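(* Let $N\ge 2$, let $\Omega\subset\mathbb{R}^N$ be a bounded domain (a nonempty bounded connected open set), and let $H:\Omega\to\mathbb{R}$ be locally Lipschitz continuous in $\Omega$. Let $u:\overline{\Omega}\to\mathbb{R}$ be lower semicontinuous on $\overline{\Omega}$ and a viscosity supersolution of $M(u)=NH$ in $\Omega$, and let $v:\overline{\Omega}\to\mathbb{R}$ be upper semicontinuous on $\overline{\Omega}$ and a viscosity subsolution of $M(v)=NH$ in $\Omega$. Assume that $u\ge v$ on $\partial\Omega$. Then $u\ge v$ in $\Omega$, and hence either $u\equiv v$ in $\Omega$ or $u>v$ in $\Omega$ (at every point).
   Context: For a $C^2$ function $\varphi$, $M(\varphi):=\operatorname{div}\left(\frac{D\varphi}{\sqrt{1+|D\varphi|^2}}\right)$, where $D\varphi$ is the gradient of $\varphi$. The equation $M(u)=NH$ is the prescribed mean curvature equation. Viscosity sense (standard definition): a lower semicontinuous $u$ is a viscosity supersolution of $M(u)=NH$ in $\Omega$ if for every $\varphi\in C^2(\Omega)$ and every $x\in\Omega$ at which $u-\varphi$ attains a local minimum, $M(\varphi)(x)\le NH(x)$. An upper semicontinuous $v$ is a viscosity subsolution if for every $\varphi\in C^2(\Omega)$ and every $x\in\Omega$ at which $v-\varphi$ attains a local maximum, $M(\varphi)(x)\ge NH(x)$. *)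

(* Defs.v *)
From mathcomp Require Import all_boot all_order all_algebra.
From mathcomp Require Import all_classical all_reals all_analysis.

Set Implicit Arguments.
Unset Strict Implicit.
Unset Printing Implicit Defensive.

Import Order.TTheory GRing.Theory Num.Theory.
Import numFieldNormedType.Exports.

Local Open Scope classical_set_scope.
Local Open Scope ring_scope.

(* The library norm `|x| on 'rV[R]_N is the sup norm.  It is used below only
   through notions that do not depend on the choice of the norm (topology,
   boundedness, local Lipschitz continuity, derivability); the length of a
   gradient is the Euclidean one, [enorm]. *)

Section Domains.
Context {R : realType} {N : nat}.
Implicit Types A Omega : set 'rV[R]_N.

Definition boundary A : set 'rV[R]_N := closure A `\` A°.

Definition bounded_domain Omega : Prop :=
  [/\ Omega !=set0, open Omega, connected Omega & bounded_set Omega].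

End Domains.

Section Regularity.
Context {R : realType} {N : nat}.
Implicit Types (A Omega : set 'rV[R]_N) (f : 'rV[R]_N -> R).

(* Functions defined on A are represented by total functions whose values
   outside A are irrelevant: semicontinuity is relative to the topology that A
   inherits (in [subspace A], the points outside A are isolated). *)
Definition lsc_on A f : Prop :=
  @lower_semicontinuous (subspace A) R (EFin \o f).

Definition usc_on A f : Prop := lsc_on A (\- f).

Definition locally_lipschitz_on A f : Prop :=
  forall x, A x -> exists2 V, nbhs x V & [lipschitz f y | y in V `&` A].

Definition partial (i : 'I_N) f : 'rV[R]_N -> R := 'D_(delta_mx 0 i) f.

(* f is of class C^k in the open set Omega: its partial derivatives of order at
   most k exist and are continuous at every point of Omega. *)
Fixpoint of_class_C (k : nat) Omega f : Prop :=
  (forall x, Omega x -> {for x, continuous f}) /\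
  if k is k'.+1 then
    forall i : 'I_N, (forall x, Omega x -> derivable f x (delta_mx 0 i)) /\
                     of_class_C k' Omega (partial i f)
  else True.

End Regularity.

Section MeanCurvature.
Context {R : realType} {N : nat}.
Implicit Types (f phi u v : 'rV[R]_N -> R) (Omega : set 'rV[R]_N).

Definition enorm (p : 'rV[R]_N) : R := Num.sqrt (\sum_i p 0 i ^+ 2).

Definition grad f (x : 'rV[R]_N) : 'rV[R]_N := \row_i partial i f x.

Definition divergence (F : 'rV[R]_N -> 'rV[R]_N) (x : 'rV[R]_N) : R :=
  \sum_i partial i (fun y => F y 0 i) x.

Definition mean_curvature_op phi : 'rV[R]_N -> R :=
  divergence (fun y => (Num.sqrt (1 + enorm (grad phi y) ^+ 2))^-1
                         *: grad phi y).

Definition local_min_at f (x : 'rV[R]_N) : Prop :=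
  \forall y \near x, f x <= f y.

Definition local_max_at f (x : 'rV[R]_N) : Prop :=
  \forall y \near x, f y <= f x.

Definition viscosity_supersolution Omega (H u : 'rV[R]_N -> R) : Prop :=
  lsc_on Omega u /\
  forall phi x, of_class_C 2 Omega phi -> Omega x ->
    local_min_at (u \- phi) x -> mean_curvature_op phi x <= N%:R * H x.

Definition viscosity_subsolution Omega (H v : 'rV[R]_N -> R) : Prop :=
  usc_on Omega v /\
  forall phi x, of_class_C 2 Omega phi -> Omega x ->
    local_max_at (v \- phi) x -> N%:R * H x <= mean_curvature_op phi x.

End MeanCurvature.

(* Main.v *)
(* Adding a constant to [v] reduces everything to a strong comparison principle:
   if [v <= u] in a domain, then [v < u] everywhere or [v = u] everywhere.  Put
   [a := v] and [b := - u], so that [a + b <= 0].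

   There is no zeroth-order term, so the theorem on sums of the theory of
   viscosity solutions must be used in a quantitative form.  It comes from the
   fact that the operator [\tr (At p *m X)] is linear in [X], with
   [At p = S^T *m S].  At a contact of [a y + b x] with a smooth function, the
   sup-convolutions of [a] and [b], composed with the affine maps
   [w |-> y + k w S] and [w |-> x + k w T], satisfy Poisson inequalities up to
   small errors.  So does their sum, because one of them may be replaced on a
   sphere by a harmonic polynomial (Bernstein approximation and decomposition
   of polynomials into [|x|^2]-multiples of harmonic ones); touching the sum from
   above by a quadratic gives [sum_ineq].

   Doubling with the profiles [sqrt |h|] and then [M |h| - c |h|^(3/2)], with
   [S] and [T] coupled by the reflection along [h], gives
   [a (x + h) + b x <= M |h|], so only bounded slopes enter afterwards.  If the
   contact set [a + b = 0] is not open, some ball of radius [r] around [y1] meets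
   it only at a point [z1] of its sphere; doubling with [|h|^2 / (2 t)] plus a
   small multiple of the barrier [(2 - |x - y1|^2 / r^2)^m], [m] large,
   contradicts the inequality as [t] tends to 0, since [Smat p] is Lipschitz
   in [p].  Hence the contact set is open, and it is relatively closed. *)
Require Import Defs.
From mathcomp Require Import all_boot all_order all_algebra.
From mathcomp Require Import all_classical all_reals all_analysis.
From mathcomp Require Import ring lra.

Set Implicit Arguments.
Unset Strict Implicit.
Unset Printing Implicit Defensive.

Import Order.TTheory GRing.Theory Num.Theory.
Import numFieldNormedType.Exports.

Local Open Scope classical_set_scope.
Local Open Scope ring_scope.

(** The cost of the coupling shapes the proof. The penalization [|h|^2 / (2 t)] costs
    [|S - T|^2 / t], and an equation without zeroth-order term offers no strict gain against it.
    With a barrier of weight [k0 t], the two gradients differ by [g = O(k0 t m)], so the cost is of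
    order [k0^2 t m^2], the gain of the barrier of order [k0 t m^2], and the variation of [H] over a
    distance [|h| = O(t)] costs [O(t)]. Hence [k0] is fixed small first, whatever [m], and then [m]
    large. All this needs the slope [|h| / t] bounded independently of [t], which is the purpose of
    the preliminary Lipschitz bound. That bound takes two stages because localizing by [|x - z|^2]
    costs about [D / (|h| al)], with [D = a (x + h) + b x] and [al] the slope of the profile: once
    [D <= B sqrt |h|], this has the same power of [|h|] as the second derivative of [|h|^(3/2)], and
    a large [M] decides. In the theorem on sums, only quadratic test polynomials and uniform
    approximation occur; the sup-convolutions are never differentiated twice. *)

Lemma usc_compact_max (R : realType) (T : topologicalType) (K : set T)
    (F : T -> R) :
    compact K -> K !=set0 ->
    (forall x, K x -> forall e : R, 0 < e -> \forall y \near x, K y -> F y < F x + e) ->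
  exists2 x, K x & forall y, K y -> F y <= F x.
Proof.
move=> cK [x0 Kx0] uF.
have ncK := (compact_near_coveringP K).1 cK.
have [M hM] : exists M, forall y, K y -> F y < M.
  have /= := ncK R (pinfty_nbhs R) (fun M y => K y -> F y < M) _.
  move=> /(_ _)[].
    move=> x Kx.
  exists ([set y | K y -> F y < F x + 1], [set M | F x + 1 < M]).
    by split => /=; [exact: uF|apply: nbhs_pinfty_gt; rewrite num_real].
  by move=> -[y M] /= [h1 h2] Ky; apply: lt_trans h2; exact: h1.
  move=> A [_ hA]; exists (A + 1) => y Ky; apply: (hA (A+1)) => //.
  by rewrite ltrDl.
have hs : has_sup (F @` K).
  by split; [exists (F x0), x0|exists M => _ [y Ky <-]; apply/ltW/hM].
set S := sup (F @` K).
have hS y : K y -> F y <= S by move=> Ky; apply: sup_upper_bound => //; exists y.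
apply: contrapT => hn.
have ltS x : K x -> F x < S.
  move=> Kx; rewrite lt_neqAle hS// andbT; apply/eqP => e; apply: hn.
  by exists x => // y Ky; rewrite e hS.
have /= := ncK R (S^'-) (fun s y => K y -> F y < s) _.
move=> /(_ _)[].
  move=> x Kx; have Sx := ltS x Kx.
  exists ([set y | K y -> F y < F x + (S - F x) / 2],
          [set s | F x + (S - F x) / 2 < s]).
    by split => /=; [apply: uF => //; lra|apply: nbhs_left_gt; lra].
  by move=> -[y s] /= [h1 h2] Ky; apply: lt_trans h2; exact: h1.
move=> e /= e0 he.
have h : ubound (F @` K) (S - e / 2).
  move=> _ [y Ky <-]; apply/ltW/(he (S - e/2)) => //=; last by lra.
  by rewrite opprB addrC subrK gtr0_norm; lra.
have := ge_sup hs.1 h; rewrite -/S; lra.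
Qed.

(** * Euclidean geometry of row vectors *)

Section Euclid.
Context {R : realType} {N : nat}.
Implicit Types (x y z d : 'rV[R]_N) (A X : 'M[R]_N).

Definition dot x y : R := (x *m y^T) 0 0.
Definition sq x : R := dot x x.
Definition nrm x : R := Num.sqrt (sq x).

Lemma dotE x y : dot x y = \sum_i x 0 i * y 0 i.
Proof. by rewrite /dot mxE; apply: eq_bigr => i _; rewrite mxE. Qed.

Lemma dotC x y : dot x y = dot y x.
Proof. by rewrite !dotE; apply: eq_bigr => i _; rewrite mulrC. Qed.

Lemma dotDl x y z : dot (x + y) z = dot x z + dot y z.
Proof. by rewrite /dot mulmxDl mxE. Qed.

Lemma dotDr x y z : dot z (x + y) = dot z x + dot z y.
Proof. by rewrite !(dotC z) dotDl. Qed.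

Lemma dotZl a x y : dot (a *: x) y = a * dot x y.
Proof. by rewrite /dot -scalemxAl mxE. Qed.

Lemma dotZr a x y : dot x (a *: y) = a * dot x y.
Proof. by rewrite !(dotC x) dotZl. Qed.

Lemma dotNl x y : dot (- x) y = - dot x y.
Proof. by rewrite -scaleN1r dotZl mulN1r. Qed.

Lemma dotNr x y : dot x (- y) = - dot x y.
Proof. by rewrite !(dotC x) dotNl. Qed.

Lemma dot0l x : dot 0 x = 0.
Proof. by rewrite /dot mul0mx mxE. Qed.

Lemma dot0r x : dot x 0 = 0.
Proof. by rewrite dotC dot0l. Qed.

Lemma dot_mulmx x A y : dot (x *m A) y = dot x (y *m A^T).
Proof. by rewrite /dot trmx_mul trmxK mulmxA. Qed.

Lemma dot_delta x i : dot x (delta_mx 0 i) = x 0 i.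
Proof.
rewrite dotE (bigD1 i)//= big1 ?addr0 ?mxE ?eqxx ?mulr1// => j ji.
by rewrite mxE (negPf ji) andbF mulr0.
Qed.

Definition dotDE := (dotDl, dotDr, dotNl, dotNr, dotZl, dotZr, dot0l, dot0r).

Lemma sqE x : sq x = \sum_i x 0 i ^+ 2.
Proof. by rewrite /sq dotE; apply: eq_bigr => i _; rewrite expr2. Qed.

Lemma sq_ge0 x : 0 <= sq x.
Proof. by rewrite sqE sumr_ge0// => i _; rewrite sqr_ge0. Qed.

Lemma sq0 : sq 0 = 0. Proof. exact: dot0l. Qed.

Lemma sqN x : sq (- x) = sq x.
Proof. by rewrite /sq dotNl dotNr opprK. Qed.

Lemma sqZ a x : sq (a *: x) = a ^+ 2 * sq x.
Proof. by rewrite /sq dotZl dotZr mulrA expr2. Qed.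

Lemma sqD x y : sq (x + y) = sq x + 2 * dot x y + sq y.
Proof. rewrite /sq !dotDE (dotC y x); ring. Qed.

Lemma sqB x y : sq (x - y) = sq x - 2 * dot x y + sq y.
Proof. rewrite /sq !dotDE (dotC y x); ring. Qed.

Lemma sq_subC x y : sq (x - y) = sq (y - x).
Proof. by rewrite -sqN opprB. Qed.

Lemma sq_coord x i : x 0 i ^+ 2 <= sq x.
Proof.
by rewrite sqE (bigD1 i)//= lerDl sumr_ge0// => j _; rewrite sqr_ge0.
Qed.

Lemma sq_eq0 x : sq x = 0 -> x = 0.
Proof.
move=> x0; apply/rowP => i; rewrite mxE; apply/eqP.
by rewrite -sqrf_eq0 eq_le sqr_ge0 andbT -x0 sq_coord.
Qed.

Lemma sq_gt0 x : x != 0 -> 0 < sq x.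
Proof.
move=> x0; rewrite lt_neqAle sq_ge0 andbT eq_sym.
by apply: contra_neq x0; exact: sq_eq0.
Qed.

Lemma cauchy_schwarz x y : dot x y ^+ 2 <= sq x * sq y.
Proof.
have [->|y0] := eqVneq y 0; first by rewrite dot0r sq0 mulr0 expr0n.
have yp := sq_gt0 y0.
have := sq_ge0 (sq y *: x - dot x y *: y).
rewrite sqB !sqZ !dotDE => h.
have {h}: 0 <= sq y * (sq x * sq y - dot x y ^+ 2) by lra.
by rewrite pmulr_rge0// subr_ge0.
Qed.

Lemma young x y e : 0 < e -> 2 * dot x y <= e * sq x + sq y / e.
Proof.
move=> e0; have := sq_ge0 (e *: x - y); rewrite sqB sqZ dotDE => h.
rewrite -(ler_pM2l e0) mulrDr [e * (_ / e)]mulrCA divff ?gt_eqF// mulr1; lra.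
Qed.

Lemma sqD_le x y : sq (x + y) <= 2 * sq x + 2 * sq y.
Proof. have := sq_ge0 (x - y); rewrite sqB (sqD x y); lra. Qed.

Lemma nrm_ge0 x : 0 <= nrm x. Proof. exact: sqrtr_ge0. Qed.

Lemma nrm_sq x : nrm x ^+ 2 = sq x.
Proof. by rewrite sqr_sqrtr// sq_ge0. Qed.

Lemma nrm0 : nrm 0 = 0. Proof. by rewrite /nrm sq0 sqrtr0. Qed.

Lemma nrmN x : nrm (- x) = nrm x.
Proof. by rewrite /nrm sqN. Qed.

Lemma nrm_subC x y : nrm (x - y) = nrm (y - x).
Proof. by rewrite /nrm sq_subC. Qed.

Lemma nrmZ a x : nrm (a *: x) = `|a| * nrm x.
Proof. by rewrite /nrm sqZ sqrtrM ?sqr_ge0// sqrtr_sqr. Qed.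

Lemma dot_nrm x y : `|dot x y| <= nrm x * nrm y.
Proof.
rewrite -ler_sqr ?nnegrE ?mulr_ge0 ?nrm_ge0// exprMn !nrm_sq.
by rewrite real_normK ?num_real// cauchy_schwarz.
Qed.

Lemma nrm_triangle x y : nrm (x + y) <= nrm x + nrm y.
Proof.
rewrite -ler_sqr ?nnegrE ?addr_ge0 ?nrm_ge0// nrm_sq sqD -!nrm_sq.
by have := dot_nrm x y; have := ler_norm (dot x y); nra.
Qed.

Lemma nrm_lt x e : 0 < e -> (nrm x < e) = (sq x < e ^+ 2).
Proof.
by move=> e0; rewrite -nrm_sq ltr_sqr ?nnegrE ?nrm_ge0 ?ltW.
Qed.

Lemma nrm_le x e : 0 <= e -> (nrm x <= e) = (sq x <= e ^+ 2).
Proof.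
by move=> e0; rewrite -nrm_sq ler_sqr ?nnegrE ?nrm_ge0.
Qed.

Lemma nrm_coord x i : `|x 0 i| <= nrm x.
Proof.
rewrite -ler_sqr ?nnegrE ?nrm_ge0// real_normK ?num_real// nrm_sq.
exact: sq_coord.
Qed.

Lemma normr_le_nrm x : `|x| <= nrm x.
Proof.
rewrite [leLHS]/Num.norm /= mx_normrE; apply/bigmax_leP; split; first exact: nrm_ge0.
by move=> [i j] _ /=; rewrite (ord1 i) nrm_coord.
Qed.

Lemma coord_le_normr x i : `|x 0 i| <= `|x|.
Proof.
by rewrite [leRHS]/Num.norm /= mx_normrE; apply/bigmax_geP; right; exists (0, i).
Qed.

Lemma sq_le_normr x : sq x <= N%:R * `|x| ^+ 2.
Proof.
rewrite sqE; have -> : N%:R * `|x| ^+ 2 = \sum_(i < N) `|x| ^+ 2.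
  by rewrite sumr_const card_ord mulr_natl.
apply: ler_sum => i _; rewrite -real_normK ?num_real//.
by rewrite ler_sqr ?nnegrE// coord_le_normr.
Qed.

(** Euclidean balls, given by squared radii so that no root occurs, form a basis of the sup-norm
    topology. In the converse, [N.+1] keeps the quotient positive even for [N = 0], and a radius at
    most 1 gives [|y - x|^2 <= |y - x|]. *)
Lemma nbhs_sqP x (P : set 'rV[R]_N) :
  nbhs x P <-> exists2 e : R, 0 < e & forall y, sq (y - x) < e -> P y.
Proof.
split => [/nbhs_normP[e /= e0 h]|[e e0 h]].
  exists (e ^+ 2); first exact: exprn_gt0.
  move=> y; rewrite -nrm_lt// => ye; apply: h => /=.
  by rewrite distrC; apply: le_lt_trans ye; exact: normr_le_nrm.
have e'0 : 0 < e / N.+1%:R by rewrite divr_gt0.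
apply/nbhs_ballP; exists (Num.min 1 (e / N.+1%:R)); first by rewrite /= lt_min ltr01.
move=> y; rewrite -ball_normE /= distrC lt_min => /andP[h1 h2]; apply: h.
apply: le_lt_trans (sq_le_normr _) _.
have t0 := normr_ge0 (y - x).
have h3 : `|y - x| ^+ 2 <= `|y - x| by rewrite expr2; nra.
rewrite ltr_pdivlMr// in h2; apply: le_lt_trans h2.
rewrite mulrC ler_pM// ?ler_nat//.
Qed.

End Euclid.

(** * Second-order expansions at a point *)

Section Jets.
Context {R : realType} {N : nat}.
Implicit Types (x y z d p q a b : 'rV[R]_N) (A X Y : 'M[R]_N).
Implicit Types (f g : 'rV[R]_N -> R).

Definition bf X a b : R := dot (a *m X) b.
Notation qf X a := (bf X a a).

Lemma bfE X a b : bf X a b = \sum_i \sum_j a 0 i * X i j * b 0 j.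
Proof.
rewrite /bf dotE exchange_big /=; apply: eq_bigr => j _.
by rewrite mxE mulr_suml.
Qed.

Lemma bfDl X a b d : bf X (a + b) d = bf X a d + bf X b d.
Proof. by rewrite /bf mulmxDl dotDl. Qed.

Lemma bfDr X a b d : bf X d (a + b) = bf X d a + bf X d b.
Proof. by rewrite /bf dotDr. Qed.

Lemma bfZl X k a b : bf X (k *: a) b = k * bf X a b.
Proof. by rewrite /bf -scalemxAl dotZl. Qed.

Lemma bfZr X k a b : bf X a (k *: b) = k * bf X a b.
Proof. by rewrite /bf dotZr. Qed.

Lemma bfNl X a b : bf X (- a) b = - bf X a b.
Proof. by rewrite -scaleN1r bfZl mulN1r. Qed.

Lemma bfNr X a b : bf X a (- b) = - bf X a b.
Proof. by rewrite -scaleN1r bfZr mulN1r. Qed.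

Lemma bf0l X b : bf X 0 b = 0.
Proof. by rewrite /bf mul0mx dot0l. Qed.

Lemma bf0r X b : bf X b 0 = 0.
Proof. by rewrite /bf dot0r. Qed.

Definition bfVE := (bfDl, bfDr, bfNl, bfNr, bfZl, bfZr, bf0l, bf0r).

Lemma bf_tr X a b : bf X^T a b = bf X b a.
Proof. by rewrite /bf dot_mulmx trmxK dotC. Qed.

Lemma bf_sym X a b : X^T = X -> bf X a b = bf X b a.
Proof. by move=> {1}<-; rewrite bf_tr. Qed.

Lemma bf_mxD X Y a b : bf (X + Y) a b = bf X a b + bf Y a b.
Proof. by rewrite /bf mulmxDr dotDl. Qed.

Lemma bf_mxZ k X a b : bf (k *: X) a b = k * bf X a b.
Proof. by rewrite /bf -scalemxAr dotZl. Qed.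

Lemma bf_mxN X a b : bf (- X) a b = - bf X a b.
Proof. by rewrite -scaleN1r bf_mxZ mulN1r. Qed.

Lemma bf_mx0 a b : bf 0 a b = 0.
Proof. by rewrite /bf mulmx0 dot0l. Qed.

Lemma bf_mx1 a b : bf 1%:M a b = dot a b.
Proof. by rewrite /bf mulmx1. Qed.

Lemma bf_outer p q a b : bf (p^T *m q) a b = dot a p * dot q b.
Proof.
rewrite /bf mulmxA; have -> : a *m p^T = (dot a p)%:M.
  by rewrite [LHS]mx11_scalar.
by rewrite mul_scalar_mx dotZl.
Qed.

Definition bf_mxE := (bf_mxD, bf_mxN, bf_mxZ, bf_mx0, bf_mx1, bf_outer).

Lemma bf_conj A X a b : bf (A *m X *m A^T) a b = bf X (a *m A) (b *m A).
Proof. by rewrite /bf !mulmxA dot_mulmx trmxK. Qed.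

Lemma trace_outer p q : \tr (p^T *m q) = dot p q.
Proof. by rewrite mxtrace_mulC /mxtrace big_ord1 -/(dot q p) dotC. Qed.

Definition mxn X : R := \sum_i \sum_j `|X i j|.

Lemma mxn_ge0 X : 0 <= mxn X.
Proof. by apply: sumr_ge0 => i _; apply: sumr_ge0. Qed.

Lemma bf_le X a b : `|bf X a b| <= mxn X * (nrm a * nrm b).
Proof.
rewrite bfE mulr_suml; apply: le_trans (ler_norm_sum _ _ _) _.
apply: ler_sum => i _; rewrite mulr_suml.
apply: le_trans (ler_norm_sum _ _ _) _; apply: ler_sum => j _.
have -> : a 0 i * X i j * b 0 j = X i j * (a 0 i * b 0 j) by ring.
by rewrite !normrM ler_wpM2l// ler_pM// nrm_coord.
Qed.

Lemma qf_le X a : `|qf X a| <= mxn X * sq a.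
Proof. by apply: le_trans (bf_le _ _ _) _; rewrite -expr2 nrm_sq. Qed.

(** A Peano expansion of order two at the single point [x]: no derivative has to exist elsewhere,
    and [X] is not assumed symmetric. This passes through products, roots and powers, and it is all
    that touching arguments use. *)
Definition D2 f x p X := forall e : R, 0 < e -> exists2 r : R, 0 < r &
  forall d, sq d < r -> `|f (x + d) - f x - dot p d - qf X d / 2| <= e * sq d.

Lemma D2_cst c x : D2 (fun=> c) x 0 0.
Proof.
move=> e e0; exists 1 => // d _.
by rewrite dot0l bf_mx0 subrr mul0r !subr0 normr0 mulr_ge0 ?sq_ge0// ltW.
Qed.

Lemma D2_coord i x : D2 (fun y => y 0 i) x (delta_mx 0 i) 0.
Proof.
move=> e e0; exists 1 => // d _.
rewrite mxE dotC dot_delta bf_mx0 mul0r subr0.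
by rewrite [_ + d _ _]addrC addrK subrr normr0 mulr_ge0 ?sq_ge0// ltW.
Qed.

Lemma D2_sq z x : D2 (fun y => sq (y - z)) x (2 *: (x - z)) (2 *: 1%:M).
Proof.
move=> e e0; exists 1 => // d _.
rewrite (_ : x + d - z = (x - z) + d); last by rewrite addrAC.
rewrite sqD bf_mxE dotZl bf_mx1 -/(sq d) mulrAC divff// mul1r.
rewrite (_ : _ - _ = 0) ?normr0 ?mulr_ge0 ?sq_ge0 ?ltW//; ring.
Qed.

Lemma D2_add f g x p q X Y :
  D2 f x p X -> D2 g x q Y -> D2 (fun y => f y + g y) x (p + q) (X + Y).
Proof.
move=> hf hg e e0.
have [|r r0 h] := hf (e / 2); first lra.
have [|r' r'0 h'] := hg (e / 2); first lra.
exists (Num.min r r'); first by rewrite lt_min r0.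
move=> d; rewrite lt_min => /andP[/h {}h /h' {}h'].
rewrite dotDl bf_mxE.
have -> : f (x + d) + g (x + d) - (f x + g x) - (dot p d + dot q d)
   - (qf X d + qf Y d) / 2 =
   (f (x + d) - f x - dot p d - qf X d / 2) +
   (g (x + d) - g x - dot q d - qf Y d / 2) by lra.
by apply: le_trans (ler_normD _ _) _; lra.
Qed.

Lemma D2_mul f g x p q X Y :
  D2 f x p X -> D2 g x q Y -> D2 (fun y => f y * g y) x (f x *: q + g x *: p)
    (f x *: Y + g x *: X + p^T *m q + q^T *m p).
Proof.
move=> hf hg e e0.
(* [K] dominates all first- and second-order data, [e1] controls the two Peano remainders, and
   [m <= 1] makes the products of order three and four small. *)
pose K : R := 1 + `|f x| + `|g x| + nrm p + nrm q + mxn X + mxn Y.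
have [n1 n2] := (normr_ge0 (f x), normr_ge0 (g x)).
have [n3 n4] := (nrm_ge0 p, nrm_ge0 q).
have [n5 n6] := (mxn_ge0 X, mxn_ge0 Y).
have K1 : 1 <= K by rewrite /K; lra.
have K0 : 0 < K by lra.
have KK : 0 < 16 * K ^+ 2 by rewrite mulr_gt0// exprn_gt0.
pose e1 := Num.min 1 (e / (8 * K)).
have e10 : 0 < e1 by rewrite lt_min ltr01 divr_gt0//; lra.
have e11 : e1 <= 1 by rewrite ge_min lexx.
have e12 : e1 * (8 * K) <= e by rewrite -ler_pdivlMr ?ge_min ?lexx ?orbT//; lra.
have [r r0 h] := hf _ e10.
have [r' r'0 h'] := hg _ e10.
pose m := Num.min 1 (e / (16 * K ^+ 2)).
have m0 : 0 < m by rewrite lt_min ltr01 divr_gt0.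
have m1 : m <= 1 by rewrite ge_min lexx.
have m2 : m * (16 * K ^+ 2) <= e by rewrite -ler_pdivlMr// ge_min lexx orbT.
exists (Num.min (m ^+ 2) (Num.min r r')); first by rewrite !lt_min r0 r'0 exprn_gt0.
move=> d; rewrite !lt_min -nrm_lt// => /and3P[dm /h {}h /h' {}h'].
have := qf_le X d; have := qf_le Y d.
have := dot_nrm p d; have := dot_nrm q d.
move: h h'; rewrite !dotDE !bf_mxE (dotC d p) (dotC d q).
rewrite -!nrm_sq; have s0 := nrm_ge0 d; set n := nrm d in dm s0 *.
move: (dot p d) (dot q d) (qf X d) (qf Y d) => P Q A B.
set r1 := f (x + d) - _ - _ - _; set t1 := g (x + d) - _ - _ - _.
have -> : f (x + d) = f x + P + A / 2 + r1 by rewrite /r1; ring.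
have -> : g (x + d) = g x + Q + B / 2 + t1 by rewrite /t1; ring.
move: r1 t1 => r1 t1 hr ht hQ hP hB hA.
set U := A / 2 + r1; set V := B / 2 + t1.
have n20 : 0 <= n ^+ 2 by rewrite sqr_ge0.
have i2 : `|2^-1 : R| = 2^-1 by rewrite ger0_norm// invr_ge0.
have hU : `|U| <= K * n ^+ 2.
  rewrite /U; apply: le_trans (ler_normD _ _) _; rewrite normrM i2.
  have : e1 * n ^+ 2 <= n ^+ 2 by rewrite ler_piMl.
  have : 0 <= mxn X * n ^+ 2 by rewrite mulr_ge0.
  have : (1 + mxn X) * n ^+ 2 <= K * n ^+ 2.
    by rewrite ler_wpM2r// /K; clear - n1 n2 n3 n4 n6; lra.
  clear - hA hr; lra.
have hV : `|V| <= K * n ^+ 2.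
  rewrite /V; apply: le_trans (ler_normD _ _) _; rewrite normrM i2.
  have : e1 * n ^+ 2 <= n ^+ 2 by rewrite ler_piMl.
  have : 0 <= mxn Y * n ^+ 2 by rewrite mulr_ge0.
  have : (1 + mxn Y) * n ^+ 2 <= K * n ^+ 2.
    by rewrite ler_wpM2r// /K; clear - n1 n2 n3 n4 n5; lra.
  clear - hB ht; lra.
have hP' : `|P| <= K * n by apply: le_trans hP _; rewrite ler_wpM2r// /K; clear - n1 n2 n4 n5 n6; lra.
have hQ' : `|Q| <= K * n by apply: le_trans hQ _; rewrite ler_wpM2r// /K; clear - n1 n2 n3 n5 n6; lra.
have -> : (f x + P + A / 2 + r1) * (g x + Q + B / 2 + t1) - f x * g x -
    (f x * Q + g x * P) - (f x * B + g x * A + P * Q + Q * P) / 2 =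
    f x * t1 + g x * r1 + P * V + Q * U + U * V by rewrite /U /V; field.
have b1 : `|f x * t1| <= K * (e1 * n ^+ 2).
  by rewrite normrM ler_pM// /K; clear - n2 n3 n4 n5 n6; lra.
have b2 : `|g x * r1| <= K * (e1 * n ^+ 2).
  by rewrite normrM ler_pM// /K; clear - n1 n3 n4 n5 n6; lra.
have b3 : `|P * V| <= (K * n) * (K * n ^+ 2) by rewrite normrM ler_pM.
have b4 : `|Q * U| <= (K * n) * (K * n ^+ 2) by rewrite normrM ler_pM.
have b5 : `|U * V| <= (K * n ^+ 2) * (K * n ^+ 2) by rewrite normrM ler_pM.
have c1 : K * (e1 * n ^+ 2) * 8 <= e * n ^+ 2.
  have -> : K * (e1 * n ^+ 2) * 8 = e1 * (8 * K) * n ^+ 2 by ring.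
  by rewrite ler_wpM2r.
have c2 : (K * n) * (K * n ^+ 2) * 16 <= e * n ^+ 2.
  have -> : (K * n) * (K * n ^+ 2) * 16 = n * (16 * K ^+ 2) * n ^+ 2 by ring.
  rewrite ler_wpM2r//; apply: le_trans m2.
  by rewrite ler_wpM2r ?ltW.
have c3 : (K * n ^+ 2) * (K * n ^+ 2) <= (K * n) * (K * n ^+ 2).
  apply: ler_wpM2r; first by rewrite mulr_ge0// ltW.
  apply: ler_wpM2l; first exact: ltW.
  by rewrite expr2 ler_piMl//; clear - dm m1; lra.
have := ler_normD (f x * t1 + g x * r1 + P * V + Q * U) (U * V).
have := ler_normD (f x * t1 + g x * r1 + P * V) (Q * U).
have := ler_normD (f x * t1 + g x * r1) (P * V).
have := ler_normD (f x * t1) (g x * r1).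
have : 0 <= e * n ^+ 2 by rewrite mulr_ge0// ltW.
clear - b1 b2 b3 b4 b5 c1 c2 c3; lra.
Qed.

(** The increments [s] of the root and [T] of [f] satisfy [s (2 g + s) = T], that is
    [s = T / (2 g) - s^2 / (2 g)]. Replacing [s] by [T / (2 g)] in the square yields the
    second-order term, with an error of order three. *)
Lemma D2_sqrt f x p X : 0 < f x -> D2 f x p X ->
  let g := Num.sqrt (f x) in
  D2 (fun y => Num.sqrt (f y)) x ((2 * g)^-1 *: p)
    ((2 * g)^-1 *: (X - (2 * f x)^-1 *: (p^T *m p))).
Proof.
move=> f0 hf g e e0.
have g0 : 0 < g by rewrite sqrtr_gt0.
have gg : g ^+ 2 = f x by rewrite sqr_sqrtr// ltW.
pose C := 1 + nrm p + mxn X.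
have [n3 n5] := (nrm_ge0 p, mxn_ge0 X).
have C1 : 1 <= C by rewrite /C; lra.
pose K := 12 * C ^+ 3 / g ^+ 4 + 3 * C ^+ 2 / (4 * g ^+ 2).
have K0 : 0 < K.
  by rewrite addr_gt0// divr_gt0 ?mulr_gt0 ?exprn_gt0//; lra.
pose e1 := Num.min 1 (e * g).
have e10 : 0 < e1 by rewrite lt_min ltr01 mulr_gt0.
have e11 : e1 <= 1 by rewrite ge_min lexx.
have e12 : e1 <= e * g by rewrite ge_min lexx orbT.
have [r r0 h] := hf _ e10.
(* The last bound keeps [f (x + d)] nonnegative, so that its root squares back to it. *)
pose m := Num.min 1 (Num.min (e * g / K) (f x / (2 * C))).
have fC0 : 0 < f x / (2 * C) by rewrite divr_gt0//; lra.
have m0 : 0 < m by rewrite !lt_min ltr01 fC0 !mulr_gt0// invr_gt0.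
have m1 : m <= 1 by rewrite ge_min lexx.
have m2 : m * K <= e * g by rewrite -ler_pdivlMr// !ge_min lexx orbT.
have m3 : m * (2 * C) <= f x.
  by rewrite -ler_pdivlMr ?ge_min ?lexx ?orbT//; lra.
exists (Num.min (m ^+ 2) r); first by rewrite !lt_min r0 exprn_gt0.
move=> d; rewrite !lt_min -nrm_lt// => /andP[dm /h {}h].
have := qf_le X d; have := dot_nrm p d.
move: h; rewrite dotZl !bf_mxE (dotC d p).
rewrite -!nrm_sq; have s0 := nrm_ge0 d; set n := nrm d in dm s0 *.
move: (dot p d) (qf X d) => P A.
set r1 := f (x + d) - _ - _ - _.
have Fe : f (x + d) = f x + P + A / 2 + r1 by rewrite /r1; ring.
move: r1 Fe => r1 Fe hr hP hA.
set T := f (x + d) - f x.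
have n20 : 0 <= n ^+ 2 by rewrite sqr_ge0.
have n2n : n ^+ 2 <= n by rewrite expr2 ler_piMl//; clear - dm m1; lra.
have i2 : `|2^-1 : R| = 2^-1 by rewrite ger0_norm// invr_ge0.
pose U := A / 2 + r1.
have hU : `|U| <= C * n ^+ 2.
  rewrite /U; apply: le_trans (ler_normD _ _) _; rewrite normrM i2.
  have : e1 * n ^+ 2 <= n ^+ 2 by rewrite ler_piMl.
  have : 0 <= mxn X * n ^+ 2 by rewrite mulr_ge0.
  have : (1 + mxn X) * n ^+ 2 <= C * n ^+ 2 by rewrite ler_wpM2r// /C; clear - n3; lra.
  clear - hA hr; lra.
have hP' : `|P| <= C * n by apply: le_trans hP _; rewrite ler_wpM2r// /C; clear - n5; lra.
have TE : T = P + U by rewrite /T /U Fe; ring.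
have Cn : C * n ^+ 2 <= C * n by rewrite ler_wpM2l//; clear - C1; lra.
have hT : `|T| <= 2 * C * n.
  by rewrite TE; apply: le_trans (ler_normD _ _) _; clear - hP' hU Cn; lra.
have F0 : 0 <= f (x + d).
  have := ler_norm (- T); rewrite normrN /T.
  have : 2 * C * n <= m * (2 * C).
    by rewrite mulrC ler_wpM2r//; [clear - C1; lra|exact: ltW].
  clear - m3 hT; lra.
set G := Num.sqrt (f (x + d)).
have GG : G ^+ 2 = f (x + d) by rewrite sqr_sqrtr.
have G0 : 0 <= G by rewrite sqrtr_ge0.
rewrite -/g -gg; set s := G - g.
have sT : s * (G + g) = T by rewrite /s /T -GG -gg; ring.
have hs : `|s| * g <= `|T|.
  by rewrite -sT normrM ler_wpM2l// ger0_norm; clear - G0 g0; lra.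
have ig : 0 < g^-1 by rewrite invr_gt0.
pose a := (2 * C * n) / g.
have C0 : 0 <= C := le_trans ler01 C1.
have a0 : 0 <= a by apply: divr_ge0 (ltW g0); apply: mulr_ge0 => //; exact: mulr_ge0.
have hs' : `|s| <= a by rewrite /a ler_pdivlMr//; exact: le_trans hs hT.
have hTg : `|T / (2 * g)| <= a.
  rewrite /a normrM [`|(2 * g)^-1|]gtr0_norm ?invr_gt0 ?mulr_gt0//.
  have g2 : 0 < 2 * g by clear - g0; lra.
  apply: ler_pM => //; first by rewrite invr_ge0 ltW.
  by rewrite lef_pV2 ?posrE//; clear - g0; lra.
have e1' : s - T / (2 * g) = - (s ^+ 2 / (2 * g)).
  by rewrite -sT /s; field; rewrite gt_eqF.
have -> : (s - (2 * g)^-1 * P - (2 * g)^-1 *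
   (A - (2 * g ^+ 2)^-1 * (P * P)) / 2) =
   r1 / (2 * g) + (s ^+ 2 * (s + T / (2 * g)) / (2 * g)
    - U * (T + P) / (4 * g ^+ 2)) / (2 * g).
  have -> : s ^+ 2 * (s + T / (2 * g)) / (2 * g) =
     - ((s - T / (2 * g)) * (s + T / (2 * g))) by rewrite e1'; field; rewrite gt_eqF.
  have es : s = T / (2 * g) - s ^+ 2 / (2 * g) by rewrite -[in LHS](subrK (T / (2 * g)) s) e1' addrC.
  rewrite {1}es TE /U; field; rewrite gt_eqF//.
have b1 : `|r1 / (2 * g)| <= e * n ^+ 2 / 2.
  rewrite normrM [`|(2 * g)^-1|]gtr0_norm ?invr_gt0 ?mulr_gt0//.
  rewrite ler_pdivrMr ?mulr_gt0//; apply: le_trans hr _.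
  have -> : e * n ^+ 2 / 2 * (2 * g) = (e * g) * n ^+ 2 by field.
  by rewrite ler_wpM2r.
have b2 : `|s ^+ 2 * (s + T / (2 * g)) / (2 * g)| <= (6 * C ^+ 3 / g ^+ 4) * n ^+ 2 * n * 2.
  rewrite normrM [`|(2 * g)^-1|]gtr0_norm ?invr_gt0 ?mulr_gt0//.
  rewrite ler_pdivrMr ?mulr_gt0// normrM normrX.
  have -> : (6 * C ^+ 3 / g ^+ 4) * n ^+ 2 * n * 2 * (2 * g) = (3 / 2) * (a ^+ 2 * (a + a)).
    by rewrite /a; field; rewrite gt_eqF.
  have : `|s| ^+ 2 * `|s + T / (2 * g)| <= a ^+ 2 * (a + a).
    apply: ler_pM => //; rewrite ?sqr_ge0 ?lerXn2r ?nnegrE//.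
    by apply: le_trans (ler_normD _ _) _; rewrite lerD.
  have : 0 <= a ^+ 2 * (a + a) by rewrite mulr_ge0 ?sqr_ge0 ?addr_ge0.
  clear; lra.
have b3 : `|U * (T + P) / (4 * g ^+ 2)| <= (3 * C ^+ 2 / (4 * g ^+ 2)) * n ^+ 2 * n.
  rewrite normrM [`|(4 * g ^+ 2)^-1|]gtr0_norm ?invr_gt0 ?mulr_gt0 ?exprn_gt0//.
  rewrite ler_pdivrMr ?mulr_gt0 ?exprn_gt0// normrM.
  have -> : (3 * C ^+ 2 / (4 * g ^+ 2)) * n ^+ 2 * n * (4 * g ^+ 2) = (C * n ^+ 2) * (3 * C * n).
    by field; rewrite gt_eqF.
  by apply: ler_pM => //; apply: le_trans (ler_normD _ _) _; clear - hT hP'; lra.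
have b4 : `|(s ^+ 2 * (s + T / (2 * g)) / (2 * g) - U * (T + P) / (4 * g ^+ 2)) / (2 * g)|
   <= e * n ^+ 2 / 2.
  rewrite normrM [`|(2 * g)^-1|]gtr0_norm ?invr_gt0 ?mulr_gt0//.
  rewrite ler_pdivrMr ?mulr_gt0//; apply: le_trans (ler_normB _ _) _.
  apply: le_trans (_ : K * n * n ^+ 2 <= _).
    have -> : K * n * n ^+ 2 = 6 * C ^+ 3 / g ^+ 4 * n ^+ 2 * n * 2 +
      3 * C ^+ 2 / (4 * g ^+ 2) * n ^+ 2 * n.
      by rewrite /K; field; rewrite gt_eqF.
    clear - b2 b3; lra.
  have -> : e * n ^+ 2 / 2 * (2 * g) = e * g * n ^+ 2 by field.
  apply: ler_wpM2r => //; apply: le_trans m2; rewrite mulrC.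
  by apply: ler_wpM2r; [exact: ltW|exact: ltW].
by apply: le_trans (ler_normD _ _) _; clear - b1 b4; lra.
Qed.

Lemma D2_scale c f x p X : D2 f x p X -> D2 (fun y => c * f y) x (c *: p) (c *: X).
Proof.
move=> hf; have := D2_mul (D2_cst c x) hf.
by rewrite !scaler0 !addr0 trmx0 mulmx0 mul0mx !addr0.
Qed.

Lemma D2_cont f x p X : D2 f x p X ->
  forall e : R, 0 < e -> exists2 r : R, 0 < r &
    forall y, sq (y - x) < r -> `|f y - f x| < e.
Proof.
move=> hf e e0; have [r r0 h] := hf 1 ltr01.
pose C := 2 + nrm p + mxn X; have [n1 n2] := (nrm_ge0 p, mxn_ge0 X).
have C0 : 0 < C by rewrite /C; lra.
pose m := Num.min 1 (e / C).
have m0 : 0 < m by rewrite lt_min ltr01 divr_gt0.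
exists (Num.min r (m ^+ 2)); first by rewrite lt_min r0 exprn_gt0.
move=> y; rewrite lt_min -nrm_lt// => /andP[h1]; rewrite lt_min => /andP[h2].
rewrite ltr_pdivlMr// => h3.
have := h _ h1; rewrite [x + _]addrC subrK mul1r.
have := qf_le X (y - x); have := dot_nrm p (y - x); rewrite -nrm_sq.
have n0 := nrm_ge0 (y - x); move: (nrm _) n0 h2 h3 => n n0 h2 h3.
move: (dot _ _) (qf _ _) => P A hP hA.
have -> : f y - f x - P - A / 2 = (f y - f x) - (P + A / 2) by ring.
have nn : n ^+ 2 <= n by rewrite expr2 ler_piMl// ltW.
have : mxn X * n ^+ 2 <= mxn X * n by rewrite ler_wpM2l.
have := ler_normD (P + A / 2) (f y - f x - (P + A / 2)).
have -> : P + A / 2 + (f y - f x - (P + A / 2)) = f y - f x by ring.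
have := ler_normD P (A / 2).
have : `|A / 2| = `|A| / 2 by rewrite normrM (ger0_norm (_ : 0 <= 2^-1))// invr_ge0.
have : 0 <= mxn X * n by rewrite mulr_ge0.
move: h3; rewrite /C; lra.
Qed.

(* The exact trace needed to touch with a quadratic is that of [X] up to an
   arbitrarily small multiple of the identity. *)
Lemma D2_above f x p X e : 0 < e -> D2 f x p X -> exists2 r : R, 0 < r &
  forall d, sq d < r -> f (x + d) <= f x + dot p d + qf (X + e *: 1%:M) d / 2.
Proof.
move=> e0 hf; have [|r r0 h] := hf (e / 2); first lra.
exists r => // d /h; rewrite !bf_mxE -/(sq d) => hd.
by have := ler_norm (f (x + d) - f x - dot p d - qf X d / 2); lra.
Qed.

End Jets.

Notation qf X a := (bf X a a).

(** * Homogeneous and harmonic polynomials *)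

Section Harmonic.
Context {R : realType} {N : nat}.
Implicit Types (x y z d p q a b : 'rV[R]_N) (A X Y : 'M[R]_N).
Implicit Types (f g : 'rV[R]_N -> R).

(** Homogeneous polynomials of degree [n], as functions. They are generated by multiplications by
    coordinates, so that gradients and Laplacians come by induction. *)
Inductive hpoly : nat -> ('rV[R]_N -> R) -> Prop :=
| hpoly_cst c : hpoly 0 (fun=> c)
| hpoly_mulX i n f : hpoly n f -> hpoly n.+1 (fun x => x 0 i * f x)
| hpoly_add n f g : hpoly n f -> hpoly n g -> hpoly n (fun x => f x + g x).

Lemma hpoly_scale n c f : hpoly n f -> hpoly n (fun x => c * f x).
Proof.
elim=> {n f} [k|i n f hf IH|n f g hf IHf hg IHg].
- exact: hpoly_cst.
- have -> : (fun x => c * (x 0 i * f x)) = (fun x => x 0 i * (c * f x)).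
    by apply/funext => x; ring.
  exact: hpoly_mulX.
- have -> : (fun x => c * (f x + g x)) = (fun x => c * f x + c * g x).
    by apply/funext => x; ring.
  exact: hpoly_add.
Qed.

Lemma tr_outer p q : (p^T *m q)^T = q^T *m p.
Proof. by rewrite trmx_mul trmxK. Qed.

Definition hessian_trace f L := forall x, exists p X,
  [/\ X^T = X, D2 f x p X & \tr X = L x].

(* [G] is the gradient and [L] the Laplacian of [f], and [n * f] is Euler's
   sum [x . G x], as for a homogeneous function of degree [n]. *)
Definition euler_data n f (G : 'rV[R]_N -> 'rV[R]_N) L :=
  (forall x, exists X, [/\ X^T = X, D2 f x (G x) X & \tr X = L x]) /\
  forall x, dot (G x) x = n%:R * f x.

(** The product rule lowers the degree by one for the gradient and by two for the Laplacian; the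
    case distinctions replace negative degrees by zero. *)
Lemma hpoly_data n f : hpoly n f -> exists G L,
  [/\ euler_data n f G L,
      if n is n'.+1 then forall i, hpoly n' (fun x => G x 0 i) else G = (fun=> 0) &
      if n is n'.+2 then hpoly n' L else L = (fun=> 0)].
Proof.
elim=> {n f} [k|i n f hf [G [L [[hJ hE] hG hL]]]|
  n f g hf [G [L [[hJ hE] hG hL]]] hg [G' [L' [[hJ' hE'] hG' hL']]]].
- exists (fun=> 0), (fun=> 0); split => //; split => x; last by rewrite dot0l mul0r.
  by exists 0; rewrite trmx0 mxtrace0; split => //; apply: D2_cst.
- exists (fun x => f x *: delta_mx 0 i + x 0 i *: G x),
    (fun x => 2 * G x 0 i + x 0 i * L x); split.
  + split=> x.
      have [X [Xs hX tX]] := hJ x.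
      exists (x 0 i *: X + ((delta_mx 0 i)^T *m G x + (G x)^T *m delta_mx 0 i)).
      split.
      * by rewrite !linearD/= linearZ/= Xs !trmx_mul !trmxK [X in _ + X]addrC.
      * have := D2_mul (D2_coord i x) hX.
        by rewrite scaler0 addr0 addrC addrA.
      * rewrite !linearD/= linearZ/= tX !trace_outer [dot (delta_mx _ _) _]dotC.
        rewrite dot_delta; ring.
    rewrite dotDl !dotZl hE dotC dot_delta -natr1; ring.
  + move=> j; case: n hf hE hG hL => [|n] hf hE hG hL.
      have -> : (fun x => (f x *: delta_mx 0 i + x 0 i *: G x) 0 j) =
          (fun x => (delta_mx 0 i : 'rV[R]_N) 0 j * f x).
        by apply/funext => x; rewrite hG scaler0 addr0 !mxE mulrC.
      exact: hpoly_scale.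
    have -> : (fun x => (f x *: delta_mx 0 i + x 0 i *: G x) 0 j) =
        (fun x => (delta_mx 0 i : 'rV[R]_N) 0 j * f x + x 0 i * G x 0 j).
      by apply/funext => x; rewrite !mxE mulrC.
    by apply: hpoly_add; [exact: hpoly_scale|exact: hpoly_mulX].
  + case: n hf hE hG hL => [|[|n]] hf hE hG hL.
    * by apply/funext => x; rewrite hG hL mxE; ring.
    * have -> : (fun x => 2 * G x 0 i + x 0 i * L x) = (fun x => 2 * G x 0 i).
        by apply/funext => x; rewrite hL; ring.
      exact: hpoly_scale.
    * by apply: hpoly_add; [exact: hpoly_scale|exact: hpoly_mulX].
- exists (fun x => G x + G' x), (fun x => L x + L' x); split.
  + split=> x; last by rewrite dotDl hE hE'; ring.
    have [X [Xs hX tX]] := hJ x; have [X' [Xs' hX' tX']] := hJ' x.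
    exists (X + X'); split; first by rewrite linearD/= Xs Xs'.
      exact: D2_add.
    by rewrite linearD/= tX tX'.
  + case: n hf hg hE hE' hG hG' hL hL' => [|n] hf hg hE hE' hG hG' hL hL'.
      by apply/funext => x; rewrite hG hG' addr0.
    move=> i; have -> : (fun x => (G x + G' x) 0 i) = (fun x => G x 0 i + G' x 0 i).
      by apply/funext => x; rewrite mxE.
    exact: hpoly_add.
  + case: n hf hg hE hE' hG hG' hL hL' => [|[|n]] hf hg hE hE' hG hG' hL hL'.
    * by apply/funext => x; rewrite hL hL' addr0.
    * by apply/funext => x; rewrite hL hL' addr0.
    * exact: hpoly_add.
Qed.

Lemma hpoly_sum n (F : 'I_N -> 'rV[R]_N -> R) (s : seq 'I_N) :
  hpoly n (fun=> 0) -> (forall i, hpoly n (F i)) ->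
  hpoly n (fun x => \sum_(i <- s) F i x).
Proof.
move=> h0 hF; elim: s => [|i s IH].
  have -> // : (fun x => \sum_(i <- [::]) F i x) = fun=> 0.
  by apply/funext => x; rewrite big_nil.
have -> : (fun x => \sum_(j <- i :: s) F j x) = (fun x => F i x + \sum_(j <- s) F j x).
  by apply/funext => x; rewrite big_cons.
exact: hpoly_add.
Qed.

Hypothesis N0 : (0 < N)%N.
Let i0 := Ordinal N0.

(** Without a coordinate [hpoly n.+1] would be empty, whence the hypothesis on the dimension. *)
Lemma hpoly0 n : hpoly n (fun=> 0).
Proof.
elim: n => [|n IH]; first exact: hpoly_cst.
have -> : (fun=> 0 : R) = (fun x : 'rV[R]_N => x 0 i0 * 0).
  by apply/funext => x; rewrite mulr0.
exact: hpoly_mulX.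
Qed.

Lemma hpoly_sq n f : hpoly n f -> hpoly n.+2 (fun x => sq x * f x).
Proof.
move=> hf; have -> : (fun x => sq x * f x) =
    (fun x => \sum_(i <- enum 'I_N) x 0 i * (x 0 i * f x)).
  apply/funext => x; rewrite sqE mulr_suml big_enum /=.
  by apply: eq_bigr => i _; rewrite expr2 mulrA.
apply: hpoly_sum => [|i]; first exact: hpoly0.
by do 2 apply: hpoly_mulX.
Qed.

(** In the Laplacian of [|x|^2 f], the term [2 N f] comes from the Laplacian of [|x|^2], and the
    cross term [4 x . G x] becomes [4 n f] by Euler's relation. *)
Lemma euler_data_sq n f G L : euler_data n f G L ->
  euler_data n.+2 (fun x => sq x * f x) (fun x => sq x *: G x + f x *: (2 *: x))
    (fun x => (2 * N%:R + 4 * n%:R) * f x + sq x * L x).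
Proof.
move=> [hJ hE]; split=> x; last first.
  by rewrite dotDl !dotZl hE -/(sq x) -[n.+2]addn2 natrD; ring.
have [X [Xs hX tX]] := hJ x.
have hs : D2 (fun x => sq x) x (2 *: x) (2 *: 1%:M).
  have := D2_sq 0 x; rewrite subr0.
  have -> // : (fun y : 'rV[R]_N => sq (y - 0)) = fun y => sq y.
  by apply/funext => y; rewrite subr0.
have := D2_mul hs hX; set Y := _ + _ + _ + _ => h.
exists Y; split => //.
  have As : (2 *: 1%:M : 'M[R]_N)^T = 2 *: 1%:M by rewrite linearZ/= trmx1.
  rewrite /Y; move: (2 *: x) (2 *: 1%:M : 'M[R]_N) As => w A As.
  by rewrite !linearD/= !linearZ/= Xs As !tr_outer -!addrA [X in _ + (_ + X)]addrC.
rewrite /Y !linearD/= !trace_outer !linearZ/= tX mxtrace1.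
rewrite !dotDE (dotC x) hE; ring.
Qed.

Lemma euler_data_scale c n f G L : euler_data n f G L ->
  euler_data n (fun x => c * f x) (fun x => c *: G x) (fun x => c * L x).
Proof.
move=> [hJ hE]; split => x; last by rewrite dotZl hE; ring.
have [X [Xs hX tX]] := hJ x; exists (c *: X); split.
- by rewrite linearZ/= Xs.
- exact: D2_scale.
- by rewrite linearZ/= tX.
Qed.

Lemma euler_data_sub n f g G G' L L' : euler_data n f G L -> euler_data n g G' L' ->
  euler_data n (fun x => f x - g x) (fun x => G x - G' x) (fun x => L x - L' x).
Proof.
move=> [hJ hE] /(euler_data_scale (-1))[hJ' hE']; split=> x.
  have [X [Xs hX tX]] := hJ x; have [X' [Xs' hX' tX']] := hJ' x.
  exists (X + X'); split; first by rewrite linearD/= Xs Xs'.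
    have := D2_add hX hX'; rewrite scaleN1r.
    have -> // : (fun y => f y + -1 * g y) = (fun y => f y - g y).
    by apply/funext => y; rewrite mulN1r.
  by rewrite linearD/= tX tX' mulN1r.
by have := hE' x; rewrite dotDl hE scaleN1r => ->; ring.
Qed.

Lemma hpoly_sub n f g : hpoly n f -> hpoly n g -> hpoly n (fun x => f x - g x).
Proof.
move=> hf hg; have -> : (fun x => f x - g x) = (fun x => f x + -1 * g x).
  by apply/funext => y; rewrite mulN1r.
exact/hpoly_add/hpoly_scale.
Qed.

(* [Lap (sq x * s) = (2N + 4n) s + sq x * Lap s] for [s] homogeneous of degree
   [n], so the equation of degree [n + 2] reduces to one of degree [n] with a
   larger constant. *)
Lemma solve_sq_lap n : forall c f, 0 < c -> hpoly n f -> exists g G L,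
  [/\ hpoly n g, euler_data n g G L & forall x, c * g x + sq x * L x = f x].
Proof.
elim/ltn_ind: n => n IH c f c0 hf.
have c1 : c != 0 by rewrite gt_eqF.
have [G [L [hd hG hL]]] := hpoly_data hf.
have simple : L = (fun=> 0) -> exists g G L,
  [/\ hpoly n g, euler_data n g G L & forall x, c * g x + sq x * L x = f x].
  move=> L0; exists (fun x => c^-1 * f x), (fun x => c^-1 *: G x), (fun x => c^-1 * L x).
  split; [exact: hpoly_scale|exact: euler_data_scale|].
  by move=> x; rewrite L0 !mulr0 addr0 mulrA divff// mul1r.
case: n => [|[|n]] in IH hf hd hG hL simple *; [exact: simple|exact: simple|].
have c'0 : 0 < c + (2 * N%:R + 4 * n%:R) by rewrite ltr_wpDr ?addr_ge0 ?mulr_ge0.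
have [s [Gs [Ls [hs hds es]]]] := IH n (leqnSn n.+1) _ _ c'0 hL.
(* The solution is [c^-1 (f - |x|^2 s)], where [s] solves the same kind of equation with right-hand
   side the Laplacian of [f] and constant [c + 2 N + 4 n]. *)
eexists; eexists; eexists; split.
- apply: (@hpoly_scale _ c^-1); apply: hpoly_sub hf (hpoly_sq hs).
- exact: euler_data_scale (euler_data_sub hd (euler_data_sq hds)).
- by move=> x /=; rewrite -es; field.
Qed.

Definition harmonic h := hessian_trace h (fun=> 0).

Lemma harmonic_add f g : harmonic f -> harmonic g -> harmonic (fun x => f x + g x).
Proof.
move=> hf hg x; have [p [X [Xs hX tX]]] := hf x; have [q [Y [Ys hY tY]]] := hg x.
exists (p + q), (X + Y); split; [by rewrite linearD/= Xs Ys|exact: D2_add|].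
by rewrite linearD/= tX tY addr0.
Qed.

Definition sphere_ext f := exists2 h, harmonic h & forall x, sq x = 1 -> h x = f x.

(** Choose [s], of degree lower by two, with the Laplacian of [|x|^2 s] equal to that of [f]. Then
    [f - |x|^2 s] is harmonic and differs from [f] by [s] on the unit sphere, so induction applies
    to [s]. *)
Lemma hpoly_sphere_ext n f : hpoly n f -> sphere_ext f.
Proof.
elim/ltn_ind: n f => n IH f hf.
have [G [L [hd hG hL]]] := hpoly_data hf.
have simple : L = (fun=> 0) -> sphere_ext f.
  by move=> L0; exists f => // x; have [X hX] := hd.1 x; exists (G x), X; rewrite L0 in hX.
case: n => [|[|n]] in IH hf hd hG hL simple *; [exact: simple|exact: simple|].
have c0 : 0 < 2 * N%:R + 4 * n%:R :> R by rewrite ltr_wpDr ?mulr_ge0// mulr_gt0 ?ltr0n.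
have [s [Gs [Ls [hs hds es]]]] := solve_sq_lap c0 hL.
have [h hh eh] := IH n (leqnSn n.+1) _ hs.
exists (fun x => (f x - sq x * s x) + h x).
  apply: harmonic_add => // x.
  have [X [Xs hX tX]] := (euler_data_sub hd (euler_data_sq hds)).1 x.
  by exists (G x - (sq x *: Gs x + s x *: (2 *: x))), X; split; rewrite // tX es subrr.
by move=> x x1; rewrite eh// x1; ring.
Qed.

(** * Polynomials and Bernstein approximation on the cube *)

Inductive polyfun : ('rV[R]_N -> R) -> Prop :=
| polyfun_cst c : polyfun (fun=> c)
| polyfun_mulX i f : polyfun f -> polyfun (fun x => x 0 i * f x)
| polyfun_add f g : polyfun f -> polyfun g -> polyfun (fun x => f x + g x).

Lemma polyfun_scale c f : polyfun f -> polyfun (fun x => c * f x).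
Proof.
elim=> {f} [k|i f hf IH|f g hf IHf hg IHg].
- exact: polyfun_cst.
- have -> : (fun x => c * (x 0 i * f x)) = (fun x => x 0 i * (c * f x)).
    by apply/funext => x; ring.
  exact: polyfun_mulX.
- have -> : (fun x => c * (f x + g x)) = (fun x => c * f x + c * g x).
    by apply/funext => x; ring.
  exact: polyfun_add.
Qed.

Lemma polyfun_sphere_ext f : polyfun f -> sphere_ext f.
Proof.
move=> hf.
(* The homogeneous factor [g] accumulates the coordinates by which [polyfun_mulX] multiplies; a
   constant times [g] is then homogeneous. *)
suff : forall n g, hpoly n g -> sphere_ext (fun x => f x * g x).
  move=> /(_ 0%N (fun=> 1) (hpoly_cst 1)) [h hh eh]; exists h => // x x1.
  by rewrite eh// mulr1.
elim: hf => {f} [c|i f _ IH|f g _ IHf _ IHg] n k hk.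
- exact/hpoly_sphere_ext/hpoly_scale/hk.
- have [h hh eh] := IH _ _ (hpoly_mulX i hk); exists h => // x x1.
  by rewrite eh//; ring.
- have [h hh eh] := IHf _ _ hk; have [h' hh' eh'] := IHg _ _ hk.
  exists (fun x => h x + h' x); first exact: harmonic_add.
  by move=> x x1; rewrite eh// eh'//; ring.
Qed.

(* Bernstein's operator, as the expectation of [g] under the binomial law
   built one trial at a time. *)
Fixpoint bernstein n (g : nat -> R) (t : R) : R :=
  if n is n'.+1 then t * bernstein n' (fun k => g k.+1) t + (1 - t) * bernstein n' g t
  else g 0%N.

(** The bracket is the second moment around [s] of a binomial variable: variance plus squared bias.
    Conditioning on one trial moves [s] to [s - 1] or leaves it, which is why [s] is arbitrary in
    the induction. *)
Lemma bernstein_le n : forall (g : nat -> R) (t c a b s : R), 0 <= t <= 1 ->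
  (forall k, (k <= n)%N -> `|g k - c| <= a + b * (k%:R - s) ^+ 2) ->
  `|bernstein n g t - c| <= a + b * (n%:R * (t * (1 - t)) + (n%:R * t - s) ^+ 2).
Proof.
elim: n => [|n IH] g t c a b s t01 hg /=.
  by rewrite !mul0r add0r; exact: hg.
have h1 : `|bernstein n (fun k => g k.+1) t - c| <=
    a + b * (n%:R * (t * (1 - t)) + (n%:R * t - (s - 1)) ^+ 2).
  apply: IH => // k kn; apply: le_trans (hg k.+1 kn) _.
  by rewrite -natr1 (_ : k%:R + 1 - s = k%:R - (s - 1))//; ring.
have h2 : `|bernstein n g t - c| <=
    a + b * (n%:R * (t * (1 - t)) + (n%:R * t - s) ^+ 2).
  by apply: IH => // k kn; apply: hg; rewrite leqW.
have [t0 t1] := andP t01.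
have -> : t * bernstein n (fun k => g k.+1) t + (1 - t) * bernstein n g t - c =
  t * (bernstein n (fun k => g k.+1) t - c) + (1 - t) * (bernstein n g t - c) by ring.
apply: le_trans (ler_normD _ _) _; rewrite !normrM (ger0_norm t0).
rewrite (ger0_norm (_ : 0 <= 1 - t)); last lra.
rewrite -natr1.
have -> : a + b * ((n%:R + 1) * (t * (1 - t)) + ((n%:R + 1) * t - s) ^+ 2) =
  t * (a + b * (n%:R * (t * (1 - t)) + (n%:R * t - (s - 1)) ^+ 2)) +
  (1 - t) * (a + b * (n%:R * (t * (1 - t)) + (n%:R * t - s) ^+ 2)) by ring.
by apply: lerD; rewrite ler_wpM2l//; lra.
Qed.


(** Unlike the ball, a product is stable under resetting one coordinate to a node of [[-1, 1]], so
    Bernstein's operator can act on the coordinates one by one. *)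
Definition cube : set 'rV[R]_N := [set x | forall i, `|x 0 i| <= 1].

Lemma ball_cube x : sq x <= 1 -> cube x.
Proof.
by move=> x1 i; apply: le_trans (nrm_coord _ _) _; rewrite nrm_le// expr1n.
Qed.

Definition papprox f := forall e : R, 0 < e ->
  exists2 p, polyfun p & forall x, cube x -> `|f x - p x| <= e.

Lemma papprox_comb i f g : papprox f -> papprox g ->
  papprox (fun x => (1 + x 0 i) / 2 * f x + (1 - (1 + x 0 i) / 2) * g x).
Proof.
move=> hf hg e e0; have [p hp ep] := hf e e0; have [q hq eq] := hg e e0.
exists (fun x => (2^-1 * p x + x 0 i * (2^-1 * p x)) +
  (2^-1 * q x + x 0 i * (- 2^-1 * q x))).
  by apply: polyfun_add; apply: polyfun_add; do ?apply: polyfun_mulX;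
    exact: polyfun_scale.
move=> x xc; have [{}ep {}eq] := (ep x xc, eq x xc).
have /andP[x1 x2] : - 1 <= x 0 i <= 1 by rewrite -ler_norml xc.
set t := (1 + x 0 i) / 2.
have [t0 t1] : 0 <= t /\ 0 <= 1 - t by rewrite /t; lra.
have -> : t * f x + (1 - t) * g x - (2^-1 * p x + x 0 i * (2^-1 * p x) +
  (2^-1 * q x + x 0 i * (- 2^-1 * q x))) =
  t * (f x - p x) + (1 - t) * (g x - q x) by rewrite /t; field.
clearbody t; apply: le_trans (ler_normD _ _) _.
rewrite !normrM (ger0_norm t0) (ger0_norm t1).
have -> : e = t * e + (1 - t) * e by ring.
by apply: lerD; apply: ler_wpM2l.
Qed.

Lemma papprox_bernstein i n (F : nat -> 'rV[R]_N -> R) :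
  (forall k, papprox (F k)) ->
  papprox (fun x => bernstein n (fun k => F k x) ((1 + x 0 i) / 2)).
Proof.
elim: n F => [|n IH] F hF /=; first exact: hF.
exact: papprox_comb (IH _ _) (IH _ _).
Qed.

Lemma papprox_lim f :
  (forall e : R, 0 < e -> exists2 g, papprox g & forall x, cube x -> `|f x - g x| <= e) ->
  papprox f.
Proof.
move=> h e e0; have [|g hg eg] := h (e / 2); first lra.
have [|p hp ep] := hg (e / 2); first lra.
exists p => // x xc; have := eg x xc; have := ep x xc.
have := ler_normD (f x - g x) (g x - p x); rewrite subrKA; lra.
Qed.

Definition setc i (c : R) x : 'rV[R]_N := \row_j (if j == i then c else x 0 j).

Lemma setc_sub_sq i c c' x y : sq (setc i c x - setc i c' y) <= sq (x - y) + (c - c') ^+ 2.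
Proof.
rewrite !sqE !(bigD1 i (P := xpredT))//= addrC !mxE eqxx lerD2r.
rewrite -[leLHS]add0r lerD ?sqr_ge0//.
by rewrite le_eqVlt (eq_bigr (fun j => (x - y) 0 j ^+ 2)) ?eqxx// => j /negPf ji; rewrite !mxE ji.
Qed.

Lemma setc_id i x : setc i (x 0 i) x = x.
Proof. by apply/rowP => j; rewrite mxE; case: eqP => [->|]. Qed.

Lemma setc_cube i c x : `|c| <= 1 -> cube x -> cube (setc i c x).
Proof. by move=> c1 xc j; rewrite mxE; case: eqP. Qed.

Definition lip_on (A : set 'rV[R]_N) (L : R) f :=
  forall x y, A x -> A y -> `|f x - f y| <= L * nrm (x - y).

(** Induction on a list of coordinates through which [f] factors: Bernstein's operator in one of
    them needs only the restrictions of [f] to its nodes, which depend on the remaining ones and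
    have the same Lipschitz constant. *)
Lemma lipschitz_papprox (L : R) f : 0 <= L -> lip_on cube L f -> papprox f.
Proof.
move=> L0 fL.
suff : forall (s : seq 'I_N) f, lip_on cube L f ->
    (forall x y, cube x -> cube y -> (forall i, i \in s -> x 0 i = y 0 i) -> f x = f y) ->
    papprox f.
  move=> /(_ (enum 'I_N) f fL); apply=> x y _ _ xy; congr f.
  by apply/rowP => i; apply: xy; rewrite mem_enum.
have c0 : cube 0 by move=> i; rewrite mxE normr0.
elim=> [|i s IH] {f fL} f fL fs.
  move=> e e0; exists (fun=> f 0); first exact: polyfun_cst.
  by move=> x xc; rewrite (fs x 0)// subrr normr0 ltW.
have unit k n : (k <= n)%N -> `|2 * (k%:R / n%:R) - 1 : R| <= 1.
  move=> kn; have h : 0 <= (k%:R / n%:R : R) <= 1.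
    rewrite divr_ge0//=; case: n kn => [|n] kn; first by rewrite invr0 mulr0.
    by rewrite ler_pdivrMr// mul1r ler_nat.
  by rewrite ler_norml; lra.
apply: papprox_lim => e e0.
(* The total error is at most [2 L e']. For a deviation [w] of the frequency [k / n] from [t], the
   bound [2 |w| <= e' + w^2 / e'] has the quadratic form required by [bernstein_le], and its
   variance part is at most [L e'] because [n e'^2 >= 1]. *)
pose e' := e / (2 * (L + 1)).
have e'0 : 0 < e' by rewrite divr_gt0//; lra.
have e'L : L * e' <= e / 2.
  have -> : e / 2 = (L + 1) * e' by rewrite /e'; field; lra.
  by apply: ler_wpM2r; lra.
clearbody e'; pose n := (Num.truncn (e'^-1 ^+ 2)).+1.
have n0 : 0 < n%:R :> R by rewrite ltr0n.
have ne' : 1 <= n%:R * e' ^+ 2.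
  have : e'^-1 ^+ 2 <= n%:R by apply/ltW/truncnS_gt.
  by rewrite exprVn -div1r ler_pdivrMr ?exprn_gt0.
(* The node is [2 k / n - 1]; [minn k n] keeps it in [[-1, 1]] for every index, since
   [papprox_bernstein] quantifies over all of them. *)
exists (fun x => bernstein n (fun k => f (setc i (2 * (minn k n)%:R / n%:R - 1) x)) ((1 + x 0 i) / 2)).
  apply: papprox_bernstein => k; have kn := geq_minr k n.
  apply: IH => [x y xc yc|x y xc yc xy].
    apply: le_trans (fL _ _ _ _) _; try by apply: setc_cube => //; rewrite -mulrA unit.
    rewrite ler_wpM2l// nrm_le ?nrm_ge0// nrm_sq.
    by apply: le_trans (setc_sub_sq _ _ _ _ _) _; rewrite subrr expr0n addr0.
  apply: fs => [||j]; try by apply: setc_cube => //; rewrite -mulrA unit.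
  by rewrite inE !mxE; case: eqP => //= _; exact: xy.
move=> x xc; have /andP[x1 x2] : - 1 <= x 0 i <= 1 by rewrite -ler_norml xc.
set t := (1 + x 0 i) / 2.
have t01 : 0 <= t <= 1 by rewrite /t; lra.
rewrite distrC; apply: le_trans (@bernstein_le n _ t (f x) (L * e') (L / (n%:R ^+ 2 * e')) (n%:R * t) t01 _) _.
  move=> k kn; rewrite (minn_idPl kn).
  apply: le_trans (fL _ _ _ _) _ => //; first by apply: setc_cube => //; rewrite -mulrA unit.
  have -> : L * e' + L / (n%:R ^+ 2 * e') * (k%:R - n%:R * t) ^+ 2 =
    L * (e' + (k%:R - n%:R * t) ^+ 2 / (n%:R ^+ 2 * e')) by ring.
  apply: ler_wpM2l => //.
  rewrite -{2}(setc_id i x) nrm_le; last first.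
    by rewrite addr_ge0 ?(ltW e'0)// divr_ge0 ?sqr_ge0// mulr_ge0 ?sqr_ge0// ltW.
  apply: le_trans (setc_sub_sq _ _ _ _ _) _; rewrite subrr sq0 add0r.
  have -> : 2 * k%:R / n%:R - 1 - x 0 i = 2 * ((k%:R - n%:R * t) / n%:R).
    by rewrite /t; field; rewrite gt_eqF.
  have -> : (k%:R - n%:R * t) ^+ 2 / (n%:R ^+ 2 * e') = ((k%:R - n%:R * t) / n%:R) ^+ 2 / e'.
    by field; rewrite !gt_eqF.
  move: (_ / n%:R) => w.
  have -> : (e' + w ^+ 2 / e') ^+ 2 = (2 * w) ^+ 2 + (e' - w ^+ 2 / e') ^+ 2.
    by field; rewrite gt_eqF.
  by rewrite lerDl sqr_ge0.
rewrite subrr expr0n addr0.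
have : L / (n%:R ^+ 2 * e') * (n%:R * (t * (1 - t))) <= L * e'.
  have -> : L / (n%:R ^+ 2 * e') * (n%:R * (t * (1 - t))) = L * (t * (1 - t) / (n%:R * e')).
    by field; rewrite !gt_eqF.
  rewrite ler_wpM2l// ler_pdivrMr ?mulr_gt0//.
  have : t * (1 - t) <= 1 by nra.
  lra.
lra.
Qed.

End Harmonic.

(** * Poisson inequalities in the viscosity sense *)

Section Comparison.
Context {R : realType} {N : nat}.
Implicit Types (x y z d p q a b : 'rV[R]_N) (X Y Z : 'M[R]_N).
Implicit Types (f g : 'rV[R]_N -> R) (A : set 'rV[R]_N).

Definition usc_in A f x := forall e : R, 0 < e -> exists2 r : R, 0 < r &
  forall y, A y -> sq (y - x) < r -> f y < f x + e.

Lemma usc_in_max A f : compact A -> A !=set0 -> (forall x, A x -> usc_in A f x) ->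
  exists2 x, A x & forall y, A y -> f y <= f x.
Proof.
move=> cA A0 fA; apply: usc_compact_max => // x Ax e e0.
have [r r0 h] := fA x Ax e e0.
by apply/nbhs_sqP; exists r => // y yr Ay; exact: h.
Qed.

Lemma usc_inD A f g x : usc_in A f x -> usc_in A g x -> usc_in A (fun y => f y + g y) x.
Proof.
move=> hf hg e e0; have [|r r0 h] := hf (e / 2); first lra.
have [|r' r'0 h'] := hg (e / 2); first lra.
exists (Num.min r r'); first by rewrite lt_min r0.
by move=> y Ay; rewrite lt_min => /andP[/(h y Ay) + /(h' y Ay)]; lra.
Qed.

Lemma D2_usc A f x p X : D2 f x p X -> usc_in A f x.
Proof.
move=> /D2_cont hf e /hf[r r0 h]; exists r => // y _ /h.
by move=> /(le_lt_trans (ler_norm _)); lra.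
Qed.

Lemma lip_usc A (L : R) f x : lip_on A L f -> A x -> usc_in A f x.
Proof.
move=> fL Ax e e0; pose r := e / (1 + `|L|).
have L0 := normr_ge0 L; have r0 : 0 < r by rewrite divr_gt0//; lra.
exists (r ^+ 2); first exact: exprn_gt0.
move=> y Ay; rewrite -nrm_lt// => yr.
have := le_lt_trans (ler_norm _) (le_lt_trans (fL y x Ay Ax) (_ : _ < e)).
rewrite -ltrBlDl; apply.
rewrite /r ltr_pdivlMr in yr; last lra.
have := nrm_ge0 (y - x); have := ler_norm L; nra.
Qed.

Lemma usc_in_sub A B f x : B `<=` A -> usc_in A f x -> usc_in B f x.
Proof.
by move=> BA fA e /fA[r r0 h]; exists r => // y /BA; exact: h.
Qed.

Lemma compact_closed_ball z (c : R) : compact [set x | sq (x - z) <= c].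
Proof.
apply: bounded_closed_compact.
  exists (nrm z + Num.sqrt c); split; first exact: num_real.
  move=> M hM x /= xc; apply: le_trans (normr_le_nrm _) _; apply: le_trans (ltW hM).
  rewrite -{1}(subrK z x); apply: le_trans (nrm_triangle _ _) _.
  by rewrite addrC lerD2l; apply: ler_wsqrtr.
rewrite -openC openE => x /= /negP; rewrite -ltNge => xc.
have [|r r0 h] := @D2_cont _ _ _ _ _ _ (D2_sq z x) (sq (x - z) - c); first lra.
apply/nbhs_sqP; exists r => // y /h; rewrite distrC.
move=> /(le_lt_trans (ler_norm _)) ?; apply/negP; rewrite -ltNge; lra.
Qed.

(** The inequality [Laplacian f >= c] in the open unit ball in the viscosity sense, tested by
    quadratic polynomials touching from above. *)
Definition lapsub (c : R) f := forall x, sq x < 1 -> forall p X, X^T = X ->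
  (exists2 r : R, 0 < r & forall d, sq d < r ->
     f (x + d) <= f x + dot p d + bf X d d / 2) -> c <= \tr X.

Hypothesis N0 : (0 < N)%N.
Let Nr0 : 0 < N%:R :> R. Proof. by rewrite ltr0n. Qed.

(** At an interior maximum of [f - g], the expansion of [g] plus a small multiple of the identity is
    an admissible test. The multiple raises the trace by half of [c - G x], so the trace stays below
    [c], a contradiction; the maximum is on the sphere. *)
Lemma lapsub_le c f g G k : (forall x, sq x <= 1 -> usc_in [set y | sq y <= 1] f x) ->
  lapsub c f -> hessian_trace g G -> (forall x, sq x < 1 -> G x < c) ->
  (forall x, sq x = 1 -> f x <= g x + k) -> forall x, sq x <= 1 -> f x <= g x + k.
Proof.
move=> fu fl gG Gc fg.
have [|||x /= x1 xm] := @usc_in_max [set y | sq y <= 1] (fun y => f y + (-1) * g y).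
- have := @compact_closed_ball 0 1.
  by rewrite (_ : [set x | sq (x - 0) <= 1] = [set y | sq y <= 1])//;
    apply/funext => y; rewrite /= subr0.
- by exists 0 => /=; rewrite sq0.
- move=> x x1; apply: usc_inD; first exact: fu.
  have [p [X [_ hX _]]] := gG x.
  by apply: D2_usc; apply: D2_scale; exact: hX.
move=> y0 y01; suff hx : f x <= g x + k by have := xm _ y01; lra.
move: {y0 y01} x1 => x1.
move: x1; rewrite le_eqVlt => /orP[/eqP/fg//|x1].
have [p [X [Xs hX tX]]] := gG x.
have e0 : 0 < (c - G x) / (2 * N%:R).
  by rewrite divr_gt0 ?subr_gt0 ?Gc// mulr_gt0.
have [r r0 h] := D2_above e0 hX.
have x1' : 0 < 1 - sq x by rewrite subr_gt0.
have [r' r'0 h'] := D2_cont (D2_sq 0 x) x1'.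
suff : c <= \tr (X + ((c - G x) / (2 * N%:R)) *: 1%:M).
  rewrite linearD/= linearZ/= tX mxtrace1.
  have -> : (c - G x) / (2 * N%:R) * N%:R = (c - G x) / 2 by field; rewrite gt_eqF.
  by have := Gc _ x1; lra.
apply: (fl x x1 p); first by rewrite linearD/= linearZ/= trmx1 Xs.
exists (Num.min r r'); first by rewrite lt_min r0.
move=> d; rewrite lt_min => /andP[/h {}h dr'].
have xd : `|sq (x + d - 0) - sq (x - 0)| < 1 - sq x by apply: h'; rewrite addrC addKr.
rewrite !subr0 in xd; have {}xd := le_lt_trans (ler_norm _) xd.
have := xm (x + d) _; lra.
Qed.

Lemma hessian_trace_add f g F G : hessian_trace f F -> hessian_trace g G ->
  hessian_trace (fun x => f x + g x) (fun x => F x + G x).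
Proof.
move=> hf hg x; have [p [X [Xs hX tX]]] := hf x; have [q [Y [Ys hY tY]]] := hg x.
exists (p + q), (X + Y); split; [by rewrite linearD/= Xs Ys|exact: D2_add|].
by rewrite linearD/= tX tY.
Qed.

Lemma hessian_trace_scale k f F : hessian_trace f F ->
  hessian_trace (fun x => k * f x) (fun x => k * F x).
Proof.
move=> hf x; have [p [X [Xs hX tX]]] := hf x.
exists (k *: p), (k *: X); split; [by rewrite linearZ/= Xs|exact: D2_scale|].
by rewrite linearZ/= tX.
Qed.

Lemma hessian_trace_sq k :
  hessian_trace (fun x => k * (sq x - 1)) (fun=> k * (2 * N%:R)).
Proof.
apply: hessian_trace_scale => x; exists (2 *: (x - 0)), (2 *: 1%:M + 0); split.
- by rewrite addr0 linearZ/= trmx1.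
- have := D2_add (D2_sq 0 x) (D2_cst (-1) x); rewrite addr0.
  rewrite (_ : (fun y => sq (y - 0) + -1) = (fun y => sq y - 1))//.
  by apply/funext => y; rewrite subr0.
- by rewrite addr0 linearZ/= mxtrace1.
Qed.

Lemma hessian_trace_qf Z : Z^T = Z ->
  hessian_trace (fun x => bf Z x x / 2) (fun=> \tr Z).
Proof.
move=> Zs x; exists (x *m Z), Z; split => // e e0; exists 1 => // d _.
rewrite !bfVE (bf_sym d x Zs) -/(bf Z x d).
by rewrite (_ : _ - _ = 0) ?normr0 ?mulr_ge0 ?sq_ge0 ?ltW//; field.
Qed.

(* The sum of two viscosity subsolutions of Poisson equations is one:
   [f1] is replaced on the unit sphere by a harmonic polynomial. *)
Lemma lapsub_add c1 c2 (L1 L2 : R) f1 f2 Z :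
  0 <= L1 -> lip_on cube L1 f1 -> lip_on cube L2 f2 ->
  lapsub c1 f1 -> lapsub c2 f2 -> Z^T = Z ->
  (forall x, sq x <= 1 -> f1 x + f2 x <= bf Z x x / 2) -> 0 <= f1 0 + f2 0 ->
  c1 + c2 <= \tr Z.
Proof.
move=> L10 lf1 lf2 s1 s2 Zs f12 f0.
have u (f : 'rV[R]_N -> R) (L : R) : lip_on cube L f ->
    forall x, sq x <= 1 -> usc_in [set y | sq y <= 1] f x.
  move=> fL x x1; apply: (@usc_in_sub cube) => [y|]; first exact: ball_cube.
  exact/(lip_usc fL)/ball_cube.
apply/ler_addgt0Pl => e e0.
have [k k0 ke] : exists2 k : R, 0 < k & 8 * k * N%:R + 4 * k <= e.
  exists (e / (8 * N%:R + 4)); first by rewrite divr_gt0//; have := Nr0; lra.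
  rewrite le_eqVlt; apply/orP; left; apply/eqP; field.
  by apply: lt0r_neq0; have := Nr0; lra.
have [p hp ep] := lipschitz_papprox L10 lf1 k0.
have [h hh eh] := polyfun_sphere_ext N0 hp.
have hk x : sq x = 1 -> `|f1 x - h x| <= k.
  by move=> x1; rewrite eh//; apply/ep/ball_cube; rewrite x1.
have N2 : 2 * N%:R != 0 :> R by rewrite gt_eqF// mulr_gt0.
(* [f1] is compared with [h] plus a multiple of [|x|^2 - 1], which vanishes on the sphere and brings
   the Laplacian to [c1 - k]. *)
have i1 := lapsub_le (u _ _ lf1) s1
  (hessian_trace_add hh (hessian_trace_sq ((c1 - k) / (2 * N%:R)))) (k := k).
have {}i1 : f1 0 <= h 0 + (c1 - k) / (2 * N%:R) * (sq (0 : 'rV[R]_N) - 1) + k.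
  apply: i1; last by rewrite sq0.
    by move=> x _; rewrite add0r divfK//; lra.
  by move=> x x1; rewrite x1 subrr mulr0 addr0; have := hk x x1; have := ler_norm (f1 x - h x); lra.
(* [f2] is compared with the quadratic form minus [h], corrected to have Laplacian [c2 - k]. Adding
   the two bounds at the origin cancels [h]. *)
pose kk := (c2 - k - \tr Z) / (2 * N%:R).
have i2 := lapsub_le (u _ _ lf2) s2 (hessian_trace_add
  (hessian_trace_add (hessian_trace_qf Zs) (hessian_trace_scale (-1) hh))
    (hessian_trace_sq kk)) (k := k).
have {}i2 : f2 0 <= bf Z 0 0 / 2 + -1 * h 0 + kk * (sq (0 : 'rV[R]_N) - 1) + k.
  apply: i2; last by rewrite sq0.
    by move=> x _; rewrite /kk divfK//; lra.
  move=> x x1; rewrite x1 subrr mulr0 addr0.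
  have := hk x x1; have := ler_norm (h x - f1 x); rewrite distrC.
  have := f12 x; rewrite x1 => /(_ (lexx _)); lra.
move: i1 i2; rewrite sq0 bf0l /kk => i1 i2.
have : (c1 - k) / (2 * N%:R) + (c2 - k - \tr Z) / (2 * N%:R) <= 2 * k by lra.
rewrite -mulrDl ler_pdivrMr ?mulr_gt0//; lra.
Qed.

End Comparison.

(** * The operator and its dependence on the gradient *)

Section Operator.
Context {R : realType} {N : nat}.
Implicit Types (x y z d p q s a b : 'rV[R]_N) (X Y Z P Q S T : 'M[R]_N).
Implicit Types (f g : 'rV[R]_N -> R) (A : set 'rV[R]_N).

Definition W2 p : R := 1 + sq p.
Definition W p : R := Num.sqrt (W2 p).
Definition At p : 'M[R]_N := 1%:M - (W2 p)^-1 *: (p^T *m p).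
(** This is the trace of [At p *m X]. Expanding the divergence gives [M(phi) = Eop (D phi) (D^2 phi)
    / W (D phi)], so that the equation reads [Eop = N H W]. *)
Definition Eop p X : R := \tr X - bf X p p / W2 p.

Lemma W2_ge1 p : 1 <= W2 p.
Proof. by rewrite lerDl sq_ge0. Qed.

Lemma W2_gt0 p : 0 < W2 p.
Proof. exact: lt_le_trans ltr01 (W2_ge1 p). Qed.

Lemma W_sq p : W p ^+ 2 = W2 p.
Proof. by rewrite sqr_sqrtr// ltW// W2_gt0. Qed.

Lemma W_ge1 p : 1 <= W p.
Proof. by rewrite -[leLHS]sqrtr1; apply: ler_wsqrtr; exact: W2_ge1. Qed.

Lemma W_gt0 p : 0 < W p.
Proof. exact: lt_le_trans ltr01 (W_ge1 p). Qed.

Lemma W2N p : W2 (- p) = W2 p. Proof. by rewrite /W2 sqN. Qed.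
Lemma WN p : W (- p) = W p. Proof. by rewrite /W W2N. Qed.

Lemma EopN p X : Eop (- p) X = Eop p X.
Proof. by rewrite /Eop !bfVE W2N opprK. Qed.

Lemma Eop_At p X S : S^T *m S = At p -> \tr (S *m X *m S^T) = Eop p X.
Proof.
move=> h; rewrite mxtrace_mulC mulmxA h /At mulmxBl mul1mx linearB/=.
rewrite -scalemxAl linearZ/= /Eop; congr (_ - _); rewrite mulrC; congr (_ / _).
by rewrite -mulmxA mxtrace_mulC /mxtrace big_ord1.
Qed.

Definition psd X := forall a, 0 <= bf X a a.

(** Summing the form over the vectors [a_j e_i - a_i e_j] gives [2 (|a|^2 tr X - a X a)]; no
    diagonalization is involved. *)
Lemma psd_le X a : psd X -> bf X a a <= sq a * \tr X.
Proof.
move=> hX.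
have bd i j : bf X (delta_mx 0 i) (delta_mx 0 j) = X i j.
  rewrite /bf dot_delta -rowE mxE//.
have : 0 <= \sum_i \sum_j bf X (a 0 j *: delta_mx 0 i - a 0 i *: delta_mx 0 j)
   (a 0 j *: delta_mx 0 i - a 0 i *: delta_mx 0 j).
  by apply: sumr_ge0 => i _; apply: sumr_ge0.
have -> : \sum_i \sum_j bf X (a 0 j *: delta_mx 0 i - a 0 i *: delta_mx 0 j)
   (a 0 j *: delta_mx 0 i - a 0 i *: delta_mx 0 j) =
  \sum_i \sum_j (X i i * a 0 j ^+ 2) + \sum_i \sum_j (a 0 i ^+ 2 * X j j)
  - \sum_i \sum_j (a 0 i * X i j * a 0 j) - \sum_i \sum_j (a 0 j * X j i * a 0 i).
  rewrite -!big_split/= -!sumrB; apply: eq_bigr => i _.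
  rewrite -!big_split/= -!sumrB; apply: eq_bigr => j _.
  by rewrite !bfVE !bd; ring.
rewrite (exchange_big _ _ _ _ _ (fun i j => a 0 j * X j i * a 0 i))/= -!bfE.
have -> : \sum_i \sum_j X i i * a 0 j ^+ 2 = sq a * \tr X.
  rewrite sqE mulrC /mxtrace mulr_suml; apply: eq_bigr => i _.
  by rewrite mulr_sumr.
have -> : \sum_i \sum_j a 0 i ^+ 2 * X j j = sq a * \tr X.
  rewrite sqE /mxtrace mulr_suml; apply: eq_bigr => i _.
  by rewrite mulr_sumr.
lra.
Qed.

Lemma psd_bf_le X a b (t : R) : X^T = X -> psd X -> 0 < t ->
  `|2 * bf X a b| <= (t * sq a + sq b / t) * \tr X.
Proof.
move=> Xs hX t0; pose u := Num.sqrt t; have u0 : 0 < u by rewrite sqrtr_gt0.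
have uu : u ^+ 2 = t by rewrite sqr_sqrtr// ltW.
have h1 := hX (u *: a + u^-1 *: b); have h2 := hX (u *: a - u^-1 *: b).
have l1 := psd_le (u *: a) hX; have l2 := psd_le (u^-1 *: b) hX.
rewrite !sqZ exprVn uu in l1 l2.
rewrite mulrDl -(mulrC t^-1) ler_norml.
move: h1 h2 l1 l2; rewrite !bfVE (bf_sym b a Xs).
have -> : u * (u^-1 * bf X a b) = bf X a b by rewrite mulrA divff ?mul1r ?gt_eqF.
have -> : u^-1 * (u * bf X a b) = bf X a b by rewrite mulrA mulVf ?mul1r ?gt_eqF.
lra.
Qed.

(** Ellipticity: [At p] is bounded below by [1 / W2 p]. *)
Lemma Eop_trace_le p X : psd X -> \tr X <= W2 p * Eop p X.
Proof.
move=> hX; have := psd_le p hX; rewrite /Eop mulrBr [W2 p * (_ / _)]mulrCA.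
rewrite divff ?gt_eqF ?W2_gt0// mulr1 /W2; lra.
Qed.

(** Moving the gradient by at most [t] changes the operator by [O(t) tr X], and for [X >= 0]
    ellipticity bounds the trace by the operator itself. Hence the error is relative, whatever the
    size of [X]. *)
Lemma Eop_shift p s X (t : R) : X^T = X -> psd X -> 0 < t -> t <= 1 -> sq s <= t ^+ 2 ->
  Eop (p + s) X <= (1 + 4 * t * W2 p ^+ 2) * Eop p X.
Proof.
move=> Xs hX t0 t1 st.
have tX : 0 <= \tr X.
  by apply: sumr_ge0 => i _; have := hX (delta_mx 0 i); rewrite /bf dot_delta -rowE mxE.
have st' : sq s / t <= t by rewrite ler_pdivrMr// -expr2.
have w := W2_gt0 p; have w1 := W2_ge1 p; have w' := W2_gt0 (p + s); have w'1 := W2_ge1 (p + s).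
have tt : t ^+ 2 <= t by rewrite expr2 ler_piMl// ltW.
pose k := 2 * t * W2 p.
have h1 : `|bf X (p + s) (p + s) - bf X p p| <= k * \tr X.
  have -> : bf X (p + s) (p + s) - bf X p p = 2 * bf X p s + bf X s s.
    by rewrite !bfVE (bf_sym s p Xs); ring.
  apply: le_trans (ler_normD _ _) _.
  have := psd_bf_le p s Xs hX t0; have := psd_le s hX; rewrite (ger0_norm (hX s)).
  have : (t * sq p + sq s / t + sq s) * \tr X <= k * \tr X.
    rewrite ler_wpM2r// /k /W2; have := sq_ge0 p; have := sq_ge0 s; nra.
  lra.
have h2 : `|W2 (p + s) - W2 p| <= k.
  rewrite /W2 sqD.
  have := young p s t0; have := young p (- s) t0; rewrite dotNr sqN.
  have := sq_ge0 s; have := sq_ge0 p; rewrite ler_norml /k /W2.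
  nra.
have h3 : bf X p p <= sq p * \tr X := psd_le p hX.
have h4 := Eop_trace_le p hX.
have e1 : Eop (p + s) X - Eop p X =
   ((W2 (p + s) - W2 p) * (bf X p p / W2 p) - (bf X (p + s) (p + s) - bf X p p)) / W2 (p + s).
  by rewrite /Eop; field; rewrite !gt_eqF.
have h5 : bf X p p / W2 p <= \tr X.
  rewrite ler_pdivrMr//; apply: le_trans h3 _; rewrite mulrC ler_wpM2l// /W2; lra.
have h6 : 0 <= bf X p p / W2 p by apply: divr_ge0; [exact: hX|exact: ltW].
have k0 : 0 <= k by rewrite /k; nra.
have h7 : (W2 (p + s) - W2 p) * (bf X p p / W2 p) <= k * \tr X.
  apply: le_trans (ler_norm _) _; rewrite normrM ler_pM//.
  by rewrite (ger0_norm h6).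
have h8 : Eop (p + s) X - Eop p X <= 2 * k * \tr X.
  rewrite e1 ler_pdivrMr//.
  have : 2 * k * \tr X <= 2 * k * \tr X * W2 (p + s) by rewrite ler_peMr// mulr_ge0// mulr_ge0.
  have := ler_norm (- (bf X (p + s) (p + s) - bf X p p)); rewrite normrN; lra.
have : 2 * k * \tr X <= 4 * t * W2 p ^+ 2 * Eop p X.
  have -> : 4 * t * W2 p ^+ 2 * Eop p X = 2 * k * (W2 p * Eop p X) by rewrite /k; ring.
  by rewrite ler_wpM2l// mulr_ge0.
lra.
Qed.

Lemma W_shift p s (t : R) : 0 < t -> t <= 1 -> sq s <= t ^+ 2 ->
  `|W2 (p + s) - W2 p| <= 2 * t * W2 p /\ `|W (p + s) - W p| <= 2 * t * W2 p.
Proof.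
move=> t0 t1 st.
have st' : sq s / t <= t by rewrite ler_pdivrMr// -expr2.
have tt : t ^+ 2 <= t by rewrite expr2 ler_piMl// ltW.
have h2 : `|W2 (p + s) - W2 p| <= 2 * t * W2 p.
  rewrite /W2 sqD.
  have := young p s t0; have := young p (- s) t0; rewrite dotNr sqN.
  have := sq_ge0 s; have := sq_ge0 p; rewrite ler_norml /W2.
  nra.
split=> //; apply: le_trans h2; rewrite -!W_sq subr_sqr normrM ler_peMr//.
have := W_ge1 p; have := W_ge1 (p + s) => w w'.
by rewrite ger0_norm; lra.
Qed.

(* The operator is linear in the Hessian: with the Hessian bounded below, a
   small change of the gradient is absorbed by a factor close to 1. *)
Lemma Eop_freeze p (k0 l e : R) : 0 <= l -> 0 < e -> exists2 h : R, 0 < h &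
  forall s X (k : R), X^T = X -> (forall a, - l * sq a <= bf X a a) ->
    sq s < h -> `|k - k0| < h -> k * W (p + s) <= Eop (p + s) X ->
    k0 * W p - e <= Eop p X.
Proof.
move=> l0 e0; pose w := W2 p; have w1 : 1 <= w := W2_ge1 p.
pose M := 4 * w ^+ 2 * (`|k0| * W p + e + l * N%:R) + 2 * w * (l + `|k0| + 1) + W p.
have Wp := W_ge1 p; have nk := normr_ge0 k0.
have NN : 0 <= N%:R :> R by [].
have w20 : 0 <= w ^+ 2 by rewrite sqr_ge0.
have M0 : 0 < M.
  have a1 : 0 <= `|k0| * W p by apply: mulr_ge0; lra.
  have a2 : 0 <= l * N%:R by apply: mulr_ge0.
  have a3 : 0 <= 4 * w ^+ 2 * (`|k0| * W p + e + l * N%:R) by apply: mulr_ge0; lra.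
  have a4 : 0 <= 2 * w * (l + `|k0| + 1) by apply: mulr_ge0; lra.
  rewrite /M; lra.
pose t := Num.min 1 (e / M).
have t0 : 0 < t by rewrite lt_min ltr01 divr_gt0.
have t1 : t <= 1 by rewrite ge_min lexx.
have tM : t * M <= e by rewrite -ler_pdivlMr// ge_min lexx orbT.
have tt : t ^+ 2 <= t by rewrite expr2 ler_piMl// ltW.
exists (t ^+ 2); first exact: exprn_gt0.
move=> s X k Xs Xl /ltW st kk hk.
(* [Eop_shift] is applied to the nonnegative [Y]; the contribution of [l I] is bounded separately.
   The constant [M] is the sum of all error coefficients. *)
pose Y := X + l *: 1%:M.
have Ys : Y^T = Y by rewrite linearD/= linearZ/= trmx1 Xs.
have Yp : psd Y by move=> a; rewrite !bf_mxE -/(sq a); have := Xl a; lra.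
have hY := Eop_shift p Ys Yp t0 t1 st.
have [h2 h3] := W_shift p t0 t1 st.
have EI q : Eop q (1%:M : 'M[R]_N) = N%:R - 1 + (W2 q)^-1.
  rewrite /Eop mxtrace1 bf_mx1 -/(sq q) (_ : sq q = W2 q - 1); last by rewrite /W2; ring.
  by field; rewrite gt_eqF ?W2_gt0.
have EY q : Eop q Y = Eop q X + l * Eop q 1%:M.
  by rewrite /Eop !bf_mxE linearD/= linearZ/=; ring.
have EIl : Eop p (1%:M : 'M[R]_N) <= N%:R.
  rewrite EI; have : (W2 p)^-1 <= 1 by rewrite invf_le1 ?W2_gt0.
  lra.
have hI : Eop p (1%:M : 'M[R]_N) - Eop (p + s) 1%:M <= 2 * t * w.
  rewrite !EI.
  have -> : N%:R - 1 + (W2 p)^-1 - (N%:R - 1 + (W2 (p + s))^-1) =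
    (W2 (p + s) - W2 p) / (W2 (p + s) * W2 p).
    by field; rewrite !gt_eqF ?W2_gt0.
  have [ww ww'] := (W2_ge1 p, W2_ge1 (p + s)).
  rewrite ler_pdivrMr ?mulr_gt0 ?W2_gt0//; apply: le_trans (ler_norm _) _.
  apply: le_trans h2 _; rewrite ler_peMr ?mulr_ge0// ?(ltW t0)//; clear - ww ww'; nra.
move: hY; rewrite !EY -/w => hY.
rewrite leNgt; apply/negP => hX.
have wt0 : 0 <= 4 * t * w ^+ 2 by apply: mulr_ge0 => //; lra.
set z := k0 * W p in hX *.
have hz : `|z| <= `|k0| * W p by rewrite /z normrM [`|W p|]ger0_norm//; lra.
have c1 : (1 + 4 * t * w ^+ 2) * Eop p X < z - e + 4 * t * w ^+ 2 * (`|k0| * W p + e).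
  have : (4 * t * w ^+ 2) * Eop p X <= 4 * t * w ^+ 2 * (`|k0| * W p + e).
    by rewrite ler_wpM2l//; have := ler_norm z; clear - hX hz e0; lra.
  clear - hX; lra.
have c2 : l * ((1 + 4 * t * w ^+ 2) * Eop p 1%:M - Eop (p + s) 1%:M) <=
    l * (4 * t * w ^+ 2 * N%:R + 2 * t * w).
  rewrite ler_wpM2l//.
  have : 4 * t * w ^+ 2 * Eop p (1%:M : 'M[R]_N) <= 4 * t * w ^+ 2 * N%:R by rewrite ler_wpM2l.
  lra.
have c3 : z - t * W p - (`|k0| + 1) * (2 * t * w) <= k * W (p + s).
  have -> : k * W (p + s) = z + (k - k0) * W p + k * (W (p + s) - W p) by rewrite /z; ring.
  have b1 : `|(k - k0) * W p| <= t * W p.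
    by rewrite normrM [`|W p|]ger0_norm ?ler_wpM2r//; clear - kk tt hk Wp; lra.
  have b2 : `|k * (W (p + s) - W p)| <= (`|k0| + 1) * (2 * t * w).
    rewrite normrM ler_pM//.
    by have := ler_normD (k - k0) k0; rewrite subrK; clear - hk kk t1 tt; lra.
  have := ler_norm (- ((k - k0) * W p)); have := ler_norm (- (k * (W (p + s) - W p))).
  rewrite !normrN; clear - b1 b2; lra.
have : t * M = 4 * t * w ^+ 2 * (`|k0| * W p + e) + l * (4 * t * w ^+ 2 * N%:R + 2 * t * w)
  + t * W p + (`|k0| + 1) * (2 * t * w) by rewrite /M; ring.
clear - c1 c2 c3 hY tM hk; lra.
Qed.

End Operator.

(** * Sup-convolutions and the theorem on sums *)

Section SumInequality.
Context {R : realType} {N : nat}.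
Implicit Types (x y z d p q s a b : 'rV[R]_N) (X Y Z P Q S T : 'M[R]_N).
Implicit Types (f g u v K : 'rV[R]_N -> R) (A Om : set 'rV[R]_N).

(** Viscosity subsolutions of [Eop = K W], tested by quadratic polynomials. Since [Eop] is odd in
    [(p, X)] and [W] is even, the negative of a supersolution is a subsolution for [- K]. *)
Definition qsub Om K u := forall x, Om x -> forall p X, X^T = X ->
  (exists2 r : R, 0 < r & forall d, sq d < r ->
     u (x + d) <= u x + dot p d + bf X d d / 2) -> K x * W p <= Eop p X.

Definition cont_at K x := forall e : R, 0 < e -> exists2 r : R, 0 < r &
  forall y, sq (y - x) < r -> `|K y - K x| < e.

Definition sq_open Om := forall x, Om x -> exists2 r : R, 0 < r &
  forall y, sq (y - x) < r -> Om y.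

Lemma touch_above_psd a Y :
  (exists2 r : R, 0 < r & forall d, sq d < r -> 0 <= dot a d + bf Y d d / 2) ->
  a = 0 /\ psd Y.
Proof.
move=> [r r0 h].
have small (v : 'rV[R]_N) : exists2 t : R, 0 < t & forall k : R, 0 < k -> k <= t -> sq (k *: v) < r.
  pose t := Num.min 1 (r / (1 + sq v)); have v0 := sq_ge0 v.
  have t0 : 0 < t by rewrite lt_min ltr01 divr_gt0//; lra.
  exists t => // k k0; rewrite le_min => /andP[k1]; rewrite ler_pdivlMr; last lra.
  rewrite sqZ; have : k ^+ 2 <= k by rewrite expr2 ler_piMl// ltW.
  nra.
have a0 : a = 0.
  apply: sq_eq0; apply/eqP; rewrite eq_le sq_ge0 andbT.
  rewrite leNgt; apply/negP => sa.
  have [t t0 ht] := small (- a).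
  pose k := Num.min t (sq a / (1 + `|bf Y a a|)).
  have ya := normr_ge0 (bf Y a a).
  have k0 : 0 < k by rewrite lt_min t0 divr_gt0//; lra.
  have kt : k <= t by rewrite ge_min lexx.
  have k2 : k * (1 + `|bf Y a a|) <= sq a.
    by rewrite -ler_pdivlMr ?ge_min ?lexx ?orbT//; lra.
  have := h _ (ht k k0 kt); rewrite !bfVE !dotDE -/(sq a).
  have -> : k * - sq a + k * (- (k * - bf Y a a)) / 2 = k * (- sq a + k * bf Y a a / 2) by ring.
  rewrite pmulr_rge0//; have := ler_norm (bf Y a a); nra.
split=> // v; have [t t0 ht] := small v.
have := h _ (ht t t0 (lexx _)); rewrite a0 dot0l add0r !bfVE.
have -> : t * (t * bf Y v v) / 2 = (t ^+ 2 / 2) * bf Y v v by ring.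
by rewrite pmulr_rge0// divr_gt0// exprn_gt0.
Qed.

(** The sup-convolution of [g] over the ball of squared radius [r], with penalty [l / 2]; the
    definition carries a maximizer along. *)
Definition supconv g (r l : R) f := forall z, exists m,
  [/\ sq m <= r, f z = g m - l / 2 * sq (z - m) &
      forall m', sq m' <= r -> g m' - l / 2 * sq (z - m') <= f z].

Lemma supconv_exists g (r l : R) : 0 < r ->
  (forall m, sq m <= r -> usc_in [set m | sq m <= r] g m) -> exists f, supconv g r l f.
Proof.
move=> r0 gu.
have H z : exists c : R, exists m, [/\ sq m <= r, c = g m - l / 2 * sq (z - m) &
      forall m', sq m' <= r -> g m' - l / 2 * sq (z - m') <= c].
  have [|||m /= mr hm] := @usc_in_max _ _ [set m | sq m <= r]
    (fun m => g m + (- (l / 2)) * sq (m - z)).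
  - have := @compact_closed_ball R N 0 r.
    by rewrite (_ : [set x | sq (x - 0) <= r] = [set y | sq y <= r])//;
      apply/funext => y; rewrite /= subr0.
  - by exists 0; rewrite /= sq0 ltW.
  - move=> m mr; apply: usc_inD; first exact: gu.
    by apply: D2_usc; apply: D2_scale; apply: D2_sq.
  exists (g m - l / 2 * sq (z - m)), m; split => // m' m'r.
  by have := hm m' m'r; rewrite !(sq_subC _ z); lra.
have [f hf] := choice H; by exists f.
Qed.

(** Only the penalty depends on the point, so [f] is Lipschitz on balls although [g] is merely
    semicontinuous. *)
Lemma supconv_lip g (r l : R) f (c : R) : 0 <= l -> supconv g r l f ->
  0 <= c -> forall x y, nrm x <= c -> nrm y <= c ->
  `|f x - f y| <= l * (c + Num.sqrt r) * nrm (x - y).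
Proof.
move=> l0 hf c0.
suff H x y : nrm x <= c -> nrm y <= c -> f x - f y <= l * (c + Num.sqrt r) * nrm (x - y).
  move=> x y xc yc; rewrite ler_norml H// andbT.
  by have := H y x yc xc; rewrite nrm_subC; lra.
move=> xc yc; have [m [mr -> _]] := hf x; have [_ [_ _ hy]] := hf y.
have := hy m mr.
have -> : sq (x - m) = sq (y - m) + 2 * dot (x - y) (y - m) + sq (x - y).
  have e : x - m = (x - y) + (y - m) by rewrite subrKA.
  by rewrite e sqD; ring.
have d1 := dot_nrm (x - y) ((x + y) - 2 *: m).
have d2 : 2 * dot (x - y) (y - m) + sq (x - y) = dot (x - y) ((x + y) - 2 *: m).
  by rewrite /sq !dotDE (dotC y x); ring.
have nm : nrm m <= Num.sqrt r by apply: ler_wsqrtr.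
have d3 : nrm ((x + y) - 2 *: m) <= 2 * (c + Num.sqrt r).
  apply: le_trans (nrm_triangle _ _) _; rewrite nrmN nrmZ ger0_norm//.
  have := nrm_triangle x y; lra.
have d4 : nrm (x - y) * nrm ((x + y) - 2 *: m) <= nrm (x - y) * (2 * (c + Num.sqrt r)).
  by rewrite ler_wpM2l ?nrm_ge0.
have d5 := ler_norm (- dot (x - y) ((x + y) - 2 *: m)); rewrite normrN in d5.
have d6 : - (2 * dot (x - y) (y - m) + sq (x - y)) <= nrm (x - y) * (2 * (c + Num.sqrt r)).
  by rewrite d2; lra.
have l2 : 0 <= l / 2 by lra.
have := ler_wpM2l l2 d6; lra.
Qed.

Lemma bf_gram S x : bf (S *m S^T) x x = sq (x *m S).
Proof. by rewrite -{1}[S]mulmx1 bf_conj bf_mx1. Qed.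

Lemma nrm_mulmx_le S x : nrm (x *m S) <= Num.sqrt (mxn (S *m S^T)) * nrm x.
Proof.
rewrite nrm_le ?mulr_ge0 ?sqrtr_ge0 ?nrm_ge0// exprMn sqr_sqrtr ?mxn_ge0// nrm_sq.
rewrite -bf_gram; exact: le_trans (ler_norm _) (qf_le _ _).
Qed.

(** Let [m] be the maximizer at [z]. The quadratic upper bound and [4 b <= l] give
    [|m|^2 <= 8 |z|^2], so near the origin the tests happen close to [y] with gradient close to [p].
    The paraboloid below [f] bounds [X] from below by [- l], and [Eop_freeze] then replaces gradient
    and point by [p] and [y]. *)
Lemma supconv_touch Om K u y p (r l b : R) f : sq_open Om -> qsub Om K u ->
  (forall d, sq d <= r -> Om (y + d)) -> 0 <= b -> 0 < l -> 4 * b <= l -> 0 < r ->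
  cont_at K y ->
  (forall d, sq d <= r -> u (y + d) - u y - dot p d <= b / 2 * sq d) ->
  supconv (fun d => u (y + d) - u y - dot p d) r l f ->
  forall e : R, 0 < e -> exists2 h : R, 0 < h & forall z, sq z < h ->
    forall s X, X^T = X ->
    (exists2 r : R, 0 < r & forall d, sq d < r ->
       f (z + d) <= f z + dot s d + bf X d d / 2) ->
    K y * W p - e <= Eop p X.
Proof.
move=> Oo uq Or b0 l0 bl r0 Kc ub hf e e0.
have [h1 h10 hfr] := Eop_freeze p (K y) (ltW l0) e0.
have [h2 h20 hK] := Kc h1 h10.
have l20 : 0 < l ^+ 2 by rewrite exprn_gt0.
pose h := Num.min (r / 16) (Num.min (h2 / 16) (h1 / (4 * l ^+ 2))).
exists h; first by rewrite !lt_min !divr_gt0// mulr_gt0.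
move=> z; rewrite !lt_min => /and3P[z1 z2 z3] s X Xs [r' r'0 ht].
rewrite ltr_pdivlMr ?mulr_gt0// in z3.
have [m [mr fz hz]] := hf z.
have lo : - (l / 2) * sq z <= f z.
  have := hz 0; rewrite sq0 subr0 addr0 dot0r subrr subr0 => /(_ (ltW r0)); lra.
have up := ub m mr; set D := z - m.
have sm : sq m <= 2 * sq z + 2 * sq D.
  have -> : m = z - D by rewrite /D opprB addrC subrK.
  by have := sqD_le z (- D); rewrite sqN.
have sz := sq_ge0 z; have sD := sq_ge0 D; have sm0 := sq_ge0 m.
have D3 : sq D <= 3 * sq z.
  move: lo; rewrite fz -/D => lo.
  have b1 : b * sq m <= b * (2 * sq z + 2 * sq D) by rewrite ler_wpM2l.
  have b2 : 4 * b * sq z <= l * sq z by rewrite ler_wpM2r.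
  have b3 : 4 * b * sq D <= l * sq D by rewrite ler_wpM2r.
  have : l * sq D <= l * (3 * sq z) by lra.
  by rewrite ler_pM2l.
have m8 : sq m <= 8 * sq z by lra.
(* The penalty with [m] fixed is a paraboloid below [f] touching it at [z]; any test from above also
   lies above this paraboloid. *)
have [es Xp] : s + l *: D = 0 /\ psd (X + l *: 1%:M).
  apply: touch_above_psd; exists r' => // d /ht hd.
  have := hf (z + d) => -[_ [_ _ /(_ m mr)]].
  have -> : z + d - m = D + d by rewrite /D addrAC.
  rewrite sqD !dotDE !bf_mxE -/(sq d) => h3.
  by move: hd h3; rewrite fz -/D; lra.
have {}es : s = - (l *: D) by apply/eqP; rewrite -addr_eq0 es.
apply: (hfr s X (K (y + m))) => //.
- by move=> a; have := Xp a; rewrite !bf_mxE -/(sq a); lra.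
- rewrite es sqN sqZ; have : l ^+ 2 * sq D <= l ^+ 2 * (3 * sq z) by rewrite ler_wpM2l// ltW.
  have : 0 <= l ^+ 2 * sq z by rewrite mulr_ge0// ltW.
  lra.
- by apply: hK; rewrite addrC addKr; lra.
(* Translating the point and its maximizer together leaves the penalty unchanged, so a test for [f]
   at [z] becomes one for [u] at [y + m], with gradient [p + s]. *)
apply: uq => //; first exact: Or.
have rm : 0 < r - sq m by lra.
have [r3 r30 h3] := D2_cont (D2_sq 0 m) rm.
exists (Num.min r3 r'); first by rewrite lt_min r30.
move=> d; rewrite lt_min => /andP[d3 /ht hd].
have mdr : sq (m + d) <= r.
  have : `|sq (m + d - 0) - sq (m - 0)| < r - sq m by apply: h3; rewrite addrC addKr.
  by rewrite !subr0 => /(le_lt_trans (ler_norm _)); lra.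
have := hf (z + d) => -[_ [_ _ /(_ _ mdr)]].
have -> : z + d - (m + d) = D by rewrite /D opprD addrACA subrr addr0.
move: hd; rewrite fz -/D !dotDE !addrA; lra.
Qed.

Lemma touch_lapsub (S : 'M[R]_N) (f : 'rV[R]_N -> R) (c h k : R) p :
  S \in unitmx -> S^T *m S = At p -> 0 < k ->
  (forall w, sq w < 1 -> sq (k *: (w *m S)) < h) ->
  (forall z, sq z < h -> forall s X, X^T = X ->
    (exists2 r : R, 0 < r & forall d, sq d < r ->
       f (z + d) <= f z + dot s d + bf X d d / 2) -> c <= Eop p X) ->
  lapsub (k ^+ 2 * c) (fun w => f (k *: (w *m S))).
Proof.
move=> Su SA k0 kh hf w w1 s X Xs [r r0 hr].
pose T := invmx S; pose Y := (k ^- 2) *: (T *m X *m T^T).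
have kn : k != 0 by rewrite gt_eqF.
have Ys : Y^T = Y by rewrite /Y linearZ/= !trmx_mul trmxK Xs mulmxA.
suff : c <= Eop p Y.
  rewrite -(Eop_At Y SA) /Y -scalemxAr -scalemxAl linearZ/=.
  have -> : S *m (T *m X *m T^T) *m S^T = X.
    rewrite !mulmxA mulmxV// mul1mx -mulmxA -trmx_mul mulmxV// trmx1 mulmx1.
    by [].
  by rewrite mulrC ler_pdivlMr ?exprn_gt0// mulrC.
apply: (hf _ (kh w w1) (k^-1 *: (s *m T^T))) => //.
pose C := Num.sqrt (mxn (T *m T^T)).
have C0 : 0 <= C by rewrite sqrtr_ge0.
exists (r * k ^+ 2 / (1 + C ^+ 2)).
  by rewrite !divr_gt0 ?mulr_gt0 ?exprn_gt0// ltr_wpDr ?sqr_ge0.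
move=> d hd; have := hr (k^-1 *: (d *m T)) _.
have -> : k *: ((w + k^-1 *: (d *m T)) *m S) = k *: (w *m S) + d.
  rewrite mulmxDl -scalemxAl -mulmxA mulVmx// mulmx1 scalerDr scalerA.
  by rewrite mulfV// scale1r.
have -> : dot s (k^-1 *: (d *m T)) = dot (k^-1 *: (s *m T^T)) d.
  by rewrite dotZr dotZl dot_mulmx trmxK.
have -> : bf X (k^-1 *: (d *m T)) (k^-1 *: (d *m T)) = bf Y d d.
  by rewrite /Y bf_mxZ bf_conj !bfVE mulrA -expr2 exprVn.
apply; rewrite sqZ -nrm_sq exprVn mulrC ltr_pdivrMr ?exprn_gt0//.
have := nrm_mulmx_le T d; rewrite -/C => hT.
have : nrm (d *m T) ^+ 2 <= C ^+ 2 * sq d.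
  by rewrite -nrm_sq -exprMn lerXn2r ?nnegrE ?mulr_ge0 ?nrm_ge0.
rewrite ltr_pdivlMr in hd; last by rewrite ltr_wpDr ?sqr_ge0.
have := sq_ge0 d; lra.
Qed.

Lemma cube_nrm x : cube x -> nrm x <= Num.sqrt N%:R.
Proof.
move=> xc; apply: ler_wsqrtr; rewrite sqE.
have -> : N%:R = \sum_(i < N) (1 : R) by rewrite sumr_const card_ord.
apply: ler_sum => i _; rewrite -real_normK ?num_real//.
by rewrite expr_le1.
Qed.

Lemma supconv_lip_mulmx g (r l k : R) f S : 0 <= l -> supconv g r l f -> 0 <= k ->
  exists2 L : R, 0 <= L & lip_on cube L (fun w => f (k *: (w *m S))).
Proof.
move=> l0 hf k0; pose C := Num.sqrt (mxn (S *m S^T)); pose c := k * (C * Num.sqrt N%:R).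
have C0 : 0 <= C by rewrite sqrtr_ge0.
have c0 : 0 <= c by rewrite !mulr_ge0// sqrtr_ge0.
have cr : 0 <= c + Num.sqrt r by rewrite addr_ge0// sqrtr_ge0.
exists (l * (c + Num.sqrt r) * (k * C)); first by rewrite !mulr_ge0.
have hn w : cube w -> nrm (k *: (w *m S)) <= c.
  move=> wc; rewrite nrmZ ger0_norm// /c ler_wpM2l//.
  by apply: le_trans (nrm_mulmx_le _ _) _; rewrite ler_wpM2l// cube_nrm.
move=> x y xc yc; apply: le_trans (supconv_lip l0 hf c0 (hn x xc) (hn y yc)) _.
rewrite -[leRHS]mulrA ler_wpM2l ?mulr_ge0// -scalerBr -mulmxBl nrmZ ger0_norm//.
by rewrite -[leRHS]mulrA ler_wpM2l// nrm_mulmx_le.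
Qed.

Lemma D2_dot p x : D2 (fun d => dot p d) x p 0.
Proof.
move=> e e0; exists 1 => // d _; rewrite bf_mx0 mul0r subr0 dotDr.
by rewrite [X in X - _ - _]addrC addrK subrr normr0 mulr_ge0 ?sq_ge0// ltW.
Qed.

Lemma usc_in_tilt A u y p B m : (forall d, B d -> A (y + d)) ->
  usc_in A u (y + m) -> usc_in B (fun d => u (y + d) - u y - dot p d) m.
Proof.
move=> AB uy.
have -> : (fun d => u (y + d) - u y - dot p d) =
    (fun d => u (y + d) + (- u y + -1 * dot p d)).
  by apply/funext => d; ring.
apply: usc_inD.
  move=> e /uy[r r0 h]; exists r => // d /AB ABd dr; apply: h => //.
  by rewrite opprD addrACA subrr add0r.
apply: usc_inD; first exact: D2_usc (D2_cst _ _).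
exact: D2_usc (D2_scale _ (D2_dot _ _)).
Qed.

(** [P] is the Hessian in the difference [d - c] and [Q] that of the localization in [c]. Both
    sup-convolutions are read in one variable [w] through [d = k w S] and [c = k w T]; their sum
    lies below a quadratic form and is nonnegative at the origin, so [lapsub_add] applies. *)
Lemma sum_ineq_eps Om K1 K2 u v x y p q P Q S T (e : R) : (0 < N)%N ->
  sq_open Om -> qsub Om K1 u -> qsub Om K2 v ->
  (forall z, Om z -> usc_in Om u z) -> (forall z, Om z -> usc_in Om v z) ->
  Om x -> Om y -> cont_at K1 y -> cont_at K2 x -> P^T = P -> Q^T = Q ->
  S \in unitmx -> T \in unitmx -> S^T *m S = At p -> T^T *m T = At q ->
  (forall e : R, 0 < e -> exists2 r : R, 0 < r & forall d c, sq d < r -> sq c < r ->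
    u (y + d) + v (x + c) <= u y + v x + dot p d - dot q c +
       (bf P (d - c) (d - c) + bf Q c c) / 2 + e * (sq d + sq c)) ->
  0 < e ->
  (K1 y * W p - e) + (K2 x * W q - e) <=
    \tr ((S - T) *m P *m (S - T)^T) + \tr (T *m Q *m T^T) +
    8 * e * (\tr (S *m S^T) + \tr (T *m T^T)).
Proof.
move=> N0 Oo u1 v1 uu vu Ox Oy c1 c2 Ps Qs Su Tu SA TA hT e0.
have [r1 r10 hr1] := hT e e0.
have [r2 r20 hr2] := Oo y Oy; have [r3 r30 hr3] := Oo x Ox.
pose r := Num.min (r1 / 2) (Num.min (r2 / 2) (r3 / 2)).
have r0 : 0 < r by rewrite !lt_min !divr_gt0.
have [rr1 rr2 rr3] : [/\ r < r1, r < r2 & r < r3].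
  by rewrite /r !gt_min; split; apply/orP; [left|right; apply/orP; left|right; apply/orP; right]; lra.
pose M := mxn P + mxn Q; have [mP mQ] := (mxn_ge0 P, mxn_ge0 Q).
have M0 : 0 <= M by rewrite addr_ge0.
(* The weight in Young's inequality for the cross terms between a point and its displacement to the
   maximizer: the share left on [d] and [c] is small relative to [e]. *)
pose t := e / (2 * M + 1).
have t0 : 0 < t by rewrite divr_gt0//; lra.
have Mt : 2 * (M * t) <= e.
  have -> : e = t * (2 * M + 1) by rewrite /t mulfVK// gt_eqF//; lra.
  lra.
pose b := M + 2 * e; have b0 : 0 <= b by rewrite /b; lra.
pose l := 4 * b + 4 * (M / t + M).
have Mt' : 0 <= M / t by rewrite divr_ge0// ltW.
have l0 : 0 < l by rewrite /l /b; lra.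
have bl : 4 * b <= l by rewrite /l; lra.
pose gu d := u (y + d) - u y - dot p d.
pose gv d := v (x + d) - v x - dot (- q) d.
have guv d c : sq d <= r -> sq c <= r ->
    gu d + gv c <= (bf P (d - c) (d - c) + bf Q c c) / 2 + e * (sq d + sq c).
  move=> dr cr; have := hr1 d c (le_lt_trans dr rr1) (le_lt_trans cr rr1).
  by rewrite /gu /gv dotNl; lra.
have [u0 v0] : gu 0 = 0 /\ gv 0 = 0.
  by rewrite /gu /gv !addr0 !dot0r !subrr ?subr0.
have Our d : sq d <= r -> Om (y + d).
  by move=> dr; apply: hr2; rewrite addrC addKr; lra.
have Ovr d : sq d <= r -> Om (x + d).
  by move=> dr; apply: hr3; rewrite addrC addKr; lra.
have s00 : sq (0 : 'rV[R]_N) <= r by rewrite sq0 ltW.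
have ub d : sq d <= r -> gu d <= b / 2 * sq d.
  move=> dr; have := guv d 0 dr s00; rewrite v0 bf0l sq0 subr0.
  have := ler_norm (bf P d d); have := qf_le P d.
  have : 0 <= mxn Q * sq d by rewrite mulr_ge0 ?sq_ge0.
  by rewrite /b /M; clear; lra.
have vb c : sq c <= r -> gv c <= b / 2 * sq c.
  move=> cr; have := guv 0 c s00 cr; rewrite u0 sub0r !bfVE sq0 opprK.
  have := ler_norm (bf P c c); have := qf_le P c.
  have := ler_norm (bf Q c c); have := qf_le Q c.
  by rewrite /b /M; clear; lra.
have [fu hfu] : exists f, supconv gu r l f.
  apply: supconv_exists => // m mr; apply: (@usc_in_tilt Om) => //.
  exact/uu/Our.
have [fv hfv] : exists f, supconv gv r l f.
  apply: supconv_exists => // m mr; apply: (@usc_in_tilt Om) => //.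
  exact/vu/Ovr.
have [h1 h10 t1] := supconv_touch Oo u1 Our b0 l0 bl r0 c1 ub hfu e0.
have [h2 h20 t2] := supconv_touch Oo v1 Ovr b0 l0 bl r0 c2 vb hfv e0.
pose Cs := mxn (S *m S^T); pose Ct := mxn (T *m T^T).
have [Cs0 Ct0] : 0 <= Cs /\ 0 <= Ct by rewrite !mxn_ge0.
pose k := Num.min 1 (Num.min (h1 / (1 + Cs)) (h2 / (1 + Ct))).
have k0 : 0 < k by rewrite !lt_min ltr01 !divr_gt0//; clear - Cs0 Ct0; lra.
have [kk1 kk2 kk3] : [/\ k <= 1, k <= h1 / (1 + Cs) & k <= h2 / (1 + Ct)].
  by rewrite /k !ge_min !lexx !orbT.
have k1 : k ^+ 2 <= k by rewrite expr2 ler_piMl// ltW.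
have small (U : 'M[R]_N) (h C : R) : 0 < h -> k <= h / (1 + C) -> C = mxn (U *m U^T) ->
    forall w : 'rV[R]_N, sq w < 1 -> sq (k *: (w *m U)) < h.
  move=> h0 kh CE w w1; have C0 : 0 <= C by rewrite CE mxn_ge0.
  rewrite ler_pdivlMr in kh; last by clear - C0; lra.
  rewrite sqZ; have : sq (w *m U) <= C * sq w.
    rewrite -bf_gram CE; exact: le_trans (ler_norm _) (qf_le _ _).
  move=> hw; have cw : C * sq w <= C by rewrite ler_piMr// ltW.
  have : k ^+ 2 * sq (w *m U) <= k * C by rewrite ler_pM ?sqr_ge0 ?sq_ge0//; exact: le_trans hw cw.
  clear - kh k0; lra.
have su : lapsub (k ^+ 2 * (K1 y * W p - e)) (fun w => fu (k *: (w *m S))).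
  exact: touch_lapsub Su SA k0 (small S h1 Cs h10 kk2 erefl) t1.
have sv : lapsub (k ^+ 2 * (K2 x * W q - e)) (fun w => fv (k *: (w *m T))).
  apply: touch_lapsub Tu TA k0 (small T h2 Ct h20 kk3 erefl) _.
  by move=> z zh s X Xs h; have := t2 z zh s X Xs h; rewrite WN EopN.
have [L1 L10 lu] := supconv_lip_mulmx S (ltW l0) hfu (ltW k0).
have [L2 L20 lv] := supconv_lip_mulmx T (ltW l0) hfv (ltW k0).
pose Z := k ^+ 2 *: ((S - T) *m P *m (S - T)^T + T *m Q *m T^T +
  (8 * e) *: (S *m S^T + T *m T^T)).
have Zs : Z^T = Z.
  have sy (A X : 'M[R]_N) : X^T = X -> (A *m X *m A^T)^T = A *m X *m A^T.
    by move=> Xs; rewrite !trmx_mul trmxK Xs mulmxA.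
  have gr (A : 'M[R]_N) : (A *m A^T)^T = A *m A^T by rewrite trmx_mul trmxK.
  have sD (A B : 'M[R]_N) : A^T = A -> B^T = B -> (A + B)^T = A + B.
    by move=> As Bs; rewrite linearD/= As Bs.
  have sZ (c : R) (A : 'M[R]_N) : A^T = A -> (c *: A)^T = c *: A.
    by move=> As; rewrite linearZ/= As.
  by apply/sZ/sD; [apply: sD; exact: sy|apply/sZ/sD; exact: gr].
(* With [a] and [a'] the displacements to the maximizers, the contact inequality holds at
   [(d + a, c + a')], and the two penalties absorb what [a] and [a'] contribute. Thus the
   sup-convolutions inherit the bound. *)
have key d c : fu d + fv c <= (bf P (d - c) (d - c) + bf Q c c) / 2 + 4 * e * (sq d + sq c).
  have [m [mr -> _]] := hfu d; have [n [nr -> _]] := hfv c.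
  have := guv m n mr nr.
  set a := m - d; set a' := n - c.
  have -> : m = d + a by rewrite /a addrC subrK.
  have -> : n = c + a' by rewrite /a' addrC subrK.
  have -> : d - (d + a) = - a by rewrite opprD addrA subrr add0r.
  have -> : c - (c + a') = - a' by rewrite opprD addrA subrr add0r.
  have -> : d + a - (c + a') = (d - c) + (a - a') by rewrite opprD addrACA.
  rewrite !sqN.
  clearbody a a'; set g := d - c; set o := a - a'.
  have g2 : sq g <= 2 * sq d + 2 * sq c.
    by have := sqD_le d (- c); rewrite sqN.
  have o2 : sq o <= 2 * sq a + 2 * sq a'.
    by have := sqD_le a (- a'); rewrite sqN.
  clearbody g o.
  have expand X (z z' : 'rV[R]_N) : X^T = X ->
    bf X (z + z') (z + z') = bf X z z + 2 * bf X z z' + bf X z' z'.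
    by move=> Xs; rewrite !bfVE (bf_sym z' z Xs); ring.
  rewrite !expand//.
  have bd X (z z' : 'rV[R]_N) : 2 * bf X z z' + bf X z' z' <=
      mxn X * (t * sq z + (1 / t + 1) * sq z').
    have h := bf_le X z z'; have h' := qf_le X z'.
    have := ler_norm (bf X z z'); have := ler_norm (bf X z' z').
    have : 2 * (nrm z * nrm z') <= t * sq z + sq z' / t.
      rewrite -!nrm_sq -subr_ge0.
      have -> : t * nrm z ^+ 2 + nrm z' ^+ 2 / t - 2 * (nrm z * nrm z') =
        (t * nrm z - nrm z') ^+ 2 / t by field; rewrite gt_eqF.
      by rewrite divr_ge0 ?sqr_ge0// ltW.
    move=> /(ler_wpM2l (mxn_ge0 X)); clear - h h'; lra.
  have bP := bd P g o; have bQ := bd Q c a'.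
  have i0 : 0 <= 1 / t + 1 by rewrite addr_ge0// divr_ge0// ltW.
  have bP' : mxn P * (t * sq g + (1 / t + 1) * sq o) <=
    mxn P * (t * (2 * sq d + 2 * sq c) + (1 / t + 1) * (2 * sq a + 2 * sq a')).
    by rewrite ler_wpM2l// lerD// ler_wpM2l// ltW.
  have bQ' : mxn Q * (t * sq c + (1 / t + 1) * sq a') <=
    mxn Q * (t * (2 * sq d + 2 * sq c) + (1 / t + 1) * (2 * sq a + 2 * sq a')).
    rewrite ler_wpM2l// lerD// ler_wpM2l//; first exact: ltW.
      by have := sq_ge0 d; have := sq_ge0 c; clear; lra.
    by have := sq_ge0 a; have := sq_ge0 a'; clear; lra.
  have d2 := sqD_le d a; have cc2 := sqD_le c a'.
  have e2 : e * (sq (d + a) + sq (c + a')) <= e * (2 * sq d + 2 * sq a + (2 * sq c + 2 * sq a')).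
    by rewrite ler_wpM2l ?lerD// ltW.
  have tot : (mxn P + mxn Q) * (t * (2 * sq d + 2 * sq c) + (1 / t + 1) * (2 * sq a + 2 * sq a')) =
    2 * (M * t) * (sq d + sq c) + 2 * (M / t + M) * (sq a + sq a').
    by rewrite /M; field; rewrite gt_eqF.
  have tot' : 2 * (M * t) * (sq d + sq c) <= e * (sq d + sq c).
    by rewrite ler_wpM2r// addr_ge0 ?sq_ge0.
  have ll : (M / t + M) * (sq a + sq a') + 2 * e * (sq a + sq a') <= l / 2 * (sq a + sq a').
    rewrite -mulrDl ler_wpM2r ?addr_ge0 ?sq_ge0// /l /b; clear - M0 Mt' e0; lra.
  have e3 : 0 <= e * (sq d + sq c) by rewrite mulr_ge0 ?addr_ge0 ?sq_ge0// ltW.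
  clear - d2 cc2 e2 bP bQ bP' bQ' tot tot' ll e3; lra.
have fin := lapsub_add N0 L10 lu lv su sv Zs.
have {}fin : k ^+ 2 * (K1 y * W p - e) + k ^+ 2 * (K2 x * W q - e) <= \tr Z.
  apply: fin.
    move=> w _; apply: le_trans (key _ _) _.
    rewrite -scalerBr -mulmxBr /Z !(bf_mxD, bf_mxZ) !bf_conj !bf_gram !sqZ !bfVE.
    rewrite le_eqVlt; apply/orP; left; apply/eqP; by field.
  rewrite /= !mul0mx !scaler0.
  have [_ [_ _ /(_ 0)]] := hfu 0; have [_ [_ _ /(_ 0)]] := hfv 0.
  rewrite !subr0 !sq0 !mulr0 u0 v0 !subr0 => /(_ (ltW r0)) + /(_ (ltW r0)); clear; lra.
move: fin; rewrite -mulrDr /Z mxtraceZ ler_pM2l ?exprn_gt0//.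
by rewrite mxtraceD mxtraceD mxtraceZ mxtraceD.
Qed.

(** The theorem on sums in trace form. No Hessians of [u] and [v] appear separately; the freedom is
    in the choice of the two square roots [S] and [T], that is, of the coupling. *)
Theorem sum_ineq Om K1 K2 u v x y p q P Q S T : (0 < N)%N ->
  sq_open Om -> qsub Om K1 u -> qsub Om K2 v ->
  (forall z, Om z -> usc_in Om u z) -> (forall z, Om z -> usc_in Om v z) ->
  Om x -> Om y -> cont_at K1 y -> cont_at K2 x -> P^T = P -> Q^T = Q ->
  S \in unitmx -> T \in unitmx -> S^T *m S = At p -> T^T *m T = At q ->
  (forall e : R, 0 < e -> exists2 r : R, 0 < r & forall d c, sq d < r -> sq c < r ->
    u (y + d) + v (x + c) <= u y + v x + dot p d - dot q c +
       (bf P (d - c) (d - c) + bf Q c c) / 2 + e * (sq d + sq c)) ->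
  K1 y * W p + K2 x * W q <=
    \tr ((S - T) *m P *m (S - T)^T) + \tr (T *m Q *m T^T).
Proof.
move=> h0 h1 h2 h3 h4 h5 h6 h7 h8 h9 h10 h11 h12 h13 h14 h15 h16.
apply/ler_addgt0Pl => e e0.
pose C := `|\tr (S *m S^T) + \tr (T *m T^T)|.
have C0 : 0 <= C by exact: normr_ge0.
pose k := e / (8 * C + 2).
have k0 : 0 < k by rewrite divr_gt0//; lra.
have := sum_ineq_eps h0 h1 h2 h3 h4 h5 h6 h7 h8 h9 h10 h11 h12 h13 h14 h15 h16 k0.
have : 8 * k * (\tr (S *m S^T) + \tr (T *m T^T)) <= 8 * k * C.
  by rewrite ler_wpM2l ?ler_norm// mulr_ge0// ltW.
have : e = 8 * k * C + 2 * k by rewrite /k; field; rewrite gt_eqF//; lra.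
lra.
Qed.

End SumInequality.

(** * Square roots of the coefficients, reflection and Lipschitz dependence *)

Section Coupling.
Context {R : realType} {N : nat}.
Implicit Types (x y z d p q e a b w : 'rV[R]_N) (X Y Z P Q S T D A B : 'M[R]_N).

(** Along [p] the matrix [At p] has eigenvalue [W^-2], so its root needs [1 - cW |p|^2 = W^-1].
    Since [|p|^2 = W^2 - 1], this gives an expression without singularity at [p = 0]. *)
Definition cW p : R := (W p * (W p + 1))^-1.
Definition Smat p : 'M[R]_N := 1%:M - cW p *: (p^T *m p).

Lemma outer_mul a b p q : (a^T *m b) *m (p^T *m q) = dot b p *: (a^T *m q).
Proof.
rewrite -mulmxA (mulmxA b); have -> : b *m p^T = (dot b p)%:M.
  by rewrite [LHS]mx11_scalar.
by rewrite mul_scalar_mx scalemxAr.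
Qed.

Lemma sq_W p : sq p = W p ^+ 2 - 1.
Proof. by rewrite W_sq /W2; ring. Qed.

Lemma Smat_tr p : (Smat p)^T = Smat p.
Proof. by rewrite /Smat linearB/= trmx1 linearZ/= tr_outer. Qed.

Lemma W_neq0 p : W p != 0.
Proof. by rewrite gt_eqF// W_gt0. Qed.

Lemma W1_neq0 p : W p + 1 != 0.
Proof. by rewrite gt_eqF// ltr_wpDl// ltW// W_gt0. Qed.

Lemma Smat_sq p : Smat p *m Smat p = At p.
Proof.
rewrite /Smat mulmxBl !mulmxBr mul1mx mulmx1 mul1mx -scalemxAl -scalemxAr.
have hc : (W2 p)^-1 = 2 * cW p - cW p ^+ 2 * sq p.
  rewrite -W_sq sq_W /cW; by field; rewrite ?W_neq0 ?W1_neq0.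
rewrite outer_mul -/(sq p) /At hc; move: (p^T *m p) => E.
by apply/matrixP => i j; rewrite !mxE; ring.
Qed.

Lemma Smat_unit p : Smat p \in unitmx.
Proof.
suff h : Smat p *m (1%:M + (W p + 1)^-1 *: (p^T *m p)) = 1%:M.
  by case: (mulmx1_unit h).
rewrite /Smat mulmxBl !mulmxDr mulmx1 mul1mx mulmx1 -scalemxAl -scalemxAr.
have hc : cW p = (W p + 1)^-1 - cW p * (W p + 1)^-1 * sq p.
  rewrite sq_W /cW; by field; rewrite ?W_neq0 ?W1_neq0.
rewrite outer_mul -/(sq p) {1}hc; move: (p^T *m p) => E.
by apply/matrixP => i j; rewrite !mxE; ring.
Qed.

Definition fro D : R := \tr (D *m D^T).

Lemma froE D : fro D = \sum_i \sum_j D i j ^+ 2.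
Proof.
rewrite /fro /mxtrace; apply: eq_bigr => i _; rewrite mxE.
by apply: eq_bigr => j _; rewrite mxE expr2.
Qed.

Lemma fro_ge0 D : 0 <= fro D.
Proof. by rewrite froE; apply: sumr_ge0 => i _; apply: sumr_ge0 => j _; rewrite sqr_ge0. Qed.

Lemma fro_outer a b : fro (a^T *m b) = sq a * sq b.
Proof. by rewrite /fro tr_outer outer_mul mxtraceZ trace_outer mulrC. Qed.

Lemma froZ (k : R) D : fro (k *: D) = k ^+ 2 * fro D.
Proof.
by rewrite /fro [(_ *: _)^T]linearZ/= -scalemxAl -scalemxAr !mxtraceZ mulrA expr2.
Qed.

Lemma fro_add_le A B : fro (A + B) <= 2 * fro A + 2 * fro B.
Proof.
rewrite !froE !mulr_sumr -big_split/=; apply: ler_sum => i _.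
rewrite !mulr_sumr -big_split/=; apply: ler_sum => j _; rewrite mxE.
by have := sqr_ge0 (A i j - B i j); lra.
Qed.

Lemma tr_conj_outer D e : \tr (D *m (e^T *m e) *m D^T) = sq (e *m D^T).
Proof.
rewrite /sq -trace_outer; congr (\tr _).
by rewrite trmx_mul trmxK !mulmxA.
Qed.

Lemma tr_At p : \tr (At p) <= N%:R.
Proof.
rewrite /At linearB/= mxtrace1 linearZ/= trace_outer -/(sq p) gerDl oppr_le0.
by rewrite mulr_ge0 ?sq_ge0// invr_ge0 ltW// W2_gt0.
Qed.

Lemma sq_Smat_ge p a : sq a / W2 p <= sq (a *m Smat p).
Proof.
rewrite -bf_gram Smat_tr Smat_sq /At !bf_mxE -/(sq a) (dotC p).
rewrite ler_pdivrMr ?W2_gt0// mulrBl mulrAC mulVf ?gt_eqF ?W2_gt0// mul1r.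
by have := cauchy_schwarz a p; rewrite /W2; have := sq_ge0 a; lra.
Qed.

Lemma cW_gt0 p : 0 < cW p.
Proof. by rewrite invr_gt0 mulr_gt0 ?W_gt0// ltr_wpDl// ltW// W_gt0. Qed.

Lemma cW_sq p : cW p * sq p = 1 - (W p)^-1.
Proof.
rewrite sq_W /cW; by field; rewrite ?W_neq0 ?W1_neq0.
Qed.

Lemma cW_sq2 p : cW p ^+ 2 * sq p <= (W2 p)^-1.
Proof.
have -> : cW p ^+ 2 * sq p = (W2 p)^-1 * ((W p - 1) / (W p + 1)).
  rewrite sq_W /cW -W_sq; by field; rewrite ?W_neq0 ?W1_neq0.
rewrite ger_pMr ?invr_gt0 ?W2_gt0//; have := W_ge1 p => w.
by rewrite ler_pdivrMr; lra.
Qed.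

(* The reflection makes the two increments opposite in the direction [e], so
   that the concavity of the radial profile enters with its full strength. *)
Lemma reflect_trace (al r f2 : R) e l q S T :
  sq e = 1 -> 0 < r -> 0 <= al -> f2 <= 0 -> q = al *: e - l ->
  S = Smat (al *: e) -> T = (1%:M - 2 *: (e^T *m e)) *m Smat q ->
  \tr ((S - T) *m ((f2 - al / r) *: (e^T *m e) + (al / r) *: 1%:M) *m (S - T)^T) <=
    f2 / W2 (al *: e) + al / r * (sq l / W2 q).
Proof.
move=> e1 r0 al0 f20 qE SE TE.
pose s := cW (al *: e) * al ^+ 2; pose k := cW q; pose be := dot e q.
pose m := q - (2 * be) *: e.
have ee : dot e e = 1 by [].
have mE : m^T *m q = q^T *m q - (2 * be) *: (e^T *m q).
  by rewrite /m linearB/= [(_ *: e)^T]linearZ/= mulmxBl -scalemxAl.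
have sm : sq m = sq q.
  by rewrite /m sqB sqZ e1 !dotDE (dotC q) -/be; ring.
have em : dot e m = - be by rewrite /m !dotDE ee -/be; ring.
clearbody m.
(* [m] is [q] reflected along [e]: the difference consists of two matrices of rank one, nearly
   [2 e^T e] up to the contributions of [p] and [q]. *)
have DE : S - T = (2 - s) *: (e^T *m e) + k *: (m^T *m q).
  have ae : (al *: e)^T *m (al *: e) = al ^+ 2 *: (e^T *m e).
    by rewrite [(_ *: e)^T]linearZ/= -scalemxAl -scalemxAr scalerA expr2.
  rewrite SE TE /Smat ae mulmxBl !mulmxBr !mul1mx !mulmx1 -!scalemxAl -!scalemxAr.
  rewrite outer_mul -/be -/k mE.
  move: (e^T *m e) (q^T *m q) (e^T *m q) => E1 E2 E3.
  by apply/matrixP => i j; rewrite /s !mxE; ring.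
have DT : (S - T)^T = (2 - s) *: (e^T *m e) + k *: (q^T *m m).
  by rewrite DE linearD/= [((2 - s) *: _)^T]linearZ/= [(k *: _)^T]linearZ/= !tr_outer.
have froD : fro (S - T) = (2 - s) ^+ 2 - 2 * (2 - s) * k * be ^+ 2 + k ^+ 2 * sq q ^+ 2.
  rewrite /fro DT DE mulmxDl !mulmxDr.
  rewrite -!scalemxAl -!scalemxAr !outer_mul !mxtraceD !mxtraceZ !trace_outer.
  have smd : dot m m = sq q := sm.
  by rewrite ee smd (dotC m e) em (dotC q e) -/be -/(sq q); ring.
have eD : e *m (S - T)^T = (2 - s) *: e + (k * be) *: m.
  rewrite DT mulmxDr -!scalemxAr !mulmxA.
  have h a b : a *m b^T = (dot a b)%:M by rewrite [LHS]mx11_scalar.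
  by rewrite !h !mul_scalar_mx -/(sq e) e1 scale1r -/be scalerA.
have sqeD : sq (e *m (S - T)^T) = (2 - s) ^+ 2 - 2 * (2 - s) * k * be ^+ 2 + k ^+ 2 * be ^+ 2 * sq q.
  by rewrite eD sqD !sqZ e1 sm dotZl dotZr em; ring.
move: (S - T) DE DT froD eD sqeD => D DE DT froD eD sqeD.
rewrite mulmxDr mulmxDl -!scalemxAr -!scalemxAl mulmx1 mxtraceD !mxtraceZ.
rewrite tr_conj_outer -/(fro _).
(* The terms of order [al / r] cancel except for the part of [q] orthogonal to [e], which comes only
   from [l]. *)
have -> : (f2 - al / r) * sq (e *m D^T) + al / r * fro D =
  f2 * sq (e *m D^T) + al / r * (k ^+ 2 * sq q * (sq q - be ^+ 2)).
  by rewrite sqeD froD; ring.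
have w0 := W2_gt0 q; have wv0 := W2_gt0 (al *: e).
have bel : sq q - be ^+ 2 <= sq l.
  rewrite /be qE sqB sqZ e1 !dotDE ee dotC.
  have := sqr_ge0 (dot e l); rewrite (dotC l); lra.
have be0 : 0 <= sq q - be ^+ 2.
  by have := cauchy_schwarz e q; rewrite e1 mul1r -/be; lra.
apply: lerD; last first.
  apply: ler_wpM2l; first by rewrite divr_ge0// ltW.
  rewrite [leRHS]mulrC; apply: ler_pM => //.
    by rewrite mulr_ge0 ?sqr_ge0 ?sq_ge0.
  exact: cW_sq2.
have -> : f2 / W2 (al *: e) = f2 * (W (al *: e))^-1 ^+ 2 by rewrite exprVn W_sq.
rewrite ler_wnM2l//.
have sE : s = 1 - (W (al *: e))^-1.
  by rewrite -cW_sq sqZ e1 mulr1.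
(* The component of [e D^T] along [e] is [2 - s - k be^2], at least [1 / W q + 1 / W (al e)]: both
   increments point the same way and add up. *)
have kb : k * be ^+ 2 <= 1 - (W q)^-1.
  rewrite -cW_sq ler_wpM2l//; first exact/ltW/cW_gt0.
  lra.
have iq : 0 < (W q)^-1 by rewrite invr_gt0 W_gt0.
have iv : 0 < (W (al *: e))^-1 by rewrite invr_gt0 W_gt0.
have : (2 - s - k * be ^+ 2) ^+ 2 <= sq (e *m D^T).
  have := cauchy_schwarz e (e *m D^T); rewrite e1 mul1r => /(le_trans _); apply.
  rewrite eD !dotDE ee em le_eqVlt; apply/orP; left; apply/eqP; ring.
apply: le_trans; rewrite lerXn2r ?nnegrE; lra.
Qed.

Lemma W_lip p q : `|W p - W q| <= nrm (p - q).
Proof.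
suff H a b : W a - W b <= nrm (a - b).
  by rewrite ler_norml H andbT; have := H q p; rewrite nrm_subC; lra.
rewrite lerBlDr -ler_sqr ?nnegrE ?addr_ge0 ?nrm_ge0 ?(ltW (W_gt0 _))//.
rewrite W_sq sqrrD nrm_sq W_sq /W2.
have -> : sq a = sq (a - b) + 2 * dot (a - b) b + sq b by rewrite -sqD subrK.
have := dot_nrm (a - b) b; have := ler_norm (dot (a - b) b).
have : nrm (a - b) * nrm b <= nrm (a - b) * W b.
  by rewrite ler_wpM2l ?nrm_ge0// ler_wsqrtr// /W2 lerDr.
lra.
Qed.

(** In the telescoped difference, the decay of [cW] compensates the growth of the outer products, so
    each piece is bounded by [|p - q|] uniformly in [p]. The bounds 1, 1 and 4, with two uses of
    [fro_add_le], stay within 44. *)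
Lemma fro_Smat_lip p q : sq (p - q) <= 1 -> fro (Smat p - Smat q) <= 44 * sq (p - q).
Proof.
move=> pq1; pose w := p - q.
have DE : Smat p - Smat q = (- cW p) *: (p^T *m w) +
   ((- cW p) *: (w^T *m q) + (cW q - cW p) *: (q^T *m q)).
  have -> : p^T *m w = p^T *m p - p^T *m q by rewrite /w mulmxBr.
  have -> : w^T *m q = p^T *m q - q^T *m q by rewrite /w linearB/= mulmxBl.
  rewrite /Smat.
  move: (p^T *m p) (q^T *m p) (p^T *m q) (q^T *m q) => A B C D.
  by apply/matrixP => i j; rewrite !mxE; ring.
have w1 : nrm w <= 1 by rewrite nrm_le// expr1n.
have [Wp Wq] := (W_ge1 p, W_ge1 q).
have wl := W_lip p q; rewrite -/w in wl.
have [cp cq] := (cW_gt0 p, cW_gt0 q).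
have cp1 : cW p <= 1.
  by rewrite invf_le1 ?mulr_gt0 ?W_gt0//; nra.
have cWW : cW p * (W p * (W p + 1)) = 1.
  by rewrite mulVf// gt_eqF// mulr_gt0; lra.
have cWq : cW q * (W q * (W q + 1)) = 1.
  by rewrite mulVf// gt_eqF// mulr_gt0; lra.
have n0 := nrm_ge0 w.
have [np nq] : nrm p <= W p /\ nrm q <= W q.
  by split; apply: ler_wsqrtr; rewrite /W2 lerDr.
have [np0 nq0] := (nrm_ge0 p, nrm_ge0 q).
have a1 : cW p * nrm p <= 1 by nra.
have Wqp : W q <= W p + 1 by have := ler_norm (- (W p - W q)); rewrite normrN; lra.
have a2 : cW p * nrm q <= 1 by nra.
have a3 : `|cW q - cW p| * nrm q ^+ 2 <= 2 * nrm w.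
  have -> : cW q - cW p = cW p * cW q * ((W p - W q) * (W p + W q + 1)).
    have -> : (W p - W q) * (W p + W q + 1) = W p * (W p + 1) - W q * (W q + 1) by ring.
    by rewrite mulrBr mulrAC cWW mul1r -mulrA cWq mulr1.
  rewrite !normrM (gtr0_norm cp) (gtr0_norm cq) [`|_ + 1|]ger0_norm; last lra.
  have b1 : cW q * nrm q ^+ 2 <= 1.
    by rewrite nrm_sq cW_sq gerBl invr_ge0; lra.
  have b2 : cW p * (W p + W q + 1) <= 2 by nra.
  have b20 : 0 <= cW p * (W p + W q + 1) by rewrite mulr_ge0; lra.
  have b10 : 0 <= cW q * nrm q ^+ 2 by rewrite mulr_ge0 ?sqr_ge0; lra.
  have -> : cW p * cW q * (`|W p - W q| * (W p + W q + 1)) * nrm q ^+ 2 =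
    `|W p - W q| * ((cW p * (W p + W q + 1)) * (cW q * nrm q ^+ 2)) by ring.
  rewrite mulrC; apply: ler_pM => //; first exact: mulr_ge0.
  have := ler_pM b20 b10 b2 b1; lra.
have f1 : fro ((- cW p) *: (p^T *m w)) <= sq w.
  rewrite froZ fro_outer -!nrm_sq.
  have -> : (- cW p) ^+ 2 * (nrm p ^+ 2 * nrm w ^+ 2) = (cW p * nrm p) ^+ 2 * nrm w ^+ 2 by ring.
  by rewrite ler_piMl ?sqr_ge0// expr_le1// mulr_ge0// ltW.
have f2 : fro ((- cW p) *: (w^T *m q)) <= sq w.
  rewrite froZ fro_outer -!nrm_sq.
  have -> : (- cW p) ^+ 2 * (nrm w ^+ 2 * nrm q ^+ 2) = (cW p * nrm q) ^+ 2 * nrm w ^+ 2 by ring.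
  by rewrite ler_piMl ?sqr_ge0// expr_le1// mulr_ge0// ltW.
have f3 : fro ((cW q - cW p) *: (q^T *m q)) <= 4 * sq w.
  rewrite froZ fro_outer -!nrm_sq.
  have -> : (cW q - cW p) ^+ 2 * (nrm q ^+ 2 * nrm q ^+ 2) = (`|cW q - cW p| * nrm q ^+ 2) ^+ 2.
    by rewrite exprMn real_normK ?num_real//; ring.
  have -> : 4 * nrm w ^+ 2 = (2 * nrm w) ^+ 2 by ring.
  by rewrite lerXn2r ?nnegrE ?mulr_ge0 ?sqr_ge0.
rewrite DE; apply: le_trans (fro_add_le _ _) _.
have := fro_add_le ((- cW p) *: (w^T *m q)) ((cW q - cW p) *: (q^T *m q)).
have := sq_ge0 w; rewrite -/w; lra.
Qed.

End Coupling.

(** * Hessians of radial profiles *)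

Section Radial.
Context {R : realType} {N : nat}.
Implicit Types (x y z d h p q e : 'rV[R]_N) (X Y : 'M[R]_N) (f g G : 'rV[R]_N -> R).

(** The Hessian, at radius [r] in the unit direction [e], of a radial function with slope [al] and
    second derivative [f2]. *)
Definition rad (r al f2 : R) e : 'M[R]_N :=
  (f2 - al / r) *: (e^T *m e) + (al / r) *: 1%:M.

Lemma D2_eq f g x p X : (forall y, f y = g y) -> D2 f x p X -> D2 g x p X.
Proof. by move=> /funext ->. Qed.

Lemma D2_nrm h : h != 0 ->
  D2 nrm h (1 *: ((nrm h)^-1 *: h)) (rad (nrm h) 1 0 ((nrm h)^-1 *: h)).
Proof.
move=> h0; have s0 := sq_gt0 h0; have r0 : 0 < nrm h by rewrite sqrtr_gt0.
have f0 : 0 < sq (h - 0) by rewrite subr0.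
have := D2_sqrt (f := fun y => sq (y - 0)) f0 (D2_sq 0 h); rewrite subr0 -/(nrm h).
move=> hD.
have pE : (2 * nrm h)^-1 *: (2 *: h) = 1 *: ((nrm h)^-1 *: h).
  by rewrite scale1r scalerA; congr (_ *: _); field; rewrite gt_eqF.
have XE : (2 * nrm h)^-1 *: (2 *: 1%:M - (2 * sq h)^-1 *: ((2 *: h)^T *m (2 *: h))) =
    rad (nrm h) 1 0 ((nrm h)^-1 *: h).
  have o (c : R) : (c *: h)^T *m (c *: h) = c ^+ 2 *: (h^T *m h).
    by rewrite [(_ *: h)^T]linearZ/= -scalemxAl -scalemxAr scalerA expr2.
  rewrite /rad -nrm_sq !o; move: (h^T *m h) => E; apply/matrixP => i j; rewrite !mxE.
  by field; rewrite gt_eqF.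
rewrite -XE -pE; apply: D2_eq hD => y; by rewrite subr0.
Qed.

Lemma rad_sqrt h : h != 0 -> let r := nrm h in let g := Num.sqrt r in
  D2 (fun y => Num.sqrt (nrm y)) h ((2 * g)^-1 *: (r^-1 *: h))
    (rad r (2 * g)^-1 (- (4 * g * r)^-1) (r^-1 *: h)).
Proof.
move=> h0 r g; have s0 := sq_gt0 h0; have r0 : 0 < r by rewrite sqrtr_gt0.
have g0 : 0 < g by rewrite sqrtr_gt0.
have := D2_sqrt r0 (D2_nrm h0); rewrite -/r -/g !scale1r.
move=> hD; have XE : (2 * g)^-1 *: (rad r 1 0 (r^-1 *: h) -
    (2 * r)^-1 *: ((r^-1 *: h)^T *m (r^-1 *: h))) =
    rad r (2 * g)^-1 (- (4 * g * r)^-1) (r^-1 *: h).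
  rewrite /rad; move: ((_ *: h)^T *m _) => E; apply/matrixP => i j; rewrite !mxE.
  by field; rewrite !gt_eqF.
by rewrite -XE.
Qed.

Lemma rad_comb h (c1 c2 : R) : h != 0 -> let r := nrm h in let g := Num.sqrt r in
  D2 (fun y => c1 * nrm y - c2 * (nrm y * Num.sqrt (nrm y))) h
    ((c1 - 3 / 2 * c2 * g) *: (r^-1 *: h))
    (rad r (c1 - 3 / 2 * c2 * g) (- (3 / 4 * c2 / g)) (r^-1 *: h)).
Proof.
move=> h0 r g; have s0 := sq_gt0 h0; have r0 : 0 < r by rewrite sqrtr_gt0.
have g0 : 0 < g by rewrite sqrtr_gt0.
have gg : g ^+ 2 = r by rewrite sqr_sqrtr// ltW.
have := D2_add (D2_scale c1 (D2_nrm h0)) (D2_scale (- c2) (D2_mul (D2_nrm h0) (rad_sqrt h0))).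
rewrite -/r -/g !scale1r.
rewrite -[rad r _ _ _]/(rad _ _ _ _); move: (r^-1 *: h) => e hD.
apply: (D2_eq (f := fun y => c1 * nrm y + - c2 * (nrm y * Num.sqrt (nrm y)))).
  by move=> y; ring.
move: hD; set p := (X in D2 _ _ X _); set X := (X in D2 _ _ _ X) => hD.
have -> : (c1 - 3 / 2 * c2 * g) *: e = p.
  by rewrite /p; apply/rowP => i; rewrite !mxE -gg; field; rewrite gt_eqF.
have -> // : rad r (c1 - 3 / 2 * c2 * g) (- (3 / 4 * c2 / g)) e = X.
rewrite /X /rad.
have -> : e^T *m ((2 * g)^-1 *: e) = (2 * g)^-1 *: (e^T *m e) by rewrite scalemxAr.
have -> : ((2 * g)^-1 *: e)^T *m e = (2 * g)^-1 *: (e^T *m e).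
  by rewrite [(_ *: e)^T]linearZ/= scalemxAl.
move: (e^T *m e) => E; apply/matrixP => i j; rewrite !mxE -gg.
by field; rewrite gt_eqF.
Qed.

End Radial.

(** All requirements on [M] are lower bounds. The first three make the root [1 / (4 A M)] of the
    doubling radius small enough; the last three feed [lipschitz_gain]. *)
Lemma absorbing_slope {R : realType} (A B h r C1 L : R) : 0 < A -> 0 < B -> 0 < h -> 0 < r -> 0 <= C1 -> 0 <= L ->
  exists2 M : R, 4 <= M & [/\ 1 <= 4 * A * M, 1 <= 4 * A * h * M, B <= 4 * A * r * M &
    [/\ 4 * C1 <= A ^+ 2 * M, 512 * B <= A * M & 2 * L <= A ^+ 3 * M]].
Proof.
move=> A0 B0 h0 r0 C0 L0.
have [A2 A3] : 0 < A ^+ 2 /\ 0 < A ^+ 3 by rewrite !exprn_gt0.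
have [Ah Ar] : 0 < A * h /\ 0 < A * r by rewrite !mulr_gt0.
have ex (c X : R) : 0 <= c -> 0 < X -> exists2 t : R, 0 <= t & forall M, t <= M -> c <= X * M.
  move=> c0 X0; exists (c / X); first by rewrite divr_ge0// ltW.
  by move=> M; rewrite ler_pdivrMr// mulrC.
have [t1 p1 f1] := ex 1 A ler01 A0.
have [t2 p2 f2] := ex 1 _ ler01 Ah.
have [t3 p3 f3] := ex B _ (ltW B0) Ar.
have [t4 p4 f4] := ex (4 * C1) _ (mulr_ge0 (ler0n _ _) C0) A2.
have [t5 p5 f5] := ex (512 * B) _ (mulr_ge0 (ler0n _ _) (ltW B0)) A0.
have [t6 p6 f6] := ex (2 * L) _ (mulr_ge0 (ler0n _ _) L0) A3.
have [M [M4 m1 m2 m3 [m4 m5 m6]]] : exists M : R, [/\ 4 <= M, t1 <= M, t2 <= M, t3 <= M &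
    [/\ t4 <= M, t5 <= M & t6 <= M]].
  by exists (4 + t1 + t2 + t3 + t4 + t5 + t6); clear - p1 p2 p3 p4 p5 p6; split; [lra..|split; lra].
move: {f1 m1} (f1 M m1) {f2 m2} (f2 M m2) {f3 m3} (f3 M m3).
move: {f4 m4} (f4 M m4) {f5 m5} (f5 M m5) {f6 m6} (f6 M m6) => f4 f5 f6 f1 f2 f3.
by exists M => //; split => //; clear - f1 f2 f3 B0; lra.
Qed.

(** Here [g] is the root of [|h|]. With slope comparable to [M], the gain is at least [3/8 A / g],
    and [D <= B g] makes the localization error at most [32 B / (g M)]. After multiplication by [g],
    each of the three errors is at most [A / 16], which contradicts the gain. *)
Lemma lipschitz_gain {R : realType} (A B M L C1 g al D : R) : 0 < A -> 0 < B -> 4 <= M -> 0 <= L ->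
  4 * C1 <= A ^+ 2 * M -> 512 * B <= A * M -> 2 * L <= A ^+ 3 * M ->
  0 < g -> g <= 1 -> A * M * g <= 1 / 4 -> M / 2 <= al -> al <= M -> D <= B * g ->
  ~ - - (3 / 4 * (A * M ^+ 2) / g) / (2 * al ^+ 2) <=
    2 * (L * g ^+ 2) * al + C1 + 16 * D / (g ^+ 2 * al).
Proof.
move=> A0 B0 M4 L0 m4 m5 m6 g0 g1 Ag al1 alM DB; rewrite opprK => hh.
have M0 : 0 < M by lra.
have al0 : 0 < al by lra.
have Ag0 : 0 < A * M * g by do 2 apply: mulr_gt0 => //.
have i1 : 3 / 8 * A / g <= 3 / 4 * (A * M ^+ 2) / g / (2 * al ^+ 2).
  have -> : 3 / 4 * (A * M ^+ 2) / g / (2 * al ^+ 2) = 3 / 8 * A / g * (M / al) ^+ 2.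
    by field; rewrite !gt_eqF.
  rewrite ler_peMr//; first by rewrite divr_ge0 ?mulr_ge0// ltW.
  by rewrite exprn_ege1// ler_pdivlMr// mul1r.
have i2 : 2 * (L * g ^+ 2) * al <= 2 * (L * g ^+ 2) * M.
  by rewrite ler_wpM2l// mulr_ge0// mulr_ge0// sqr_ge0.
have i3 : 16 * D / (g ^+ 2 * al) <= 32 * B / (g * M).
  have -> : 32 * B / (g * M) = 16 * (B * g) / (g ^+ 2 * (M / 2)).
    by field; rewrite !gt_eqF.
  have gal : 0 < g ^+ 2 * al by rewrite mulr_gt0// exprn_gt0.
  have gM : 0 < g ^+ 2 * (M / 2) by rewrite mulr_gt0 ?exprn_gt0 ?divr_gt0.
  apply: le_trans (_ : 16 * (B * g) / (g ^+ 2 * al) <= _).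
    by rewrite ler_wpM2r ?invr_ge0 ?(ltW gal)// ler_wpM2l.
  rewrite ler_wpM2l ?mulr_ge0 ?(ltW B0) ?(ltW g0)// lef_pV2 ?posrE//.
  by rewrite ler_wpM2l ?sqr_ge0.
have {hh i1 i2 i3} hh := le_trans i1 (le_trans hh (lerD (lerD i2 (lexx C1)) i3)).
have := ler_wpM2l (ltW g0) hh.
have -> : g * (3 / 8 * A / g) = 3 / 8 * A by field; rewrite gt_eqF.
have -> : g * (2 * (L * g ^+ 2) * M + C1 + 32 * B / (g * M)) =
  2 * L * M * g ^+ 3 + C1 * g + 32 * B / M.
  by field; rewrite !gt_eqF.
have j1 : 32 * B / M <= A / 16 by rewrite ler_pdivrMr//; clear - m5; lra.
have j2 : C1 * g <= A / 16.
  have := ler_wpM2r (ltW g0) m4; have -> : A ^+ 2 * M * g = A * (A * M * g) by ring.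
  by have := ler_wpM2l (ltW A0) Ag; clear; lra.
have j3 : 2 * L * M * g ^+ 3 <= A / 16.
  have g3 : 0 < g ^+ 3 by rewrite exprn_gt0.
  have Mg : 0 <= M * g ^+ 3 by apply: mulr_ge0; exact: ltW.
  have := ler_wpM2r Mg m6.
  have -> : A ^+ 3 * M * (M * g ^+ 3) = A * (A * M * g) ^+ 2 * g by ring.
  have : (A * M * g) ^+ 2 <= 1 / 16.
    have -> : 1 / 16 = (1 / 4) ^+ 2 :> R by field.
    by rewrite lerXn2r ?nnegrE ?(ltW Ag0).
  have := sqr_ge0 (A * M * g); move: (_ ^+ 2) => Q Q0 Q1.
  have : A * Q * g <= A * (1 / 16) * 1.
    apply: ler_pM => //; [by apply: mulr_ge0 => //; exact: ltW|exact: ltW|].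
    by apply: ler_wpM2l => //; exact: ltW.
  by clear; lra.
clear - j1 j2 j3 A0; lra.
Qed.

(** * Doubling of variables: Hölder and Lipschitz bounds *)

Section Pair.
Context {R : realType} {N : nat}.
Implicit Types (x y z d h c p q e : 'rV[R]_N) (X Y : 'M[R]_N) (f g G a b K : 'rV[R]_N -> R).
Implicit Types (Om U : set 'rV[R]_N).

Lemma usc_pair_max (A B : set 'rV[R]_N) (F : 'rV[R]_N -> 'rV[R]_N -> R) :
  compact A -> compact B -> A !=set0 -> B !=set0 ->
  (forall x h, A x -> B h -> forall e : R, 0 < e -> exists2 r : R, 0 < r &
    forall x' h', A x' -> B h' -> sq (x' - x) < r -> sq (h' - h) < r ->
      F x' h' < F x h + e) ->
  exists x h, [/\ A x, B h & forall x' h', A x' -> B h' -> F x' h' <= F x h].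
Proof.
move=> cA cB [x0 Ax0] [h0 Bh0] FU.
have [||[x h] [/= Ax Bh] hm] := @usc_compact_max R _ (A `*` B) (fun t => F t.1 t.2)
  (compact_setX cA cB).
- by exists (x0, h0).
- move=> [x h] [/= Ax Bh] e e0; have [r r0 hr] := FU x h Ax Bh e e0.
  exists ([set y | sq (y - x) < r], [set y | sq (y - h) < r]).
    by split; apply/nbhs_sqP; exists r.
  by move=> [x' h'] [/= h1 h2] [/= h3 h4]; exact: hr.
by exists x, h; split => // x' h' Ax' Bh'; exact: (hm (x', h')).
Qed.

(** Semicontinuity and compactness turn a strict bound on the diagonal into one on a uniform
    neighbourhood of it. *)
Lemma diag_usc Om U a b (k : R) : sq_open Om -> compact U -> U `<=` Om ->
  (forall z, Om z -> usc_in Om a z) -> (forall z, Om z -> usc_in Om b z) ->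
  (forall x, U x -> a x + b x < k) ->
  exists2 s : R, 0 < s & forall x h, U x -> nrm h <= s -> Om (x + h) /\ a (x + h) + b x < k.
Proof.
move=> Oo cU UO ua ub ab.
have [s /= s0 hs] : \forall s \near (0 : R)^'+, forall x, U x -> forall h, nrm h <= s ->
    Om (x + h) /\ (Om x -> a (x + h) + b x < k).
  apply: (proj1 (compact_near_coveringP U) cU R _
    (fun s x => forall h, nrm h <= s -> Om (x + h) /\ (Om x -> a (x + h) + b x < k))) => x Ux.
  have Ox := UO x Ux; pose e := (k - (a x + b x)) / 2.
  have e0 : 0 < e by rewrite /e; have := ab x Ux; lra.
  have [r1 r10 h1] := ua x Ox e e0; have [r2 r20 h2] := ub x Ox e e0.
  have [r3 r30 h3] := Oo x Ox.
  pose r := Num.min r1 (Num.min r2 r3).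
  have r0 : 0 < r by rewrite !lt_min r10 r20.
  pose t := Num.sqrt (r / 4); have t0 : 0 < t by rewrite sqrtr_gt0 divr_gt0.
  have tt : t ^+ 2 = r / 4 by rewrite sqr_sqrtr// ltW// divr_gt0.
  exists ([set y | sq (y - x) < r / 4], [set s | s < t]).
    split => /=; first by apply/nbhs_sqP; exists (r / 4); rewrite ?divr_gt0.
    exact: nbhs_right_lt.
  move=> [y s] /= [yx st] h hn.
  have hh : sq h < r / 4 by rewrite -tt -nrm_lt//; lra.
  have yhx : sq (y + h - x) < r.
    by have := sqD_le (y - x) h; rewrite addrAC; lra.
  have [c1 c2 c3] : [/\ r <= r1, r <= r2 & r <= r3].
    by rewrite /r !ge_min !lexx !orbT.
  have Oyh : Om (y + h) by apply: h3; lra.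
  split=> // Oy; have := h1 (y + h) Oyh (lt_le_trans yhx c1).
  have yx2 : sq (y - x) < r2 by lra.
  have := h2 y Oy yx2; rewrite /e; lra.
exists (s / 2); first by rewrite divr_gt0.
have s2 : 0 < s / 2 by rewrite divr_gt0.
have d1 : `|0 - s / 2| < s by rewrite sub0r normrN gtr0_norm//; lra.
move=> x h Ux hn; have [oy1 oy2] := hs (s / 2) d1 s2 x Ux h hn.
by split => //; apply: oy2; exact: UO.
Qed.

Lemma reflect_sq e : sq e = 1 ->
  (1%:M - 2 *: (e^T *m e)) *m (1%:M - 2 *: (e^T *m e)) = 1%:M :> 'M[R]_N.
Proof.
move=> e1; rewrite mulmxBl !mulmxBr mul1mx mulmx1 mul1mx -scalemxAl -scalemxAr.
rewrite outer_mul -/(sq e) e1; move: (e^T *m e) => E.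
by apply/matrixP => i j; rewrite !mxE; ring.
Qed.

Lemma reflect_tr e : (1%:M - 2 *: (e^T *m e))^T = 1%:M - 2 *: (e^T *m e) :> 'M[R]_N.
Proof. by rewrite linearB/= trmx1 [(2 *: _)^T]linearZ/= tr_outer. Qed.

Hypothesis N0 : (0 < N)%N.
Variables (Om : set 'rV[R]_N) (K a b : 'rV[R]_N -> R).
Hypothesis Oo : sq_open Om.
Hypothesis aq : qsub Om K a.
Hypothesis bq : qsub Om (fun x => - K x) b.
Hypothesis ua : forall z, Om z -> usc_in Om a z.
Hypothesis ub : forall z, Om z -> usc_in Om b z.
Hypothesis Kc : forall z, Om z -> cont_at K z.

Lemma cont_atN z : cont_at K z -> cont_at (fun x => - K x) z.
Proof.
move=> h e /h[r r0 hr]; exists r => // y /hr.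
by rewrite -opprD normrN.
Qed.

(** The gain uses [W2 (al e) <= 2 al^2]. The first error is the variation of [K]. The localization
    has gradient [l = 2 (x - z)], with [|l| <= 1], and Hessian [2 I]: it costs [K0] through
    [|W p - W q| <= |l|], [2 N] through its trace, and the last term through [|l|^2 <= 4 D] and
    [W2 q >= al^2 / 4]. *)
Lemma contact_ineq z x h (al f2 L K0 : R) G :
  let r := nrm h in let e := r^-1 *: h in let D := a (x + h) + b x in
  Om x -> Om (x + h) -> h != 0 -> D2 G h (al *: e) (rad r al f2 e) ->
  (exists2 s : R, 0 < s & forall c d, sq c < s -> sq d < s ->
     a (x + h + d) + b (x + c) - G (h + (d - c)) - sq (x + c - z) <=
     a (x + h) + b x - G h - sq (x - z)) ->
  2 <= al -> f2 <= 0 -> nrm (x - z) <= 1 / 2 -> `|K (x + h) - K x| <= L * r ->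
  `|K x| <= K0 -> 0 <= G h -> G h + sq (x - z) < D ->
  - f2 / (2 * al ^+ 2) <= 2 * (L * r) * al + (K0 + 2 * N%:R) + 16 * D / (r * al).
Proof.
move=> r e D Ox Oy h0 hG [s s0 hs] al2 f20 xz KL KK G0 GD.
have sh := sq_gt0 h0; have r0 : 0 < r by rewrite sqrtr_gt0.
have e1 : sq e = 1.
  by rewrite /e sqZ exprVn nrm_sq mulVf// gt_eqF.
pose l := 2 *: (x - z); pose q := al *: e - l.
have sl : sq l = 4 * sq (x - z) by rewrite /l sqZ; ring.
have nl : nrm l <= 1.
  by rewrite /l nrmZ ger0_norm//; lra.
pose S := Smat (al *: e); pose T := (1%:M - 2 *: (e^T *m e)) *m Smat q.
have Tu : T \in unitmx.
  by rewrite unitmx_mul Smat_unit andbT; case: (mulmx1_unit (reflect_sq e1)).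
have TT : T^T *m T = At q.
  rewrite /T trmx_mul Smat_tr reflect_tr; have := reflect_sq e1.
  by move: (1%:M - _) => Rf RR; rewrite -mulmxA (mulmxA Rf Rf) RR mul1mx Smat_sq.
have Ps : (rad r al f2 e)^T = rad r al f2 e.
  rewrite /rad linearD/= [(_ *: (_ *m _))^T]linearZ/= tr_outer.
  by rewrite [(_ *: 1%:M)^T]linearZ/= trmx1.
have Qs : (2 *: 1%:M : 'M[R]_N)^T = 2 *: 1%:M by rewrite linearZ/= trmx1.
have main := sum_ineq N0 Oo aq bq ua ub Ox Oy (Kc Oy) (cont_atN (Kc Ox)) Ps Qs
  (Smat_unit (al *: e)) Tu _ TT (p := al *: e).
have {}main : K (x + h) * W (al *: e) + - K x * W q <=
   \tr ((S - T) *m rad r al f2 e *m (S - T)^T) + \tr (T *m (2 *: 1%:M) *m T^T).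
  apply: main; first by rewrite Smat_tr Smat_sq.
  move=> k k0; have [|s' s'0 hs'] := hG (k / 2); first lra.
  exists (Num.min s (s' / 4)); first by rewrite lt_min s0 divr_gt0.
  move=> d c; rewrite !lt_min => /andP[d1 d2] /andP[c1 c2].
  have dc := sqD_le d (- c); rewrite sqN in dc.
  have dcs : sq (d - c) < s' by lra.
  have := hs' (d - c) dcs; have := hs c d c1 d1.
  have -> : x + c - z = (x - z) + c by rewrite addrAC.
  rewrite [sq (x - z + c)]sqD bf_mxZ bf_mx1 -/(sq c) => h1 h2.
  have {}h2 := le_trans (ler_norm _) h2.
  have kk : k / 2 * sq (d - c) <= k / 2 * (2 * sq d + 2 * sq c) by rewrite ler_wpM2l//; lra.
  rewrite /q /l; move: h1 h2; move: (x - z) => w h1; rewrite !dotDE; lra.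
have tT : \tr (T *m (2 *: 1%:M) *m T^T) <= 2 * N%:R.
  rewrite -scalemxAr mulmx1 -scalemxAl mxtraceZ ler_wpM2l//.
  by rewrite mxtrace_mulC TT tr_At.
have al00 : 0 <= al by lra.
have := reflect_trace e1 r0 al00 f20 (erefl q) (erefl S) (erefl T).
rewrite -/(rad r al f2 e) => tS.
have {}main : K (x + h) * W (al *: e) - K x * W q <=
  f2 / W2 (al *: e) + al / r * (sq l / W2 q) + 2 * N%:R by lra.
have al0 : 0 < al by lra.
have al4 : 4 <= al ^+ 2 by rewrite expr2; nra.
have sal : sq (al *: e) = al ^+ 2 by rewrite sqZ e1 mulr1.
have nal : nrm (al *: e) = al by rewrite /nrm sal sqrtr_sqr gtr0_norm.
have Wp2 : W (al *: e) <= 2 * al.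
  have w0 := W_gt0 (al *: e); rewrite -ler_sqr ?nnegrE; [|lra|lra].
  by rewrite W_sq /W2 sal exprMn; lra.
have W2p : W2 (al *: e) <= 2 * al ^+ 2 by rewrite /W2 sal; lra.
have W2q : al ^+ 2 / 4 <= W2 q.
  have : al - 1 <= nrm q.
    have := nrm_triangle q l; rewrite /q subrK nal; lra.
  rewrite /W2 -nrm_sq => qa.
  have : (al - 1) ^+ 2 <= nrm q ^+ 2 by rewrite lerXn2r ?nnegrE ?nrm_ge0//; lra.
  nra.
have WW : `|W (al *: e) - W q| <= 1.
  by apply: le_trans (W_lip _ _) _; rewrite /q opprB addrC subrK.
have lhs : - (L * r * (2 * al)) - K0 <= K (x + h) * W (al *: e) - K x * W q.
  have -> : K (x + h) * W (al *: e) - K x * W q =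
    (K (x + h) - K x) * W (al *: e) + K x * (W (al *: e) - W q) by ring.
  have b1 : `|(K (x + h) - K x) * W (al *: e)| <= L * r * (2 * al).
    by rewrite normrM ler_pM// ger0_norm ?(ltW (W_gt0 _)).
  have b2 : `|K x * (W (al *: e) - W q)| <= K0 * 1 by rewrite normrM ler_pM.
  have := ler_norm (- ((K (x + h) - K x) * W (al *: e))).
  have := ler_norm (- (K x * (W (al *: e) - W q))); rewrite !normrN; lra.
have f2b : - f2 / (2 * al ^+ 2) <= - (f2 / W2 (al *: e)).
  by rewrite -mulNr ler_wpM2l ?oppr_ge0// lef_pV2 ?posrE ?W2_gt0// mulr_gt0 ?exprn_gt0.
have lb : al / r * (sq l / W2 q) <= 16 * D / (r * al).
  have -> : 16 * D / (r * al) = al / r * (4 * D / (al ^+ 2 / 4)).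
    by field; rewrite !gt_eqF.
  rewrite ler_wpM2l ?divr_ge0 ?(ltW al0) ?(ltW r0)//.
  have q0 := W2_gt0 q.
  apply: ler_pM; rewrite ?sq_ge0 ?invr_ge0 ?(ltW q0)//; first by rewrite sl; lra.
  by rewrite lef_pV2 ?posrE// divr_gt0// exprn_gt0.
lra.
Qed.

Hypothesis ab : forall z, Om z -> a z + b z <= 0.

(** The maximum over two balls of [a (x + h) + b x - G h - |x - z|^2] is not positive: the boundary
    hypotheses exclude the spheres, [a + b <= 0] excludes [h = 0], where the profile is singular,
    and the last hypothesis excludes an interior contact. The claim is then read at [x = z]. *)
Lemma doubling z (rho h1 : R) G : 0 < rho -> 0 < h1 ->
  (forall x h, nrm (x - z) <= rho -> nrm h <= h1 -> Om x /\ Om (x + h)) ->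
  G 0 = 0 -> (forall h, nrm h <= h1 -> 0 <= G h) ->
  (forall h, h != 0 -> exists p X, D2 G h p X) ->
  (forall x h, nrm (x - z) <= rho -> nrm h = h1 -> a (x + h) + b x <= G h) ->
  (forall x h, nrm (x - z) = rho -> nrm h <= h1 -> a (x + h) + b x <= rho ^+ 2) ->
  (forall x h, nrm (x - z) < rho -> h != 0 -> nrm h < h1 ->
     G h + sq (x - z) < a (x + h) + b x ->
     (exists2 s : R, 0 < s & forall c d, sq c < s -> sq d < s ->
       a (x + h + d) + b (x + c) - G (h + (d - c)) - sq (x + c - z) <=
       a (x + h) + b x - G h - sq (x - z)) -> False) ->
  forall h, nrm h <= h1 -> a (z + h) + b z <= G h.
Proof.
move=> rho0 h10 OC G0 Gp GD bh bx hc.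
have [|||||x [h [/= xr hr hm]]] := @usc_pair_max [set x | sq (x - z) <= rho ^+ 2]
  [set h | sq (h - 0) <= h1 ^+ 2]
  (fun x h => (a (x + h) + b x) - G h - sq (x - z)).
- exact: compact_closed_ball.
- exact: compact_closed_ball.
- by exists z; rewrite /= subrr sq0 sqr_ge0.
- by exists 0; rewrite /= subrr sq0 sqr_ge0.
- move=> x h /=; rewrite -!nrm_le ?(ltW rho0) ?(ltW h10)// subr0 => xr hr e e0.
  have [Ox Oxh] := OC x h xr hr.
  have e40 : 0 < e / 4 by rewrite divr_gt0.
  have [r1 r10 k1] := ua Oxh e40; have [r2 r20 k2] := ub Ox e40.
  have [r3 r30 k3] := D2_cont (D2_sq z x) e40.
  have [r4 r40 k4] : exists2 r : R, 0 < r & forall h', nrm h' <= h1 ->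
      sq (h' - h) < r -> G h - e / 4 < G h'.
    have [h0|h0] := eqVneq h 0.
      by exists 1 => // h' h'1 _; have := Gp h' h'1; rewrite h0 G0; lra.
    have [p [X hD]] := GD h h0; have [r r0 hr'] := D2_cont hD e40.
    exists r => // h' _ /hr'; rewrite distrC => /(le_lt_trans (ler_norm _)); lra.
  exists (Num.min (r1 / 4) (Num.min r2 (Num.min r3 r4))).
    by rewrite !lt_min divr_gt0// r20 r30.
  move=> x' h'; rewrite -!nrm_le ?(ltW rho0) ?(ltW h10)// subr0 => x'r h'r.
  rewrite !lt_min => /and4P[p1 p2 p3 p4] /and4P[q1 q2 q3 q4].
  have [Ox' Oxh'] := OC x' h' x'r h'r.
  have := k4 h' h'r q4.
  have := k3 x' p3; rewrite distrC => /(le_lt_trans (ler_norm _)).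
  have := k2 x' Ox' p2; have := k1 (x' + h') Oxh'.
  rewrite opprD addrACA; have := sqD_le (x' - x) (h' - h) => s1 /(_ ltac:(lra)); lra.
have [xr' hr'] : nrm (x - z) <= rho /\ nrm h <= h1.
  by rewrite !nrm_le ?(ltW rho0) ?(ltW h10)//; rewrite subr0 in hr.
suff hx : a (x + h) + b x - G h - sq (x - z) <= 0.
  move=> k kh; have := hm z k; rewrite subrr sq0 subr0 -!nrm_le ?(ltW rho0) ?(ltW h10)//.
  by move=> /(_ (sqr_ge0 _) kh); lra.
have [Ox Oxh] := OC x h xr' hr'.
rewrite leNgt; apply/negP => hpos.
have [h0|h0] := eqVneq h 0.
  have := ab Ox; have := sq_ge0 (x - z); move: hpos; rewrite h0 G0 addr0; lra.
have := Gp h hr' => Gh.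
have hlt : nrm h < h1.
  rewrite lt_neqAle hr' andbT; apply/eqP => he.
  have := bh x h xr' he; have := sq_ge0 (x - z); lra.
have xlt : nrm (x - z) < rho.
  rewrite lt_neqAle xr' andbT; apply/eqP => he.
  by have := bx x h he hr'; rewrite -he nrm_sq; lra.
apply: (hc x h xlt h0 hlt); first lra.
pose t := Num.min (rho - nrm (x - z)) ((h1 - nrm h) / 2).
have t0 : 0 < t by rewrite lt_min subr_gt0 xlt/=; lra.
have [t1 t2] : t <= rho - nrm (x - z) /\ t <= (h1 - nrm h) / 2.
  by rewrite /t !ge_min !lexx orbT.
exists (t ^+ 2); first exact: exprn_gt0.
move=> c d; rewrite -!nrm_lt// => ct dt.
have := hm (x + c) (h + (d - c)).
rewrite -!nrm_le ?(ltW rho0) ?(ltW h10)// subr0.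
have -> : x + c + (h + (d - c)) = x + h + d by apply/rowP => i; rewrite !mxE; ring.
apply.
  rewrite addrAC; apply: le_trans (nrm_triangle _ _) _; lra.
apply: le_trans (nrm_triangle _ _) _.
have := nrm_triangle d (- c); rewrite nrmN; lra.
Qed.

Lemma radZ (k r al f2 : R) e : k *: rad r al f2 e = rad r (k * al) (k * f2) e.
Proof.
rewrite /rad; move: (e^T *m e) => E.
by apply/matrixP => i j; rewrite !mxE; ring.
Qed.

Definition lip_ball z0 (rb L K0 : R) :=
  [/\ 0 < rb, rb <= 1, 0 <= L, 0 <= K0 &
  [/\ forall x, nrm (x - z0) <= rb -> Om x,
      forall x y, nrm (x - z0) <= rb -> nrm (y - z0) <= rb ->
        `|K x - K y| <= L * nrm (x - y) &
      forall x, nrm (x - z0) <= rb -> `|K x| <= K0]].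

Lemma near_center z0 z x (t s : R) : nrm (z - z0) <= t -> nrm (x - z) <= s ->
  nrm (x - z0) <= t + s.
Proof.
have -> : x - z0 = (z - z0) + (x - z) by rewrite [RHS]addrC subrKA.
move=> h1 h2; apply: le_trans (nrm_triangle _ _) _; lra.
Qed.

End Pair.

(* At a contact point the profile itself is at most [eta], which makes the
   gradient of the localization term and all the errors small. *)
Lemma pair_holder {R : realType} {N : nat} (Om : set 'rV[R]_N) (K a b : 'rV[R]_N -> R)
    (z0 : 'rV[R]_N) (rb L K0 : R) :
  (0 < N)%N -> sq_open Om -> qsub Om K a -> qsub Om (fun x => - K x) b ->
  (forall z, Om z -> usc_in Om a z) -> (forall z, Om z -> usc_in Om b z) ->
  (forall z, Om z -> cont_at K z) -> (forall z, Om z -> a z + b z <= 0) ->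
  lip_ball Om K z0 rb L K0 ->
  exists B h0 : R, [/\ 0 < B, 0 < h0 &
  forall x h : 'rV[R]_N, nrm (x - z0) <= rb / 4 -> nrm h <= h0 ->
    a (x + h) + b x <= B * Num.sqrt (nrm h)].
Proof.
have eqle (s t : R) : s = t -> s <= t by move=> ->.
move=> N0 Oo aq bq ua ub Kc ab hball; have [rb0 rb1 L0 K00 [BOm Klip Kle]] := hball.
have [C1 C1E C10] : exists2 C1 : R, C1 = K0 + 2 * N%:R & 0 <= C1.
  by exists (K0 + 2 * N%:R); rewrite // addr_ge0 ?mulr_ge0.
pose rho := rb / 4; have rho0 : 0 < rho by rewrite divr_gt0.
have c0 : 0 < 4 * (L + C1 + 32) by rewrite mulr_gt0// ltr_wpDl// addr_ge0.
(* The first bound gives slope at least 2 at a contact, the second excludes the sphere around [z],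
   and the third makes the final errors at most 1/4 against a gain of 1/2. *)
pose eta := Num.min (1 / 4) (Num.min (rho ^+ 2) (1 / (4 * (L + C1 + 32)))).
have [e1 e2 e3] : [/\ eta <= 1 / 4, eta <= rho ^+ 2 & eta <= 1 / (4 * (L + C1 + 32))].
  by rewrite /eta !ge_min !lexx !orbT.
have eta0 : 0 < eta.
  by rewrite !lt_min exprn_gt0// !divr_gt0.
rewrite ler_pdivlMr// in e3; clearbody eta.
pose U : set 'rV[R]_N := [set x | sq (x - z0) <= (rb / 2) ^+ 2].
have UO : U `<=` Om.
  by move=> x; rewrite /U /= -nrm_le; [move=> h; apply: BOm; lra|lra].
have Ul x : U x -> a x + b x < eta by move=> /UO/ab; lra.
have [s s0 hs] := diag_usc Oo (@compact_closed_ball _ _ z0 _) UO ua ub Ul.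
pose h0 := Num.min s rho.
have h00 : 0 < h0 by rewrite lt_min s0.
have [hs1 hs2] : h0 <= s /\ h0 <= rho by rewrite /h0 !ge_min !lexx orbT.
(* With this [B] the profile exceeds [eta] at [|h| = h0]. *)
pose B := 1 + eta / Num.sqrt h0.
have sh0 : 0 < Num.sqrt h0 by rewrite sqrtr_gt0.
have B1 : 1 <= B by rewrite lerDl divr_ge0// ltW.
have B0 : 0 < B by lra.
exists B, h0; split => // z h zr.
have hC x k : nrm (x - z) <= rho -> nrm k <= h0 ->
   [/\ nrm (x - z0) <= rb, nrm (x + k - z0) <= rb & a (x + k) + b x < eta].
  move=> xr kr; have xz := near_center zr xr.
  have xkz : nrm (x + k - z0) <= rb.
    by rewrite addrAC; apply: le_trans (nrm_triangle _ _) _; rewrite /rho in hs2 xz; clear - hs2 xz kr rb0; lra.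
  split => //; first by rewrite /rho in xz; clear - xz rb0; lra.
  have Ux : U x by rewrite /U /= -nrm_le; [rewrite /rho in xz; clear - xz rb0; lra|clear - rb0; lra].
  by case: (hs x k Ux); first exact: le_trans kr hs1.
move: h; apply: (@doubling _ _ _ _ _ ua ub ab z rho h0) => //.
- by move=> x k xr kr; have [/BOm ? /BOm ? _] := hC x k xr kr.
- by rewrite nrm0 sqrtr0 mulr0.
- by move=> k _; rewrite mulr_ge0 ?sqrtr_ge0// ltW.
- by move=> k k0; eexists; eexists; apply: D2_scale (rad_sqrt k0).
- move=> x k xr kh; have [_ _ /ltW h] := hC x k xr (eqle _ _ kh).
  apply: le_trans h _; rewrite kh /B mulrDl divfK ?gt_eqF//; lra.
- by move=> x k xr kr; have [_ _ h] := hC x k (eqle _ _ xr) kr; lra.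
move=> x k xr k0 kr; set g := Num.sqrt (nrm k) => hpos hmax.
have [x1 x2 x3] := hC x k (ltW xr) (ltW kr).
have r0 : 0 < nrm k by rewrite sqrtr_gt0 sq_gt0.
have g0 : 0 < g by rewrite sqrtr_gt0.
have gg : nrm k = g ^+ 2 by rewrite sqr_sqrtr// ltW.
have sx := sq_ge0 (x - z).
have Bg : B * g < eta by clear - hpos x3 sx; lra.
have ge : g < eta by clear - Bg B1 g0; nra.
have hD := D2_scale B (rad_sqrt k0); rewrite -/g radZ scalerA in hD.
have al2 : 2 <= B * (2 * g)^-1.
  rewrite ler_pdivlMr ?mulr_gt0//; clear - ge e1 B1; lra.
have f20 : B * - (4 * g * nrm k)^-1 <= 0.
  by rewrite mulrN oppr_le0 mulr_ge0 ?invr_ge0 ?mulr_ge0// ltW.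
have xz2 : nrm (x - z) <= 1 / 2 by rewrite /rho in xr; clear - xr rb1; lra.
have KL : `|K (x + k) - K x| <= L * nrm k.
  have xk : x + k - x = k by rewrite addrC addKr.
  by have := Klip _ _ x2 x1; rewrite xk.
have G0 : 0 <= B * Num.sqrt (nrm k) by rewrite -/g mulr_ge0// ltW.
have := contact_ineq N0 Oo aq bq ua ub Kc (BOm _ x1) (BOm _ x2) k0 hD hmax al2 f20 xz2 KL (Kle _ x1) G0 hpos.
rewrite -/g -C1E gg; set D := a (x + k) + b x in hpos x3 *.
pose T := B * g; have T0 : 0 < T by rewrite mulr_gt0.
have -> : - (B * - (4 * g * g ^+ 2)^-1) / (2 * (B * (2 * g)^-1) ^+ 2) = 1 / (2 * T).
  by rewrite /T; field; rewrite !gt_eqF.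
have -> : 2 * (L * g ^+ 2) * (B * (2 * g)^-1) = L * T.
  by rewrite /T; field; rewrite !gt_eqF.
have -> : 16 * D / (g ^+ 2 * (B * (2 * g)^-1)) = 32 * D / T.
  by rewrite /T; field; rewrite !gt_eqF.
move=> hh; have {hh} := ler_wpM2l (ltW T0) hh.
have -> : T * (1 / (2 * T)) = 1 / 2 by field; rewrite gt_eqF.
have -> : T * (L * T + C1 + 32 * D / T) = L * T ^+ 2 + C1 * T + 32 * D.
  by field; rewrite gt_eqF.
have Te : T < eta by [].
have : L * T ^+ 2 <= L * eta.
  by rewrite ler_wpM2l// expr2; clear - T0 Te e1; nra.
have : C1 * T <= C1 * eta by rewrite ler_wpM2l// ltW.
lra.
Qed.

(** The profile [M |h| - A M^2 |h|^(3/2)] has slope between [M / 2] and [M] on the ball used, and a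
    second derivative of order [|h|^(-1/2)] that beats the errors left by the Hölder bound. *)
Lemma pair_lipschitz {R : realType} {N : nat} (Om : set 'rV[R]_N) (K a b : 'rV[R]_N -> R)
    (z0 : 'rV[R]_N) (rb L K0 : R) :
  (0 < N)%N -> sq_open Om -> qsub Om K a -> qsub Om (fun x => - K x) b ->
  (forall z, Om z -> usc_in Om a z) -> (forall z, Om z -> usc_in Om b z) ->
  (forall z, Om z -> cont_at K z) -> (forall z, Om z -> a z + b z <= 0) ->
  lip_ball Om K z0 rb L K0 ->
  exists M r1 : R, [/\ 0 <= M, 0 < r1 &
  forall x h : 'rV[R]_N, nrm (x - z0) <= r1 -> nrm h <= r1 -> a (x + h) + b x <= M * nrm h].
Proof.
have eqle (s t : R) : s = t -> s <= t by move=> ->.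
move=> N0 Oo aq bq ua ub Kc ab hball; have [rb0 rb1 L0 K00 [BOm Klip Kle]] := hball.
have [C1 C1E C10] : exists2 C1 : R, C1 = K0 + 2 * N%:R & 0 <= C1.
  by exists (K0 + 2 * N%:R); rewrite // addr_ge0 ?mulr_ge0.
have [B [h0 [B0 h00 hH]]] := pair_holder N0 Oo aq bq ua ub Kc ab hball.
pose A := 3 / (16 * B); have A0 : 0 < A by rewrite divr_gt0// mulr_gt0.
pose rho := rb / 8; have rho0 : 0 < rho by rewrite divr_gt0.
have sh0 : 0 < Num.sqrt h0 by rewrite sqrtr_gt0.
pose h0' := Num.min h0 rho; have h0'0 : 0 < h0' by rewrite lt_min h00.
have [hm1 hm2] : h0' <= h0 /\ h0' <= rho by rewrite /h0' !ge_min !lexx orbT.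
have sh0' : 0 < Num.sqrt h0' by rewrite sqrtr_gt0.
have rr : 0 < rho ^+ 2 by rewrite exprn_gt0.
have [M M4 [m1 m2 m3 [m4 m5 m6]]] := absorbing_slope A0 B0 sh0' rr C10 L0.
have M0 : 0 < M by apply: lt_le_trans M4.
(* With [A M g1 = 1/4] the profile at [|h| = g1^2] is [3/4 M g1^2], and [A = 3 / (16 B)] makes this
   equal to [B g1]: it meets the Hölder bound exactly on the sphere. *)
pose g1 := 1 / (4 * A * M).
have AM0 : 0 < 4 * A * M by exact: lt_le_trans ltr01 m1.
have g10 : 0 < g1 by rewrite divr_gt0.
have g1E : A * M * g1 = 1 / 4 by rewrite /g1; field; rewrite !gt_eqF.
have g11 : g1 <= 1 by rewrite /g1 ler_pdivrMr// mul1r.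
have g12 : g1 <= Num.sqrt h0'.
  by rewrite /g1 ler_pdivrMr// mulrC mulrAC.
have g13 : B * g1 <= rho ^+ 2.
  by rewrite /g1 mulrA mulr1 ler_pdivrMr//; clear - m3; lra.
pose h1 := g1 ^+ 2; have h10 : 0 < h1 by rewrite exprn_gt0.
have h1h : h1 <= h0'.
  by rewrite -[leRHS](sqr_sqrtr (ltW h0'0)) lerXn2r ?nnegrE ?(ltW g10) ?(ltW sh0').
have sg1 : Num.sqrt h1 = g1 by rewrite sqrtr_sqr gtr0_norm.
exists M, (Num.min rho h1); split; [exact: ltW|by rewrite lt_min rho0|].
move=> z h; rewrite !le_min => /andP[zr _] /andP[_ hr].
pose G (k : 'rV[R]_N) := M * nrm k - A * M ^+ 2 * (nrm k * Num.sqrt (nrm k)).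
have GE k : G k = M * Num.sqrt (nrm k) ^+ 2 * (1 - A * M * Num.sqrt (nrm k)).
  by rewrite /G sqr_sqrtr ?nrm_ge0//; ring.
have gk (k : 'rV[R]_N) : nrm k <= h1 -> Num.sqrt (nrm k) <= g1.
  by move=> kh; rewrite -sg1; exact: ler_wsqrtr.
have AMg (k : 'rV[R]_N) : nrm k <= h1 -> A * M * Num.sqrt (nrm k) <= 1 / 4.
  by move=> /gk kg; rewrite -g1E ler_wpM2l// mulr_ge0// ltW.
suff : a (z + h) + b z <= G h.
  have : 0 <= A * M ^+ 2 * (nrm h * Num.sqrt (nrm h)).
    have [n1 n2] := (nrm_ge0 h, sqrtr_ge0 (nrm h)); have M2 := sqr_ge0 M.
    by apply: mulr_ge0; apply: mulr_ge0 => //; exact: ltW.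
  by rewrite /G; clear; lra.
have hC x k : nrm (x - z) <= rho -> nrm k <= h1 ->
   [/\ nrm (x - z0) <= rb, nrm (x + k - z0) <= rb &
       a (x + k) + b x <= B * Num.sqrt (nrm k)].
  move=> xr kr; have xz := near_center zr xr.
  have xkz : nrm (x + k - z0) <= rb.
    by rewrite addrAC; apply: le_trans (nrm_triangle _ _) _; rewrite /rho in hm2 xz; clear - hm2 xz kr h1h rb0; lra.
  split => //; first by rewrite /rho in xz; clear - xz rb0; lra.
  by apply: hH; [rewrite /rho in xz; clear - xz rb0; lra|exact: le_trans kr (le_trans h1h hm1)].
move: h hr; apply: (@doubling _ _ _ _ _ ua ub ab z rho h1) => //.
- by move=> x k xr kr; have [/BOm ? /BOm ? _] := hC x k xr kr.
- by rewrite /G nrm0 mul0r !mulr0 subrr.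
- move=> k kh; have := AMg k kh => hk; rewrite GE; apply: mulr_ge0; last by clear - hk; lra.
  by apply: mulr_ge0; [exact: ltW|exact: sqr_ge0].
- by move=> k k0; eexists; eexists; apply: rad_comb k0.
- move=> x k xr kh; have [_ _ h] := hC x k xr (eqle _ _ kh).
  apply: le_trans h _; rewrite GE kh sg1 g1E le_eqVlt; apply/orP; left; apply/eqP.
  by rewrite /g1 /A; field; rewrite !gt_eqF.
- move=> x k xr kr; have [_ _ h] := hC x k (eqle _ _ xr) kr.
  have : B * Num.sqrt (nrm k) <= B * g1 by rewrite ler_wpM2l ?(ltW B0)// gk.
  clear - h g13; lra.
move=> x k xr k0 kr; set g := Num.sqrt (nrm k) => hpos hmax.
have [x1 x2 x3] := hC x k (ltW xr) (ltW kr).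
have r0 : 0 < nrm k by rewrite sqrtr_gt0 sq_gt0.
have g0 : 0 < g by rewrite sqrtr_gt0.
have gg : nrm k = g ^+ 2 by rewrite sqr_sqrtr// ltW.
have gg1 : g <= g1 := gk k (ltW kr).
have Ag : A * M * g <= 1 / 4 := AMg k (ltW kr).
have Ag0 : 0 < A * M * g by do 2 apply: mulr_gt0 => //.
have hD := rad_comb M (A * M ^+ 2) k0; rewrite -/g in hD.
set al := M - 3 / 2 * (A * M ^+ 2) * g in hD.
have alE : al = M * (1 - 3 / 2 * (A * M * g)) by rewrite /al; ring.
have al1 : M / 2 <= al.
  have := ler_wpM2l (ltW M0) Ag; rewrite alE; clear - M0; lra.
have alM : al <= M.
  have := mulr_gt0 M0 Ag0; rewrite alE; clear - M0; lra.
have al2 : 2 <= al by apply: le_trans al1; rewrite ler_pdivlMr//; clear - M4; lra.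
have f20 : - (3 / 4 * (A * M ^+ 2) / g) <= 0.
  have M2 := sqr_ge0 M; rewrite oppr_le0; apply: divr_ge0; last exact: ltW.
  by apply: mulr_ge0; [clear - A0; lra|apply: mulr_ge0 => //; exact: ltW].
have xz2 : nrm (x - z) <= 1 / 2 by rewrite /rho in xr; clear - xr rb1; lra.
have KL : `|K (x + k) - K x| <= L * nrm k.
  have xk : x + k - x = k by rewrite addrC addKr.
  by have := Klip _ _ x2 x1; rewrite xk.
have G0 : 0 <= G k.
  rewrite GE -/g; apply: mulr_ge0; last by clear - Ag; lra.
  by apply: mulr_ge0; [exact: ltW|exact: sqr_ge0].
have := contact_ineq N0 Oo aq bq ua ub Kc (BOm _ x1) (BOm _ x2) k0 hD hmax al2 f20 xz2 KL (Kle _ x1) G0 hpos.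
rewrite -C1E gg; set D := a (x + k) + b x in hpos x3 *.
rewrite sqrtr_sqr gtr0_norm// -/al -/g in x3 *.
apply: lipschitz_gain m4 m5 m6 g0 _ Ag al1 alM x3 => //.
exact: le_trans gg1 g11.
Qed.

(** * The power barrier *)

Section Barrier.
Context {R : realType} {N : nat}.
Implicit Types (x y z d h c p q e g : 'rV[R]_N) (X Y : 'M[R]_N) (a b f F K : 'rV[R]_N -> R).
Implicit Types (Om U : set 'rV[R]_N).

(** The exponent is at least 2, so that the power in the second-order term needs no truncated
    subtraction. *)
Lemma D2_pow f x p X n : D2 f x p X ->
  D2 (fun y => f y ^+ n.+2) x ((n.+2%:R * f x ^+ n.+1) *: p)
    ((n.+2%:R * f x ^+ n.+1) *: X + (n.+2%:R * n.+1%:R * f x ^+ n) *: (p^T *m p)).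
Proof.
move=> hf; elim: n => [|n IH].
  have := D2_mul hf hf; set q := (X in D2 _ _ X _); set Y := (X in D2 _ _ _ X) => h.
  have -> : (2 * f x ^+ 1) *: p = q.
    by rewrite /q; apply/rowP => i; rewrite !mxE; ring.
  have -> : (2 * f x ^+ 1) *: X + (2 * 1 * f x ^+ 0) *: (p^T *m p) = Y.
    by rewrite /Y; move: (p^T *m p) => E; apply/matrixP => i j; rewrite !mxE; ring.
  by apply: D2_eq h => y; rewrite expr2.
have := D2_mul hf IH; set q := (X in D2 _ _ X _); set Y := (X in D2 _ _ _ X) => h.
have -> : (n.+3%:R * f x ^+ n.+2) *: p = q.
  rewrite /q; apply/rowP => i; rewrite !mxE -[n.+3%:R]natr1 !exprS; ring.
have -> : (n.+3%:R * f x ^+ n.+2) *: X + (n.+3%:R * n.+2%:R * f x ^+ n.+1) *: (p^T *m p) = Y.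
  rewrite /Y.
  have -> : p^T *m ((n.+2%:R * f x ^+ n.+1) *: p) = (n.+2%:R * f x ^+ n.+1) *: (p^T *m p).
    by rewrite scalemxAr.
  have -> : ((n.+2%:R * f x ^+ n.+1) *: p)^T *m p = (n.+2%:R * f x ^+ n.+1) *: (p^T *m p).
    by rewrite [(_ *: p)^T]linearZ/= scalemxAl.
  move: (p^T *m p) => E; apply/matrixP => i j; rewrite !mxE -[n.+3%:R]natr1 -[n.+2%:R]natr1 !exprS.
  ring.
by apply: D2_eq h => y; rewrite [RHS]exprS.
Qed.

(** Convexity of the power on [[0, 1]]. With [t = 2^-m] it shows [(1 + t)^m <= 2]. *)
Lemma pow1D_le (t : R) n : 0 <= t -> t <= 1 -> (1 + t) ^+ n <= 1 + (2 ^+ n - 1) * t.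
Proof.
move=> t0 t1; elim: n => [|n IH]; first by rewrite !expr0 subrr mul0r addr0.
rewrite exprSr.
have p1 : 1 <= 2 ^+ n :> R by rewrite exprn_ege1 ?ler1n.
have : (1 + t) ^+ n * (1 + t) <= (1 + (2 ^+ n - 1) * t) * (1 + t).
  by rewrite ler_wpM2r//; lra.
move=> /le_trans; apply; rewrite exprSr.
have : (2 ^+ n - 1) * t * t <= (2 ^+ n - 1) * t by rewrite ler_piMr// mulr_ge0//; lra.
lra.
Qed.

(** Bernoulli's inequality for [1 / q], multiplied out so that [q = 0] is allowed. *)
Lemma pow_small (q : R) n : 0 <= q -> q <= 1 -> q ^+ n * (1 + n%:R * (1 - q)) <= 1.
Proof.
move=> q0 q1; elim: n => [|n IH]; first by rewrite expr0 mul0r addr0 mulr1.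
have qn : q ^+ n.+1 <= 1 by rewrite exprn_ile1.
rewrite -natr1.
have -> : q ^+ n.+1 * (1 + (n%:R + 1) * (1 - q)) =
  q * (q ^+ n * (1 + n%:R * (1 - q))) + q ^+ n.+1 * (1 - q) by rewrite exprS; ring.
have : q * (q ^+ n * (1 + n%:R * (1 - q))) <= q * 1 by rewrite ler_wpM2l.
have : q ^+ n.+1 * (1 - q) <= 1 * (1 - q) by rewrite ler_wpM2r//; lra.
lra.
Qed.

Lemma barrier_exponent (th c d : R) : 0 <= th -> th < 1 -> 0 < d ->
  exists2 n : nat, th ^+ n.+2 <= 1 / 4 & c < n.+2%:R * d.
Proof.
move=> th0 th1 d0; pose C := Num.max (c / d) (3 / (1 - th)).
have t0 : 0 < 1 - th by rewrite subr_gt0.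
pose n := Num.truncn C; exists n; last first.
  rewrite -ltr_pdivrMr//; apply: le_lt_trans (_ : C < _); first by rewrite le_max lexx.
  by apply: lt_trans (truncnS_gt C) _; rewrite ltr_nat.
have n3 : 3 / (1 - th) < n.+2%:R.
  apply: le_lt_trans (_ : C < _); first by rewrite le_max lexx orbT.
  by apply: lt_trans (truncnS_gt C) _; rewrite ltr_nat.
rewrite ltr_pdivrMr// in n3.
have := pow_small n.+2 th0 (ltW th1); have := exprn_ge0 n.+2 th0.
move: (n.+2%:R * (1 - th)) (th ^+ n.+2) n3 => A T A3 T0 TA.
have : T * 4 <= T * (1 + A) by rewrite ler_wpM2l//; lra.
lra.
Qed.

(** At a contact, the penalization is at most the Lipschitz bound plus [O(t)]; hence [|h| / t] is
    bounded independently of [t]. *)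
Lemma slope_bound (s t M c : R) : 0 < t -> 0 <= M -> 2 <= c ->
  s ^+ 2 / (2 * t) <= M * s + c * t -> s <= t * (2 * M + c).
Proof.
move=> t0 M0 c2; have t20 : 0 < 2 * t by rewrite mulr_gt0.
rewrite ler_pdivrMr// => h; rewrite leNgt; apply/negP => hs.
have tM : 0 <= t * M by rewrite mulr_ge0// ltW.
have s0 : 0 < s by apply: le_lt_trans hs; rewrite mulr_ge0 ?(ltW t0)//; lra.
have : s * (s - 2 * t * M) > s * (c * t) by rewrite ltr_pM2l//; lra.
have : s * (c * t) >= (t * c) * (c * t).
  by rewrite ler_wpM2r//; [apply: mulr_ge0; lra|lra].
have : t * c * (c * t) >= 2 * (c * t ^+ 2).
  have -> : t * c * (c * t) = c * (c * t ^+ 2) by ring.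
  by rewrite ler_wpM2r// mulr_ge0 ?sqr_ge0//; lra.
lra.
Qed.

Lemma compact_cap_le z y (c k : R) :
  compact [set x | sq (x - z) <= c /\ sq (x - y) <= k].
Proof.
apply: (@subclosed_compact _ _ [set x | sq (x - z) <= c]).
- have cl w (s : R) : closed [set x : 'rV[R]_N | sq (x - w) <= s].
    by apply: compact_closed; [exact: norm_hausdorff|exact: compact_closed_ball].
  exact: closedI (cl z c) (cl y k).
- exact: compact_closed_ball.
- by move=> x [].
Qed.

Lemma compact_cap_sphere z y (c k : R) :
  compact [set x | sq (x - z) = c /\ sq (x - y) <= k].
Proof.
apply: (@subclosed_compact _ _ [set x | sq (x - z) <= c /\ sq (x - y) <= k]); last first.
- by move=> x /= [-> ?].
- exact: compact_cap_le.
rewrite (_ : [set x | _] = [set x | sq (x - z) <= c /\ sq (x - y) <= k] `&`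
    ~` [set x | sq (x - z) < c]).
  apply: closedI.
    by apply: compact_closed; [exact: norm_hausdorff|exact: compact_cap_le].
  rewrite closedC openE => x /= xc.
  have xc0 : 0 < c - sq (x - z) by rewrite subr_gt0.
  have [r r0 h] := D2_cont (D2_sq z x) xc0.
  apply/nbhs_sqP; exists r => // w /h /(le_lt_trans (ler_norm _)) /=; lra.
apply/seteqP; split => x /= [h1 h2].
  by rewrite h1; split => //; rewrite ltxx.
split; last by case: h1.
by apply/eqP; rewrite eq_le (proj1 h1) leNgt; apply/negP.
Qed.

(* [e1] is, up to [k], the smallest excess per unit of [t] of the penalized
   doubling over its value on the contact set, in small balls around [z1]. *)
Lemma excess_level a b z1 (M R1 k : R) : 0 < k -> 0 < R1 -> a z1 + b z1 = 0 ->
  (forall x h, nrm (x - z1) <= R1 -> nrm h <= R1 -> a (x + h) + b x <= M * nrm h) ->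
  exists e1 rho1 : R, [/\ 0 <= e1, 0 < rho1,
    (forall t x h, 0 < t -> t < rho1 -> nrm (x - z1) <= rho1 -> nrm h <= rho1 ->
      a (x + h) + b x - sq h / (2 * t) <= e1 * t) &
    (forall rho : R, 0 < rho -> exists t x h, [/\ 0 < t, t < rho, nrm (x - z1) <= rho,
      nrm h <= rho & (e1 - k) * t < a (x + h) + b x - sq h / (2 * t)])].
Proof.
move=> k0 R10 z10 hM.
pose E (e : R) := exists2 rho : R, 0 < rho & forall t x h, 0 < t -> t < rho ->
   nrm (x - z1) <= rho -> nrm h <= rho -> a (x + h) + b x - sq h / (2 * t) <= e * t.
have Ege (e : R) : E e -> 0 <= e.
  move=> [rho rho0 h]; have r2 : 0 < rho / 2 by rewrite divr_gt0.
  have r2' : rho / 2 < rho by lra.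
  have := h (rho / 2) z1 0 r2 r2'; rewrite subrr nrm0 addr0 z10 sq0 mul0r subr0.
  by move=> /(_ (ltW rho0) (ltW rho0)); rewrite pmulr_lge0.
have EM : E (M ^+ 2 / 2).
  exists R1 => // t x h t0 _ /hM hx /hx {}hx.
  have -> : M ^+ 2 / 2 * t = M * nrm h - nrm h ^+ 2 / (2 * t) + (M * t - nrm h) ^+ 2 / (2 * t).
    by field; rewrite gt_eqF.
  have : 0 <= (M * t - nrm h) ^+ 2 / (2 * t) by rewrite divr_ge0 ?sqr_ge0// mulr_ge0// ltW.
  by rewrite nrm_sq; lra.
have [e1 [[rho1 rho10 h1] nE]] : exists e1 : R, E e1 /\ ~ E (e1 - k).
  (* Otherwise the level could be lowered by [k] indefinitely, starting from [M^2 / 2], the maximum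
     of [M s - s^2 / 2]; but [h = 0] at [z1] shows that no admissible level is negative. *)
  apply: contrapT => hno.
  have hE (e : R) : E e -> E (e - k).
    by move=> Ee; apply: contrapT => nEe; apply: hno; exists e.
  have En n : E (M ^+ 2 / 2 - n%:R * k).
    elim: n => [|n IH]; first by rewrite mul0r subr0.
    have -> : M ^+ 2 / 2 - n.+1%:R * k = M ^+ 2 / 2 - n%:R * k - k by rewrite -natr1; ring.
    exact: hE.
  pose n := (Num.truncn (M ^+ 2 / 2 / k)).+1.
  have := Ege _ (En n); have : M ^+ 2 / 2 / k < n%:R by apply: truncnS_gt.
  rewrite ltr_pdivrMr//; lra.
exists e1, rho1; split => //; first by apply: Ege; exists rho1.
move=> rho rho0; apply: contrapT => hno; apply: nE; exists rho => // t x h t0 tr xr hr.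
rewrite leNgt; apply/negP => hlt; apply: hno; exists t, x, h; split => //.
Qed.

(* The barrier is [f ^+ m - 1] with [f] equal to 1 on the sphere of radius [r]
   around [y1]; for [m] large its second derivative dominates. *)
Lemma barrier_contradiction K n x h y1 (r L K0 K1 w1 w2 k0 t : R) p q :
  let m : R := n.+2%:R in
  let f x := 2 - sq (x - y1) / r ^+ 2 in
  let v := (- (r ^- 2)) *: (2 *: (x - y1)) in
  let g := (k0 * t) *: ((m * f x ^+ n.+1) *: v) in
  let X := (k0 * t) *: ((m * f x ^+ n.+1) *: ((- (r ^- 2)) *: (2 *: 1%:M)) +
     (m * n.+1%:R * f x ^+ n) *: (v^T *m v)) : 'M[R]_N in
  0 < r -> 0 < t -> 0 <= L -> 0 <= K0 -> 0 <= K1 -> w1 = 1 + K1 -> w2 = (w1 + 1) ^+ 2 ->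
  k0 = 1 / (44 * 200 * 9 * w2) -> p = t^-1 *: h -> nrm p <= K1 ->
  `|K (x + h) - K x| <= L * nrm h -> `|K x| <= K0 ->
  7 / 16 <= f x -> f x <= 23 / 16 -> 1 / 2 <= f x ^+ n.+2 -> f x ^+ n.+2 <= 2 ->
  k0 * t * (15 * m / r) <= 1 ->
  10 * N%:R / r ^+ 2 + 15 * K0 / r + L * K1 * w1 / k0 < m * (1 / (9 * r ^+ 2 * w2)) ->
  q = p + g ->
  (sq g <= 1 -> K (x + h) * W p - K x * W q <= 44 * sq g / t - \tr (Smat q *m X *m Smat q)) ->
  False.
Proof.
move=> m f v g X r0 t0 L0 K00 K10 w1E w2E k0E pE pK KL KK f1 f2 f3 f4 dm big qE main.
have w11 : 1 <= w1 by clear - w1E K10; lra.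
have w20 : 0 < w2 by rewrite w2E exprn_gt0//; lra.
have c0 : 0 < 44 * 200 * 9 * w2 by clear - w20; lra.
have k00 : 0 < k0 by rewrite k0E; exact: divr_gt0 ltr01 c0.
have d0 : 0 < k0 * t by rewrite mulr_gt0.
have m2 : 2 <= m by rewrite /m ler_nat.
have m1E : n.+1%:R = m - 1 :> R by rewrite /m -[n.+2%:R]natr1; ring.
have rr : 0 < r ^+ 2 by rewrite exprn_gt0.
have sv : sq v = 4 * (2 - f x) / r ^+ 2.
  by rewrite /v !sqZ /f; field; rewrite gt_eqF.
clearbody v; set F1 := f x ^+ n.+1 in g X main qE *; set F0 := f x ^+ n in X main *.
have fp : 0 < f x by clear - f1; lra.
have F10 : 0 < F1 by rewrite exprn_gt0.
have F00 : 0 < F0 by rewrite exprn_gt0.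
have F15 : F1 <= 5.
  have : f x * F1 <= 2 by rewrite -exprS.
  have : 7 / 16 * F1 <= f x * F1 by rewrite ler_wpM2r// ltW.
  clear; lra.
have F02 : 2 / 9 <= F0.
  have e : f x ^+ n.+2 = f x ^+ 2 * F0 by rewrite -exprD.
  have : f x ^+ 2 <= (23 / 16) ^+ 2 by rewrite lerXn2r ?nnegrE//; clear - f2 fp; lra.
  rewrite e in f3; clear - f3 F00; nra.
move: (f x) fp sv f1 f2 => fx fp sv f1 f2 in F15 F02 *.
(* [F1 <= 5] and [2 - fx <= 25/16] give [F1^2 * 4 (2 - fx) <= 25 * 25/4], below 200; the bound 15 on
   the norm comes from [15^2 >= 200]. *)
have sg : sq g <= 200 * (k0 * t) ^+ 2 * m ^+ 2 / r ^+ 2.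
  rewrite /g !sqZ sv.
  have -> : (k0 * t) ^+ 2 * ((m * F1) ^+ 2 * (4 * (2 - fx) / r ^+ 2)) =
    ((k0 * t) ^+ 2 * m ^+ 2 / r ^+ 2) * (F1 ^+ 2 * (4 * (2 - fx))).
    by field; rewrite gt_eqF.
  have -> : 200 * (k0 * t) ^+ 2 * m ^+ 2 / r ^+ 2 = ((k0 * t) ^+ 2 * m ^+ 2 / r ^+ 2) * 200 by ring.
  apply: ler_wpM2l; first by apply: divr_ge0; [apply: mulr_ge0; exact: sqr_ge0|exact: sqr_ge0].
  have F125 : F1 ^+ 2 <= 25 by rewrite (_ : 25 = 5 ^+ 2) ?lerXn2r ?nnegrE ?(ltW F10)//; ring.
  have : F1 ^+ 2 * (4 * (2 - fx)) <= 25 * (25 / 4) by apply: ler_pM; rewrite ?sqr_ge0//; clear - f1 f2; lra.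
  clear; lra.
have ng : nrm g <= k0 * t * (15 * m / r).
  have mr0 : 0 <= 15 * m / r by apply: divr_ge0; clear - r0 m2; lra.
  rewrite nrm_le; last by apply: mulr_ge0 => //; exact: ltW.
  apply: le_trans sg _.
  have -> : (k0 * t * (15 * m / r)) ^+ 2 = 225 * (k0 * t) ^+ 2 * m ^+ 2 / r ^+ 2.
    by field; rewrite gt_eqF.
  have : 0 <= (k0 * t) ^+ 2 * m ^+ 2 / r ^+ 2 by apply: divr_ge0; [apply: mulr_ge0; exact: sqr_ge0|exact: sqr_ge0].
  lra.
have g1 : sq g <= 1 by rewrite -[leRHS](expr1n _ 2) -nrm_le//; clear - ng dm; lra.
have {}main := main g1.
have W0 : W (0 : 'rV[R]_N) = 1 by rewrite /W /W2 sq0 addr0 sqrtr1.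
have Wp : W p <= w1.
  have := W_lip p 0; rewrite W0 subr0 => /(le_trans (ler_norm _)); clear - pK w1E; lra.
have Wpq : `|W p - W q| <= nrm g.
  by apply: le_trans (W_lip _ _) _; rewrite qE opprD addrA subrr sub0r nrmN.
have W2q : W2 q <= w2.
  have := ler_norm (- (W p - W q)); rewrite normrN => Wn.
  rewrite -W_sq w2E lerXn2r ?nnegrE ?(ltW (W_gt0 _))//; first by clear - w11; lra.
  clear - Wn Wpq Wp ng dm; lra.
have hn : nrm h <= t * K1.
  have -> : h = t *: p by rewrite pE scalerA divff ?scale1r// gt_eqF.
  by rewrite nrmZ gtr0_norm// ler_wpM2l// ltW.
have lhs : - (L * (t * K1) * w1) - K0 * (k0 * t * (15 * m / r)) <= K (x + h) * W p - K x * W q.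
  have -> : K (x + h) * W p - K x * W q = (K (x + h) - K x) * W p + K x * (W p - W q) by ring.
  have b1 : `|(K (x + h) - K x) * W p| <= L * (t * K1) * w1.
    rewrite normrM; apply: ler_pM => //; last by rewrite ger0_norm ?(ltW (W_gt0 _)).
    by apply: le_trans KL _; rewrite ler_wpM2l.
  have b2 : `|K x * (W p - W q)| <= K0 * (k0 * t * (15 * m / r)).
    by rewrite normrM ler_pM//; clear - Wpq ng; lra.
  have := ler_norm (- ((K (x + h) - K x) * W p)).
  have := ler_norm (- (K x * (W p - W q))); rewrite !normrN; clear - b1 b2; lra.
have trX : \tr (Smat q *m X *m Smat q) =
   k0 * t * (m * F1 * (- (r ^- 2) * 2) * \tr (At q) + m * (m - 1) * F0 * sq (v *m Smat q)).
  rewrite -{2}[Smat q]Smat_tr /X -scalemxAr -scalemxAl mxtraceZ; congr (_ * _).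
  rewrite mulmxDr mulmxDl mxtraceD -!scalemxAr -!scalemxAl !mxtraceZ tr_conj_outer.
  by rewrite mulmx1 Smat_tr Smat_sq m1E; ring.
have svS : 2 / (r ^+ 2 * w2) <= sq (v *m Smat q).
  apply: le_trans (sq_Smat_ge q v); rewrite sv.
  have q0 := W2_gt0 q.
  have -> : 2 / (r ^+ 2 * w2) = 2 / r ^+ 2 / w2 by field; rewrite !gt_eqF.
  apply: ler_pM; rewrite ?invr_ge0 ?(ltW w20) ?divr_ge0 ?(ltW rr)//.
    by rewrite ler_pM2r ?invr_gt0//; clear - f2; lra.
  by rewrite lef_pV2 ?posrE.
have tr1 : - (10 * m * N%:R / r ^+ 2) <= m * F1 * (- (r ^- 2) * 2) * \tr (At q).
  have -> : m * F1 * (- (r ^- 2) * 2) * \tr (At q) = - (2 * m / r ^+ 2 * (F1 * \tr (At q))).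
    by field; rewrite gt_eqF.
  have -> : 10 * m * N%:R / r ^+ 2 = 2 * m / r ^+ 2 * (5 * N%:R) by ring.
  rewrite lerN2 ler_wpM2l ?divr_ge0 ?(ltW rr)//; first by clear - m2; lra.
  have At0 : 0 <= \tr (At q) by rewrite -Smat_sq -{2}[Smat q]Smat_tr; exact: fro_ge0.
  by rewrite ler_pM ?(ltW F10)// tr_At.
have tr2 : m * (2 / 9 * m / (r ^+ 2 * w2)) <= m * (m - 1) * F0 * sq (v *m Smat q).
  have rw : 0 < r ^+ 2 * w2 by rewrite mulr_gt0.
  have -> : m * (2 / 9 * m / (r ^+ 2 * w2)) = m * (m / 2) * (2 / 9) * (2 / (r ^+ 2 * w2)).
    by field; rewrite !gt_eqF.
  have mm : 0 <= m * (m / 2) by clear - m2; nra.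
  apply: ler_pM => //; first by apply: mulr_ge0 => //; clear - m2; lra.
    by apply: divr_ge0 => //; exact: ltW.
  by apply: ler_pM => //; clear - m2; nra.
set T := 10 * m * N%:R / r ^+ 2 in tr1 *.
have hh : L * K1 * w1 / k0 + K0 * (15 * m / r) + T + 44 * 200 * k0 * (m ^+ 2 / r ^+ 2) >= 
   m * (2 / 9 * m / (r ^+ 2 * w2)).
  rewrite -(ler_pM2l d0).
  have -> : k0 * t * (L * K1 * w1 / k0 + K0 * (15 * m / r) + T + 44 * 200 * k0 * (m ^+ 2 / r ^+ 2)) =
    L * (t * K1) * w1 + K0 * (k0 * t * (15 * m / r)) + k0 * t * T
     + 44 * (200 * (k0 * t) ^+ 2 * m ^+ 2 / r ^+ 2) / t.
    by field; rewrite !gt_eqF.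
  have b0 : 44 * sq g / t <= 44 * (200 * (k0 * t) ^+ 2 * m ^+ 2 / r ^+ 2) / t.
    by rewrite ler_pM2r ?invr_gt0// ler_pM2l.
  have b1 := ler_wpM2l (ltW d0) tr1; have b2 := ler_wpM2l (ltW d0) tr2.
  rewrite trX mulrDr in main; clear - main lhs b0 b1 b2; lra.
(* The factors of [k0] are the constant 44 of [fro_Smat_lip], the 200 of [sg], and a 9 that makes
   the coupling error exactly half of the gain [2/9 m^2 / (r^2 w2)]. The other half beats the
   remaining errors by the choice of [m]. *)
have kE : 44 * 200 * k0 * (m ^+ 2 / r ^+ 2) = m * (1 / 9 * m / (r ^+ 2 * w2)).
  by rewrite k0E; field; rewrite !gt_eqF.
have m0 : 0 < m by clear - m2; lra.
have bm := ler_wpM2l (ltW m0) (ltW big); rewrite -(ltr_pM2l m0) in big.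
have c1 : m * (10 * N%:R / r ^+ 2 + 15 * K0 / r + L * K1 * w1 / k0) =
  T + K0 * (15 * m / r) + m * (L * K1 * w1 / k0) by rewrite /T; ring.
have LKw : 0 <= L * K1 * w1.
  by apply: mulr_ge0; [exact: mulr_ge0|clear - w11; lra].
have c2 : L * K1 * w1 / k0 <= m * (L * K1 * w1 / k0).
  rewrite ler_peMl//; last by clear - m2; lra.
  exact: divr_ge0 LKw (ltW k00).
have c3 : m * (m * (1 / (9 * r ^+ 2 * w2))) = m * (1 / 9 * m / (r ^+ 2 * w2)).
  by field; rewrite !gt_eqF.
have c4 : m * (2 / 9 * m / (r ^+ 2 * w2)) = 2 * (m * (1 / 9 * m / (r ^+ 2 * w2))) by ring.
rewrite c1 c3 in big; rewrite kE c4 in hh; clear - big hh c2; lra.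
Qed.

End Barrier.

(** * Contact with the quadratic penalization *)

Section StrongMax.
Context {R : realType} {N : nat}.
Implicit Types (x y z d h c p q e g : 'rV[R]_N) (X Y : 'M[R]_N) (a b f F K : 'rV[R]_N -> R).
Implicit Types (Om U : set 'rV[R]_N).

Hypothesis N0 : (0 < N)%N.
Variables (Om : set 'rV[R]_N) (K a b : 'rV[R]_N -> R).
Hypothesis Oo : sq_open Om.
Hypothesis aq : qsub Om K a.
Hypothesis bq : qsub Om (fun x => - K x) b.
Hypothesis ua : forall z, Om z -> usc_in Om a z.
Hypothesis ub : forall z, Om z -> usc_in Om b z.
Hypothesis Kc : forall z, Om z -> cont_at K z.
Hypothesis ab : forall z, Om z -> a z + b z <= 0.

(** The penalization is convex, so the two roots should be close, in contrast with the reflection: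
    with [S = Smat p] and [T = Smat q] the Hessian [I / t] contributes only
    [|Smat p - Smat q|^2 / t]. *)
Lemma contact_sync x h g X F (t : R) p q : Om x -> Om (x + h) -> 0 < t ->
  D2 F x g X -> X^T = X -> sq g <= 1 ->
  (exists2 s : R, 0 < s & forall c d, sq c < s -> sq d < s ->
     a (x + h + d) + b (x + c) - sq (h + (d - c)) / (2 * t) + F (x + c) <=
     a (x + h) + b x - sq h / (2 * t) + F x) ->
  p = t^-1 *: h -> q = p + g ->
  K (x + h) * W p - K x * W q <= 44 * sq g / t - \tr (Smat q *m X *m Smat q).
Proof.
move=> Ox Oy t0 hF Xs g1 [s s0 hs] pE qE.
have tn : t != 0 by rewrite gt_eqF.
have Ps : (t^-1 *: 1%:M : 'M[R]_N)^T = t^-1 *: 1%:M by rewrite linearZ/= trmx1.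
have Qs : (- X)^T = - X by rewrite linearN/= Xs.
have main := sum_ineq N0 Oo aq bq ua ub Ox Oy (Kc Oy) (cont_atN (Kc Ox)) Ps Qs
  (Smat_unit p) (Smat_unit q) (p := p) (q := q).
have {}main : K (x + h) * W p + - K x * W q <=
   \tr ((Smat p - Smat q) *m (t^-1 *: 1%:M) *m (Smat p - Smat q)^T) +
   \tr (Smat q *m (- X) *m (Smat q)^T).
  apply: main; rewrite ?Smat_tr ?Smat_sq// => k k0.
  have [r r0 hr] := hF k k0.
  exists (Num.min s r); first by rewrite lt_min s0.
  move=> d c; rewrite !lt_min => /andP[d1 d2] /andP[c1 c2].
  have h1 := hs c d c1 d1.
  have h2 := hr c c2; rewrite -normrN in h2; have {}h2 := le_trans (ler_norm _) h2.
  have e1 : sq (h + (d - c)) / (2 * t) = sq h / (2 * t) + dot p (d - c) + sq (d - c) / t / 2.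
    by rewrite sqD pE dotZl; field.
  rewrite bf_mxZ bf_mx1 -/(sq (d - c)) bf_mxN qE.
  have e2 : dot p d - dot (p + g) c = dot p (d - c) - dot g c by rewrite !dotDE; ring.
  rewrite e1 in h1.
  have sd : 0 <= k * sq d by rewrite mulr_ge0 ?sq_ge0// ltW.
  rewrite mulrC in h2 *; lra.
have fr : fro (Smat p - Smat q) <= 44 * sq g.
  have e : sq (p - q) = sq g by rewrite qE opprD addrA subrr sub0r sqN.
  by rewrite -e; apply: fro_Smat_lip; rewrite e.
move: main; rewrite -scalemxAr mulmx1 -scalemxAl mxtraceZ -/(fro _) Smat_tr.
rewrite mulmxN mulNmx linearN/= => main.
have : t^-1 * fro (Smat p - Smat q) <= 44 * sq g / t.
  by rewrite mulrC ler_wpM2r// invr_ge0 ltW.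
lra.
Qed.

Lemma diag_gap U : compact U -> U `<=` Om -> (forall x, U x -> a x + b x < 0) ->
  exists k s : R, [/\ 0 < k, 0 < s & forall x h, U x -> nrm h <= s ->
     a (x + h) + b x <= - k].
Proof.
move=> cU UO Un.
have [U0|/set0P U0] := eqVneq U set0.
  by exists 1, 1; split => // x h; rewrite U0.
have [x Ux hx] := usc_in_max cU U0 (fun x Ux => usc_in_sub UO (usc_inD (ua (UO x Ux)) (ub (UO x Ux)))).
pose k := - (a x + b x) / 2.
have k0 : 0 < k by rewrite /k; have := Un x Ux; lra.
have Uk y : U y -> a y + b y < - k by move=> /hx; rewrite /k in k0 *; lra.
have [s s0 hs] := diag_usc Oo cU UO ua ub Uk.
by exists k, s; split => // y h Uy /(hs y h Uy)[_ /ltW].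
Qed.

Lemma usc_shift x h (k : R) : Om x -> Om (x + h) -> 0 < k ->
  exists2 r : R, 0 < r & forall x' h', Om x' -> Om (x' + h') ->
    sq (x' - x) < r -> sq (h' - h) < r -> a (x' + h') + b x' < a (x + h) + b x + k.
Proof.
move=> Ox Oxh k0; have k20 : 0 < k / 2 by rewrite divr_gt0.
have [r1 r10 k1] := ua Oxh k20; have [r2 r20 k2] := ub Ox k20.
exists (Num.min (r1 / 4) r2); first by rewrite lt_min divr_gt0.
move=> x' h' Ox' Oxh'; rewrite !lt_min => /andP[p1 p2] /andP[q1 q2].
have s1 := sqD_le (x' - x) (h' - h).
have e : x' + h' - (x + h) = (x' - x) + (h' - h) by rewrite opprD addrACA.
have sr : sq (x' + h' - (x + h)) < r1 by rewrite e; lra.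
have := k2 x' Ox' p2; have := k1 (x' + h') Oxh' sr; lra.
Qed.

Lemma penalized_max z1 (rho tau t : R) F : 0 <= rho -> 0 <= tau ->
  (forall x h, nrm (x - z1) <= rho -> nrm h <= tau -> Om x /\ Om (x + h)) ->
  (forall x, exists p X, D2 F x p X) ->
  let P x h := a (x + h) + b x - sq h / (2 * t) + F x in
  exists x h, [/\ nrm (x - z1) <= rho, nrm h <= tau,
    forall x' h', nrm (x' - z1) <= rho -> nrm h' <= tau -> P x' h' <= P x h &
    nrm (x - z1) < rho -> nrm h < tau -> exists2 s : R, 0 < s &
      forall c d, sq c < s -> sq d < s ->
        a (x + h + d) + b (x + c) - sq (h + (d - c)) / (2 * t) + F (x + c) <= P x h].
Proof.
move=> rho0 tau0 OC FD P.
have [|||||x [h [/= xr hr hm]]] := @usc_pair_max _ _ [set x | sq (x - z1) <= rho ^+ 2]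
  [set h | sq (h - 0) <= tau ^+ 2] P.
- exact: compact_closed_ball.
- exact: compact_closed_ball.
- by exists z1; rewrite /= subrr sq0 sqr_ge0.
- by exists 0; rewrite /= subrr sq0 sqr_ge0.
- move=> x h /=; rewrite -!nrm_le// subr0 => xr hr e e0.
  have [Ox Oxh] := OC x h xr hr.
  have e30 : 0 < e / 3 by rewrite divr_gt0.
  have [r1 r10 k1] := usc_shift Ox Oxh e30.
  have [p [X FX]] := FD x; have [r2 r20 k2] := D2_cont FX e30.
  have [r3 r30 k3] := D2_cont (D2_scale (2 * t)^-1 (D2_sq 0 h)) e30.
  exists (Num.min r1 (Num.min r2 r3)); first by rewrite !lt_min r10 r20.
  move=> x' h'; rewrite -!nrm_le// subr0 => x'r h'r.
  rewrite !lt_min => /and3P[p1 p2 p3] /and3P[q1 q2 q3].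
  have [Ox' Oxh'] := OC x' h' x'r h'r.
  have := k1 x' h' Ox' Oxh' p1 q1.
  have := k3 h' q3; rewrite distrC !subr0 ![_^-1 * _]mulrC => /(le_lt_trans (ler_norm _)).
  have := k2 x' p2 => /(le_lt_trans (ler_norm _)); rewrite /P; lra.
move: xr hr; rewrite -!nrm_le// subr0 => xr hr.
have {}hm x' h' : nrm (x' - z1) <= rho -> nrm h' <= tau -> P x' h' <= P x h.
  by rewrite !nrm_le// => x'r h'r; apply: hm; rewrite ?subr0.
exists x, h; split => // xlt hlt.
pose u := Num.min (rho - nrm (x - z1)) ((tau - nrm h) / 2).
have u0 : 0 < u by rewrite lt_min subr_gt0 xlt/= divr_gt0// subr_gt0.
have [u1 u2] : u <= rho - nrm (x - z1) /\ u <= (tau - nrm h) / 2.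
  by rewrite /u !ge_min !lexx orbT.
exists (u ^+ 2); first exact: exprn_gt0.
move=> c d; rewrite -!nrm_lt// => cu du.
have := hm (x + c) (h + (d - c)).
rewrite /P.
have -> : x + c + (h + (d - c)) = x + h + d by apply/rowP => i; rewrite !mxE; ring.
apply.
  rewrite addrAC; apply: le_trans (nrm_triangle _ _) _; lra.
apply: le_trans (nrm_triangle _ _) _.
have := nrm_triangle d (- c); rewrite nrmN; lra.
Qed.

End StrongMax.

(** The barrier [k0 t f^m] moves the maximum to a point where [f^m] lies between 1/2 and 2: a larger
    value would be inside the ball, away from the contact set, and a smaller one could not reach the
    excess level. The quadratic margin in the last hypothesis keeps the maximum off the sphere
    around [z1]. *)
Lemma no_touching_ball {R : realType} {N : nat} (Om : set 'rV[R]_N) (K a b : 'rV[R]_N -> R)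
    (z1 y1 : 'rV[R]_N) (r rb L K0 : R) :
  (0 < N)%N -> sq_open Om -> qsub Om K a -> qsub Om (fun x => - K x) b ->
  (forall z, Om z -> usc_in Om a z) -> (forall z, Om z -> usc_in Om b z) ->
  (forall z, Om z -> cont_at K z) -> (forall z, Om z -> a z + b z <= 0) ->
  lip_ball Om K z1 rb L K0 -> 0 < r -> a z1 + b z1 = 0 -> nrm (z1 - y1) = r ->
  (forall x, nrm (x - z1) <= rb -> a x + b x = 0 ->
     r ^+ 2 + sq (x - z1) / 2 <= sq (x - y1)) -> False.
Proof.
move=> N0 Oo aq bq ua ub Kc ab.
move=> hball r0 z10 z1y1 hZ; have [rb0 rb1 L0 K00 [BOm Klip Kle]] := hball.
have [M [R1 [M0 R10 hM]]] := pair_lipschitz N0 Oo aq bq ua ub Kc ab hball.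
pose K1 := 2 * M + 2; pose w1 := 1 + K1; pose w2 := (w1 + 1) ^+ 2.
have K10 : 0 <= K1 by rewrite /K1; lra.
have w21 : 1 <= w2 by rewrite /w2 exprn_ege1// /w1; lra.
pose k0 : R := 1 / (44 * 200 * 9 * w2).
have cw : 0 < 44 * 200 * 9 * w2 by clear - w21; lra.
have k00 : 0 < k0 := divr_gt0 ltr01 cw.
have k01 : k0 <= 1 by rewrite /k0 ler_pdivrMr// mul1r; clear - w21; lra.
have k80 : 0 < k0 / 8 by rewrite divr_gt0.
have [e1 [rho1 [e10 rho10 hE hN]]] := excess_level k80 R10 z10 hM.
pose rho := Num.min (rb / 2) (Num.min rho1 (Num.min R1 (r / 4))).
have rho0 : 0 < rho by rewrite !lt_min !divr_gt0// rho10 R10.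
have [p1 p2 p3 p4] : [/\ rho <= rb / 2, rho <= rho1, rho <= R1 & rho <= r / 4].
  by rewrite /rho !ge_min !lexx !orbT.
clearbody rho.
have rr : 0 < r ^+ 2 by rewrite exprn_gt0.
(* On the sphere [|x - z1| = rho], the condition [f x >= th] means [|x - y1|^2 <= r^2 + rho^2 / 4],
   below the margin [r^2 + rho^2 / 2] of contact points; where [f < th], the barrier is at most
   [th^m <= 1/4]. *)
pose th := 1 - rho ^+ 2 / (4 * r ^+ 2).
have th1 : 0 < rho ^+ 2 / (4 * r ^+ 2) by rewrite divr_gt0 ?mulr_gt0 ?exprn_gt0.
have th0 : rho ^+ 2 / (4 * r ^+ 2) <= 1.
  rewrite ler_pdivrMr ?mulr_gt0// mul1r.
  have : rho ^+ 2 <= (r / 4) ^+ 2 by rewrite lerXn2r ?nnegrE//; clear - rho0 r0 p4; lra.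
  have -> : (r / 4) ^+ 2 = r ^+ 2 / 16 by field.
  clear - rr; lra.
have th00 : 0 <= th by rewrite /th subr_ge0.
have th11 : th < 1 by rewrite /th gtrBl.
have w20 : 0 < w2 := lt_le_trans ltr01 w21.
have c90 : 0 < 1 / (9 * r ^+ 2 * w2).
  by apply: divr_gt0 => //; do 2 apply: mulr_gt0 => //.
have [n nth nbig] := barrier_exponent
  (10 * N%:R / r ^+ 2 + 15 * K0 / r + L * K1 * w1 / k0) th00 th11 c90.
pose m := n.+2; have m2 : 2 <= m%:R :> R by rewrite ler_nat.
pose f x := 2 - sq (x - y1) / r ^+ 2.
pose v x := (- (r ^- 2)) *: (2 *: (x - y1)) : 'rV[R]_N.
have fD x : D2 f x (v x) ((- (r ^- 2)) *: (2 *: 1%:M)).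
  have := D2_add (D2_cst 2 x) (D2_scale (- (r ^- 2)) (D2_sq y1 x)).
  by rewrite !add0r; apply: D2_eq => y; rewrite /f; ring.
have fmD x := D2_pow n (fD x).
have fb x : nrm (x - z1) <= rho -> 7 / 16 <= f x /\ f x <= 23 / 16.
  move=> xr.
  have u1 : nrm (x - y1) <= 5 / 4 * r.
    have := nrm_triangle (x - z1) (z1 - y1); rewrite subrKA z1y1; clear - xr p4; lra.
  have u2 : 3 / 4 * r <= nrm (x - y1).
    have := nrm_triangle (z1 - x) (x - y1); rewrite subrKA z1y1 (nrm_subC z1); clear - xr p4; lra.
  have v1 : sq (x - y1) <= (5 / 4 * r) ^+ 2 by rewrite -nrm_le//; clear - r0; lra.
  have v2 : (3 / 4 * r) ^+ 2 <= sq (x - y1).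
    by rewrite -nrm_sq lerXn2r ?nnegrE ?nrm_ge0//; clear - r0; lra.
  have q1 : sq (x - y1) / r ^+ 2 <= 25 / 16.
    by rewrite ler_pdivrMr//; apply: le_trans v1 _; rewrite exprMn; clear - rr; lra.
  have q2 : 9 / 16 <= sq (x - y1) / r ^+ 2.
    by rewrite ler_pdivlMr//; apply: le_trans v2; rewrite exprMn; clear - rr; lra.
  by rewrite /f; clear - q1 q2; lra.
pose F3 : R := (23 / 16) ^+ m.
have F30 : 0 < F3 by rewrite exprn_gt0.
have fmF x : nrm (x - z1) <= rho -> 0 <= f x ^+ m /\ f x ^+ m <= F3.
  move=> /fb[g1 g2]; split; first by rewrite exprn_ge0//; clear - g1; lra.
  by rewrite lerXn2r ?nnegrE//; clear - g1 g2; lra.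
(* A level above 1, hence strictly inside the touching ball, whose power [m] is still at most 2. *)
pose be : R := 1 + (2 ^+ m)^-1.
have i2 : 0 < (2 ^+ m)^-1 :> R by rewrite invr_gt0 exprn_gt0.
have bem : be ^+ m <= 2.
  apply: le_trans (@pow1D_le _ _ m _ _) _; first exact: ltW.
    by rewrite invf_le1 ?exprn_gt0// exprn_ege1// ler1n.
  rewrite mulrBl divff; last by rewrite expf_neq0.
  by rewrite mul1r; clear - i2; lra.
pose U1 := [set x : 'rV[R]_N | sq (x - z1) <= rho ^+ 2 /\ sq (x - y1) <= r ^+ 2 * (2 - be)].
pose U2 := [set x : 'rV[R]_N | sq (x - z1) = rho ^+ 2 /\ sq (x - y1) <= r ^+ 2 * (2 - th)].
have rhoOm x : nrm (x - z1) <= rho -> nrm (x - z1) <= rb by clear - p1 rb0; lra.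
have U1O : U1 `<=` Om.
  by move=> x [/= + _]; rewrite -nrm_le ?(ltW rho0)// => /rhoOm/BOm.
have U2O : U2 `<=` Om.
  by move=> x [/= x1 _]; apply/BOm/rhoOm; rewrite nrm_le ?(ltW rho0)// x1.
have neg (U : set 'rV[R]_N) : (forall x, U x -> nrm (x - z1) <= rho /\
    sq (x - y1) < r ^+ 2 + sq (x - z1) / 2) -> forall x, U x -> a x + b x < 0.
  move=> hU x /hU[xr xl]; have xb := rhoOm x xr.
  rewrite lt_neqAle ab ?andbT; last exact: BOm.
  by apply/eqP => /(hZ x xb); clear - xl; lra.
have U1n : forall x, U1 x -> a x + b x < 0.
  apply: neg => x [/= x1 x2]; rewrite nrm_le ?(ltW rho0)//; split => //.
  have : r ^+ 2 * (2 - be) < r ^+ 2 by rewrite gtr_pMr// /be; clear - i2; lra.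
  have := sq_ge0 (x - z1); clear - x2; lra.
have U2n : forall x, U2 x -> a x + b x < 0.
  apply: neg => x [/= x1 x2]; rewrite nrm_le ?(ltW rho0)// x1 lexx; split => //.
  have e : r ^+ 2 * (2 - th) = r ^+ 2 + rho ^+ 2 / 4.
    by rewrite /th; field; rewrite gt_eqF.
  have : 0 < rho ^+ 2 by rewrite exprn_gt0.
  clear - x2 e; lra.
have [g1 [s1 [g10 s10 hU1]]] := diag_gap Oo ua ub (@compact_cap_le _ _ z1 y1 _ _) U1O U1n.
have [g2 [s2 [g20 s20 hU2]]] := diag_gap Oo ua ub (@compact_cap_sphere _ _ z1 y1 _ _) U2O U2n.
pose tau := Num.min (Num.min s1 s2) (Num.min (rb / 2) (Num.min R1 rho1)).
have tau0 : 0 < tau by rewrite !lt_min s10 s20 R10 rho10 divr_gt0.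
have [t1 t2 t3 t4 t5] : [/\ tau <= s1, tau <= s2, tau <= rb / 2, tau <= R1 & tau <= rho1].
  by rewrite /tau !ge_min !lexx !orbT.
clearbody tau.
have z1f : f z1 = 1 by rewrite /f -nrm_sq z1y1 divff ?gt_eqF//; ring.
have e80 : 0 < 1 / 8 :> R by rewrite divr_gt0.
have [r3 r30 hr3] := D2_cont (fmD z1) e80.
(* [slope_bound] yields [|h| <= t c], and [t c] also dominates the barrier term [t F3]. So [t c]
   below [tau], [g1] and [g2] keeps [h] inside its ball and [x] out of [U1] and [U2]. *)
pose c : R := 2 * M + F3 + 2.
have c1 : 1 <= c by rewrite /c; clear - M0 F30; lra.
have c0 : 0 < c := lt_le_trans ltr01 c1.
have sr3 : 0 < Num.sqrt r3 by rewrite sqrtr_gt0.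
have m150 : 0 < 15 * m%:R :> R by rewrite mulr_gt0// ltr0n.
pose rho' := Num.min (Num.min rho (Num.min tau (Num.min rho1 (Num.sqrt r3 / 2))))
  (Num.min (tau / c) (Num.min (g1 / c) (Num.min (g2 / c) (r / (15 * m%:R))))).
have rho'0 : 0 < rho'.
  by rewrite !lt_min rho0 tau0 rho10 divr_gt0//= !divr_gt0.
have [[a1 a2 a3 a4] [a5 a6 a7 a8]] : [/\ rho' <= rho, rho' <= tau, rho' <= rho1 & rho' <= Num.sqrt r3 / 2] /\
  [/\ rho' <= tau / c, rho' <= g1 / c, rho' <= g2 / c & rho' <= r / (15 * m%:R)].
  by rewrite /rho' !ge_min !lexx !orbT.
have [t [xs [hs [t0 trho xsr hsr lev]]]] := hN _ rho'0.
have tc1 : t * c < tau by rewrite -ltr_pdivlMr//; exact: lt_le_trans a5.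
have tc2 : t * c < g1 by rewrite -ltr_pdivlMr//; exact: lt_le_trans a6.
have tc3 : t * c < g2 by rewrite -ltr_pdivlMr//; exact: lt_le_trans a7.
have tm : t * (15 * m%:R) <= r by rewrite -ler_pdivlMr//; exact: le_trans (ltW trho) a8.
have d0 : 0 < k0 * t by rewrite mulr_gt0.
have dt : k0 * t <= t by rewrite ler_piMl// ltW.
have OC x h : nrm (x - z1) <= rho -> nrm h <= tau ->
    [/\ nrm (x - z1) <= rb, nrm (x + h - z1) <= rb, Om x & Om (x + h)].
  move=> xr hr; have xb := rhoOm x xr.
  have xhb : nrm (x + h - z1) <= rb.
    by rewrite addrAC; apply: le_trans (nrm_triangle _ _) _; clear - xr hr p1 t3; lra.
  by split => //; exact: BOm.
have FD x : exists p X, D2 (fun y => k0 * t * f y ^+ m) x p X.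
  by eexists; eexists; exact: D2_scale (fmD x).
have OC' x h : nrm (x - z1) <= rho -> nrm h <= tau -> Om x /\ Om (x + h).
  by move=> xr hr; have [] := OC x h xr hr.
have [x [h [xr hr hmax hloc]]] :=
  penalized_max ua ub t (ltW rho0) (ltW tau0) OC' FD.
have [xb xhb Ox Oxh] := OC x h xr hr.
have fxs : 7 / 8 <= f xs ^+ m.
  have : sq (xs - z1) < r3.
    rewrite -[ltRHS](sqr_sqrtr (ltW r30)) -nrm_lt//.
    clear - xsr a4 sr3; lra.
  move=> /hr3; rewrite z1f expr1n distrC => /(le_lt_trans (ler_norm _)).
  clear; lra.
(* The competitor [(xs, hs)] has excess above [(e1 - k0 / 8) t] and, being close to [z1], a barrier
   at least [7/8 k0 t]. *)
have lvl : (e1 + 3 / 4 * k0) * t < a (x + h) + b x - sq h / (2 * t) + k0 * t * f x ^+ m.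
  have := hmax xs hs (le_trans xsr a1) (le_trans hsr a2).
  have := ler_wpM2l (ltW d0) fxs; clear - lev; lra.
have [fm0 fmF3] := fmF x xr.
have low : 0 < a (x + h) + b x - sq h / (2 * t) + t * F3.
  have : k0 * t * f x ^+ m <= t * F3 by rewrite ler_pM// ltW.
  have : 0 <= (e1 + 3 / 4 * k0) * t by rewrite mulr_ge0 ?(ltW t0)//; clear - e10 k00; lra.
  clear - lvl; lra.
have sh0 : 0 <= sq h / (2 * t) by rewrite divr_ge0 ?sq_ge0// mulr_ge0// ltW.
have hMx : a (x + h) + b x <= M * nrm h.
  by apply: hM; [exact: le_trans xr p3|exact: le_trans hr t4].
have tF3 : t * F3 <= t * c by rewrite ler_wpM2l ?(ltW t0)// /c; clear - M0; lra.
have hlt : nrm h < tau.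
  apply: le_lt_trans tc1; rewrite /c -addrA; apply: slope_bound => //.
    by clear - F30; lra.
  rewrite nrm_sq; have := mulr_ge0 (ltW t0) (ler0n R 2); clear - low hMx; lra.
have fbe : f x ^+ m <= 2.
  apply: le_trans bem; have [fx0 _] := fb x xr.
  rewrite lerXn2r ?nnegrE//; [clear - fx0; lra|rewrite /be; clear - i2; lra|].
  rewrite leNgt; apply/negP => bef.
  have Ux : U1 x.
    split; first by rewrite /= -nrm_le// ltW.
    have : sq (x - y1) / r ^+ 2 <= 2 - be by move: bef; rewrite /f; clear; lra.
    by rewrite ler_pdivrMr// mulrC.
  have := hU1 x h Ux (le_trans hr t1); clear - low sh0 tF3 tc2; lra.
have hE1 : a (x + h) + b x - sq h / (2 * t) <= e1 * t.
  apply: hE => //; first exact: lt_le_trans trho a3.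
    exact: le_trans xr p2.
  exact: le_trans hr t5.
(* The excess alone is at most [e1 t], so the barrier must supply the remaining [3/4 k0 t]. *)
have fm1 : 1 / 2 <= f x ^+ m.
  have : k0 * t * (3 / 4) < k0 * t * f x ^+ m by clear - hE1 lvl; lra.
  by rewrite ltr_pM2l//; clear; lra.
have xlt : nrm (x - z1) < rho.
  rewrite lt_neqAle xr andbT; apply/eqP => xe.
  have xs1 : sq (x - z1) = rho ^+ 2 by rewrite -nrm_sq xe.
  have [fx0 _] := fb x xr.
  have [fth|fth] := leP th (f x).
    have Ux : U2 x.
      split => //; have : sq (x - y1) / r ^+ 2 <= 2 - th by move: fth; rewrite /f; clear; lra.
      by rewrite ler_pdivrMr// mulrC.
    have := hU2 x h Ux (le_trans hr t2); clear - low sh0 tF3 tc3; lra.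
  have : f x ^+ m <= th ^+ m.
    by rewrite lerXn2r ?nnegrE ?(ltW fth)//; clear - fx0; lra.
  by move: (f x ^+ m) fm1 => w; clear - nth; rewrite -/m in nth; lra.
have hp : nrm (t^-1 *: h) <= K1.
  rewrite nrmZ gtr0_norm ?invr_gt0// mulrC ler_pdivrMr// mulrC.
  apply: slope_bound => //; rewrite nrm_sq.
  have : k0 * t * f x ^+ m <= t * 2 by rewrite ler_pM// ltW.
  have : 0 <= (e1 + 3 / 4 * k0) * t by rewrite mulr_ge0 ?(ltW t0)//; clear - e10 k00; lra.
  clear - lvl hMx; lra.
have KL : `|K (x + h) - K x| <= L * nrm h.
  by have := Klip _ _ xhb xb; rewrite (_ : x + h - x = h)// addrC addKr.
have [fx1 fx2] := fb x xr.
apply: (barrier_contradiction (K := K) (n := n) (x := x) (h := h) (y1 := y1) (t := t)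
  r0 t0 L0 K00 K10 (erefl w1) (erefl w2) (erefl k0) (erefl _) hp KL (Kle x xb)
  fx1 fx2 fm1 fbe _ nbig (erefl _)).
  rewrite mulrA ler_pdivrMr// mul1r -mulrA; apply: le_trans tm.
  by rewrite ler_piMl// mulr_ge0 ?(ltW t0)// ltW.
move=> g0; apply: (contact_sync N0 Oo aq bq ua ub Kc Ox Oxh t0 (D2_scale (k0 * t) (fmD x))) => //.
  have trZ (k : R) (X : 'M[R]_N) : X^T = X -> (k *: X)^T = k *: X.
    by move=> e; rewrite [LHS]linearZ/= e.
  by apply: (trZ _ _ _); rewrite linearD/= !trZ ?tr_outer ?trmx1.
exact: hloc.
Qed.

(** Applied to the midpoint of [y] and its closest contact point [z1], the identity turns
    [|x - y| >= |z1 - y|] into the margin [|x - z1|^2 / 2] required by [no_touching_ball]. *)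
Lemma sq_midpoint {R : realType} {N : nat} (x y z : 'rV[R]_N) :
  sq (x - 2^-1 *: (y + z)) = sq (x - y) / 2 + sq (x - z) / 2 - sq (y - z) / 4.
Proof.
have e1 : y - z = (x - z) - (x - y) by apply/rowP => i; rewrite !mxE; ring.
have e2 : x - 2^-1 *: (y + z) = 2^-1 *: ((x - y) + (x - z)).
  by apply/rowP => i; rewrite !mxE; field.
rewrite e1 e2; move: (x - y) (x - z) => p q.
by rewrite sqZ sqB sqD exprVn [dot q p]dotC; field.
Qed.

Lemma lip_ballW {R : realType} {N : nat} (Om : set 'rV[R]_N) K z (rb r L K0 : R) :
  lip_ball Om K z rb L K0 -> 0 < r -> r <= rb -> lip_ball Om K z r L K0.
Proof.
move=> [rb0 rb1 L0 K00 [h1 h2 h3]] r0 rrb; split => //; first exact: le_trans rrb rb1.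
split => [x xr|x y xr yr|x xr]; [apply: h1|apply: h2|apply: h3]; exact: le_trans rrb.
Qed.

(** * Strong comparison by connectedness *)

Section StrongComparison.
Context {R : realType} {N : nat}.
Variables (Om : set 'rV[R]_N) (K a b : 'rV[R]_N -> R).
Hypothesis N0 : (0 < N)%N.
Hypothesis Oo : sq_open Om.
Hypothesis aq : qsub Om K a.
Hypothesis bq : qsub Om (fun x => - K x) b.
Hypothesis ua : forall z, Om z -> usc_in Om a z.
Hypothesis ub : forall z, Om z -> usc_in Om b z.
Hypothesis Kc : forall z, Om z -> cont_at K z.
Hypothesis Klip : forall z, Om z -> exists rb L K0 : R, lip_ball Om K z rb L K0.
Hypothesis ab : forall z, Om z -> a z + b z <= 0.

Lemma open_noncontact : open [set x | Om x /\ a x + b x < 0].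
Proof.
rewrite openE => x /= [Ox x0].
have e0 : 0 < - (a x + b x) by rewrite oppr_gt0.
have [r r0 hr] := usc_inD (ua Ox) (ub Ox) e0.
have [s s0 hs] := Oo Ox.
apply/nbhs_sqP; exists (Num.min r s); first by rewrite lt_min r0.
move=> y; rewrite lt_min => /andP[yr ys]; have Oy := hs y ys; split => //.
by have := hr y Oy yr; rewrite addrN.
Qed.

(* A point near [z0] off the contact set has a closest contact point [z1]; the
   ball whose diameter joins them touches the contact set only at [z1]. *)
Lemma open_contact : open [set x | Om x /\ a x + b x = 0].
Proof.
rewrite openE => z0 /= [Oz0 z00].
have [s s0 hs] := Oo Oz0.
(* Room for three steps inside [Om]: [y] is within [t] of [z0], its closest contact point within
   [2 t], and the ball of radius [r' <= t] around the latter within [3 t]. *)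
pose t := Num.sqrt s / 4; have t0 : 0 < t by rewrite divr_gt0// sqrtr_gt0.
have tO x : nrm (x - z0) <= 3 * t -> Om x.
  move=> xt; apply: hs; rewrite -[ltRHS](sqr_sqrtr (ltW s0)) -nrm_lt ?sqrtr_gt0//.
  apply: le_lt_trans xt _; move: t0; rewrite /t; lra.
apply/nbhs_sqP; exists (t ^+ 2); first exact: exprn_gt0.
move=> y; rewrite -nrm_lt ?(ltW t0)// => yt; have Oy : Om y by apply: tO; lra.
split => //; apply/eqP/negP => /negP yn.
have y0 : a y + b y < 0 by rewrite lt_neqAle yn ab.
pose Z := [set x | sq (x - z0) <= (3 * t) ^+ 2] `&` ~` [set x | Om x /\ a x + b x < 0].
have t30 : 0 <= 3 * t by lra.
have ZE x : Z x <-> nrm (x - z0) <= 3 * t /\ a x + b x = 0.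
  rewrite nrm_le//; split => [[/= x1 x2]|[x1 x2]]; last first.
    by split => //= -[_]; rewrite x2 ltxx.
  split => //; have Ox : Om x by apply: tO; rewrite nrm_le.
  by apply/eqP; rewrite eq_le ab//= leNgt; apply/negP => x3; apply: x2.
have cZ : compact Z.
  apply: (@subclosed_compact _ _ [set x | sq (x - z0) <= (3 * t) ^+ 2]).
  - apply: closedI; last by apply: open_closedC; exact: open_noncontact.
    by apply: compact_closed; [exact: norm_hausdorff|exact: compact_closed_ball].
  - exact: compact_closed_ball.
  - by move=> x [].
have Z0 : Z z0 by apply/ZE; rewrite subrr nrm0.
have [z1 /ZE[z1t z10] hz1] := usc_in_max cZ (ex_intro _ z0 Z0)
  (fun x Zx => D2_usc Z (D2_scale (-1) (D2_sq y x))).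
have {}hz1 x : Z x -> sq (z1 - y) <= sq (x - y) by move=> /hz1; lra.
have z1y : nrm (z1 - y) < t.
  apply: le_lt_trans yt; rewrite nrm_le ?nrm_ge0// nrm_sq.
  by apply: le_trans (hz1 _ Z0) _; rewrite -opprB sqN.
have z1z : nrm (z1 - z0) < 2 * t.
  by have := nrm_triangle (z1 - y) (y - z0); rewrite subrKA; lra.
have Oz1 : Om z1 by apply: tO; lra.
have [rb [L [K0 hball]]] := Klip Oz1.
pose r' := Num.min rb t; have rb0 : 0 < rb by case: hball.
have r'0 : 0 < r' by rewrite lt_min rb0.
have [r1 r2] : r' <= rb /\ r' <= t by rewrite /r' !ge_min !lexx orbT.
have zy : z1 != y by apply: contraTneq yn => <-; rewrite z10 eqxx.
apply: (no_touching_ball (y1 := 2^-1 *: (y + z1)) (r := nrm (z1 - y) / 2) N0 Oo aq bq ua ub Kc ab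
  (lip_ballW hball r'0 r1)) => //.
- by rewrite divr_gt0// sqrtr_gt0 sq_gt0// subr_eq0.
- have -> : z1 - 2^-1 *: (y + z1) = 2^-1 *: (z1 - y) by apply/rowP => i; rewrite !mxE; field.
  by rewrite nrmZ ger0_norm// mulrC.
move=> x xr x0; rewrite sq_midpoint exprMn nrm_sq exprVn.
have /hz1 : Z x.
  apply/ZE; split => //.
  by have := nrm_triangle (x - z1) (z1 - z0); rewrite subrKA; lra.
rewrite -(sqN (y - z1)) opprB; lra.
Qed.

Lemma strong_comparison : connected Om ->
  (forall x, Om x -> a x + b x = 0) \/ (forall x, Om x -> a x + b x < 0).
Proof.
move=> cO.
have [[z [Oz z0]]|no] := pselect (exists z, Om z /\ a z + b z = 0); last first.
  right => x Ox; rewrite lt_neqAle ab// andbT; apply/eqP => x0.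
  by apply: no; exists x.
left; have -> // : Om = [set x | Om x /\ a x + b x = 0]; last by move=> x [].
symmetry; apply: cO; first by exists z.
  exists [set x | Om x /\ a x + b x = 0]; first exact: open_contact.
  by apply/seteqP; split => x /=; tauto.
exists (~` [set x | Om x /\ a x + b x < 0]); first exact/open_closedC/open_noncontact.
apply/seteqP; split => x /=.
  by move=> [Ox x0]; split => // -[_]; rewrite x0 ltxx.
move=> [Ox xn]; split => //; apply/eqP; rewrite eq_le ab//= leNgt.
by apply/negP => x0; apply: xn.
Qed.

End StrongComparison.

(** * Quadratic polynomials as test functions *)

Section Viscosity.
Context {R : realType} {N : nat}.
Implicit Types (x y z d v p q : 'rV[R]_N) (X : 'M[R]_N) (f u : 'rV[R]_N -> R) (A Om : set 'rV[R]_N).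

Lemma D2_exact f x p X :
  (forall d, f (x + d) = f x + dot p d + qf X d / 2) -> D2 f x p X.
Proof.
move=> h e e0; exists 1 => // d _; rewrite h.
rewrite (_ : _ - _ - _ - _ = 0); last by ring.
by rewrite normr0 mulr_ge0 ?sq_ge0// ltW.
Qed.

Lemma D2_continuous f x p X : D2 f x p X -> {for x, continuous f}.
Proof.
move=> hf; apply/(@cvgrPdist_lt _ _ _ (nbhs x)) => e e0; have [r r0 hr] := D2_cont hf e0.
by apply/nbhs_sqP; exists r => // y /hr; rewrite distrC.
Qed.

Lemma D2_is_derive f x v p X : D2 f x p X -> is_derive x v f (dot p v).
Proof.
move=> hf.
have cv : (fun h : R => h^-1 *: ((f \o shift x) (h *: v) - f x)) @ 0^' --> dot p v.
  apply/cvgrPdist_lt => e e0; have [r r0 hr] := hf 1 ltr01.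
  pose C := `|qf X v| / 2 + sq v + 1.
  have C0 : 0 < C by rewrite /C; have := normr_ge0 (qf X v); have := sq_ge0 v; lra.
  pose s := Num.min 1 (Num.min (r / C) (e / C)).
  have s0 : 0 < s by rewrite !lt_min ltr01 !divr_gt0.
  have [s1 s2 s3] : [/\ s <= 1, s <= r / C & s <= e / C].
    by rewrite /s !ge_min !lexx !orbT.
  near=> h.
  have hs : `|h| < s by near: h; exact: dnbhs0_lt.
  have h0 : h != 0 by near: h; exact: nbhs_dnbhs_neq.
  have ah0 : 0 < `|h| by rewrite normr_gt0.
  have vC : sq v <= C by rewrite /C; have := normr_ge0 (qf X v); lra.
  have hv : sq (h *: v) < r.
    rewrite sqZ -(real_normK (num_real h)) expr2 -mulrA.
    have q1 : `|h| * sq v <= r.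
      by apply: le_trans (_ : s * C <= r); [rewrite ler_pM ?sq_ge0// ltW|rewrite -ler_pdivlMr].
    apply: le_lt_trans (ler_wpM2l (ltW ah0) q1) _.
    by rewrite gtr_pMl//; exact: lt_le_trans s1.
  have := hr _ hv; rewrite dotDE !bfVE mul1r sqZ -(real_normK (num_real h)).
  have -> : f (x + h *: v) - f x - h * dot p v - h * (h * qf X v) / 2 =
    h * (h^-1 *: ((f \o shift x) (h *: v) - f x) - dot p v - h * (qf X v / 2)).
    rewrite /= [h *: v + x]addrC (_ : h^-1 *: (f (x + h *: v) - f x) = h^-1 * (f (x + h *: v) - f x))//.
    by move: (f (x + h *: v)) (f x) (dot p v) (qf X v) => t1 t2 t3 t4; field.
  rewrite normrM expr2 -mulrA ler_pM2l// => hh; rewrite distrC.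
  move: hh; move: (h^-1 *: _) => w hh.
  have hC : `|h| * C < s * C by rewrite ltr_pM2r.
  have sC : s * C <= e by rewrite -ler_pdivlMr.
  have hq : `|h * (qf X v / 2)| = `|h| * (`|qf X v| / 2).
    by rewrite !normrM (ger0_norm (_ : 0 <= 2^-1)) ?invr_ge0.
  have := ler_normD (w - dot p v - h * (qf X v / 2)) (h * (qf X v / 2)).
  rewrite subrK hq => hn; apply: le_lt_trans hn _; apply: le_lt_trans (lerD hh (lexx _)) _.
  apply: lt_le_trans sC; apply: le_lt_trans hC.
  by rewrite -mulrDr ler_wpM2l ?(ltW ah0)// /C; lra.
apply: DeriveDef; first by apply/cvg_ex; exists (dot p v).
exact: cvg_lim.
Unshelve. all: by end_near.
Qed.

Lemma derive_invM f (g : 'rV[R]_N -> R) x v (df dg : R) : f x != 0 ->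
  is_derive x v f df -> is_derive x v g dg ->
  'D_v (fun y => (f y)^-1 * g y) x = dg / f x - g x * df / f x ^+ 2.
Proof.
move=> f0 [hf ef] [hg eg].
have := @deriveM _ _ (fun y => (f y)^-1) g x v (derivableV f0 hf) hg.
rewrite deriveV// ef eg => e; apply: etrans e _.
have sc (s t : R) : s *: (t : R^o) = s * t by [].
by rewrite !sc; field.
Qed.

Definition quadratic (c : R) z p X y := c + dot p (y - z) + qf X (y - z) / 2.

Definition quadratic_grad z p X y := p + (y - z) *m X.

Lemma D2_quadratic c z p X y : X^T = X ->
  D2 (quadratic c z p X) y (quadratic_grad z p X y) X.
Proof.
move=> Xs; apply: D2_exact => d; rewrite /quadratic /quadratic_grad.
have -> : y + d - z = (y - z) + d by rewrite addrAC.
move: (y - z) => w; rewrite !dotDE !bfVE (bf_sym d w Xs).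
by rewrite -/(bf X w d); field.
Qed.

Lemma D2_quadratic_grad z p X y i :
  D2 (fun y => quadratic_grad z p X y 0 i) y (col i X)^T 0.
Proof.
apply: D2_exact => d; rewrite bf_mx0 mul0r addr0 /quadratic_grad.
have -> : y + d - z = (y - z) + d by rewrite addrAC.
rewrite mulmxDl addrA [LHS]mxE; congr (_ + _).
by rewrite dotC dotE mxE; apply: eq_bigr => j _; rewrite !mxE.
Qed.

Lemma D2_quadratic_slope z p X y :
  D2 (fun y => W2 (quadratic_grad z p X y)) y
    (2 *: (quadratic_grad z p X y *m X^T)) (2 *: (X *m X^T)).
Proof.
apply: D2_exact => d; rewrite /W2 /quadratic_grad.
have -> : y + d - z = (y - z) + d by rewrite addrAC.
rewrite [(y - z + d) *m X]mulmxDl [p + (_ + d *m X)]addrA.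
move: (p + (y - z) *m X) => q; rewrite sqD bf_mxZ dotZl.
have -> : dot q (d *m X) = dot (q *m X^T) d by rewrite dot_mulmx trmxK.
have -> : sq (d *m X) = qf (X *m X^T) d.
  by rewrite /bf mulmxA dot_mulmx trmxK.
by field.
Qed.

Lemma partial_quadratic c z p X i : X^T = X ->
  partial i (quadratic c z p X) = fun y => quadratic_grad z p X y 0 i.
Proof.
move=> Xs; apply/funext => y; rewrite /partial.
by have [_ ->] := D2_is_derive 'e_i (D2_quadratic c z p y Xs); rewrite dot_delta.
Qed.

Lemma of_class_C2_quadratic Om c z p X : X^T = X -> of_class_C 2 Om (quadratic c z p X).
Proof.
move=> Xs; split; first by move=> y _; exact: D2_continuous (D2_quadratic c z p y Xs).
move=> i; split.
  by move=> y _; have [] := D2_is_derive 'e_i (D2_quadratic c z p y Xs).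
rewrite (partial_quadratic _ _ _ _ Xs); split.
  by move=> y _; exact: D2_continuous (D2_quadratic_grad z p X y i).
move=> j; split.
  by move=> y _; have [] := D2_is_derive 'e_j (D2_quadratic_grad z p X y i).
split => // y _.
rewrite (_ : partial j _ = fun=> X j i); first exact: cst_continuous.
apply/funext => w; rewrite /partial.
by have [_ ->] := D2_is_derive 'e_j (D2_quadratic_grad z p X w i); rewrite dot_delta !mxE.
Qed.

Lemma enorm_sqr p : enorm p ^+ 2 = sq p.
Proof. by rewrite /enorm sqr_sqrtr -?sqE// sq_ge0. Qed.

(** The product rule gives [X i i / W] and a term from the derivative of [1 / W]; summed over [i]
    these are the trace and the quadratic form in [Eop]. The base point suffices, since the tests
    are centred at the contact. *)
Lemma mean_curvature_quadratic c z p X : X^T = X ->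
  mean_curvature_op (quadratic c z p X) z = Eop p X / W p.
Proof.
move=> Xs; rewrite /mean_curvature_op /divergence.
have gE y : grad (quadratic c z p X) y = quadratic_grad z p X y.
  by apply/rowP => i; rewrite mxE partial_quadratic.
have g0 : quadratic_grad z p X z = p by rewrite /quadratic_grad subrr mul0mx addr0.
have W20 := W2_gt0 p; have W0 := W_gt0 p.
have term i : partial i (fun y => ((Num.sqrt (1 + enorm (grad (quadratic c z p X) y) ^+ 2))^-1
    *: grad (quadratic c z p X) y) 0 i) z = X i i / W p - p 0 i * (p *m X) 0 i / (W2 p * W p).
  rewrite (_ : (fun y => _) =
      (fun y => (W (quadratic_grad z p X y))^-1 * quadratic_grad z p X y 0 i)); last first.
    by apply/funext => y; rewrite mxE gE enorm_sqr.
  have pos : 0 < W2 (quadratic_grad z p X z) by rewrite W2_gt0.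
  have dW : is_derive z 'e_i (fun y => W (quadratic_grad z p X y)) ((W p)^-1 * (p *m X) 0 i).
    have := D2_sqrt (f := fun y => W2 (quadratic_grad z p X y)) pos (D2_quadratic_slope z p X z).
    move=> /(D2_is_derive 'e_i); rewrite g0 dot_delta -/(W p) Xs.
    have -> : ((2 * W p)^-1 *: (2 *: (p *m X))) 0 i = (W p)^-1 * (p *m X) 0 i; last by [].
    by move: (p *m X) => q; rewrite !mxE; field; rewrite gt_eqF.
  have dg := D2_is_derive 'e_i (D2_quadratic_grad z p X z i).
  have Wn : W (quadratic_grad z p X z) != 0 by rewrite gt_eqF ?W_gt0.
  rewrite /partial (@derive_invM (fun y => W (quadratic_grad z p X y))
    (fun y => quadratic_grad z p X y 0 i) z 'e_i _ _ Wn dW dg) g0 dot_delta -W_sq.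
  have -> : (col i X)^T 0 i = X i i by rewrite !mxE.
  by field; rewrite gt_eqF.
rewrite (eq_bigr _ (fun i _ => term i)) sumrB -mulr_suml -mulr_suml.
have -> : \sum_i p 0 i * (p *m X) 0 i = qf X p by rewrite /bf dotC dotE.
rewrite /Eop /mxtrace; field.
by rewrite !gt_eqF.
Qed.

End Viscosity.

(** * From viscosity solutions to the comparison theorem *)

Section Assembly.
Context {R : realType} {N : nat}.
Implicit Types (x y z d p : 'rV[R]_N) (X : 'M[R]_N) (H f u v : 'rV[R]_N -> R) (A Om : set 'rV[R]_N).

Lemma subsolution_qsub Om H v :
  viscosity_subsolution Om H v -> qsub Om (fun x => N%:R * H x) v.
Proof.
move=> [_ hv] x Ox p X Xs [r r0 hr].
have := hv (quadratic (v x) x p X) x (of_class_C2_quadratic _ _ _ _ Xs) Ox.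
rewrite mean_curvature_quadratic// ler_pdivlMr ?W_gt0//; apply.
apply/nbhs_sqP; exists r => // y /hr.
by rewrite addrC subrK /= /quadratic subrr dot0r bf0r mul0r !addr0; lra.
Qed.

(** The operator is odd: a test [(p, X)] touching [- u] from above is a test [(- p, - X)] touching
    [u] from below. *)
Lemma supersolution_qsub Om H u :
  viscosity_supersolution Om H u -> qsub Om (fun x => - (N%:R * H x)) (fun x => - u x).
Proof.
move=> [_ hu] x Ox p X Xs [r r0 hr].
have Xs' : (- X)^T = - X by rewrite linearN/= Xs.
have := hu (quadratic (u x) x (- p) (- X)) x (of_class_C2_quadratic _ _ _ _ Xs') Ox.
rewrite mean_curvature_quadratic// ler_pdivrMr ?W_gt0// EopN WN.
have -> : Eop p (- X) = - Eop p X by rewrite /Eop linearN/= bf_mxN; ring.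
move=> h; rewrite mulNr lerNl; apply: h.
apply/nbhs_sqP; exists r => // y /hr.
rewrite addrC subrK /= /quadratic subrr dot0r bf0r mul0r !addr0 dotNl bf_mxN; lra.
Qed.

Lemma qsub_shift Om K f (c : R) : qsub Om K f -> qsub Om K (fun x => f x + c).
Proof.
move=> hf x Ox p X Xs [r r0 hr]; apply: hf => //.
by exists r => // d /hr; rewrite addrAC; lra.
Qed.

Lemma lsc_on_usc_in A f x : lsc_on A f -> A x -> usc_in A (fun y => - f y) x.
Proof.
move=> hf Ax e e0; have fx : ((f x - e)%:E < (EFin \o f) x)%E by rewrite lte_fin/=; lra.
have [V Vx hV] := hf x (f x - e) fx.
have [r r0 hr] : exists2 r : R, 0 < r & forall y, sq (y - x) < r -> A y -> V y.
  by apply/nbhs_sqP; move: Vx; rewrite /nbhs/= -(nbhs_subspace_in Ax).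
by exists r => // y Ay /hr/(_ Ay)/hV; rewrite lte_fin/=; lra.
Qed.

Lemma usc_on_usc_in A f x : usc_on A f -> A x -> usc_in A f x.
Proof.
move=> hf Ax e e0; have [r r0 hr] := lsc_on_usc_in hf Ax e0.
by exists r => // y Ay /(hr y Ay) /=; rewrite !opprK.
Qed.

Lemma open_sq_open A : open A -> sq_open A.
Proof. by rewrite openE => oA x /oA/nbhs_sqP. Qed.

Lemma locally_lipschitz_lip_ball Om H z (c : R) : sq_open Om -> 0 <= c ->
  locally_lipschitz_on Om H -> Om z ->
  exists rb L K0 : R, lip_ball Om (fun x => c * H x) z rb L K0.
Proof.
move=> oO c0 hH Oz; have [V /nbhs_sqP[s s0 hs] [M0 [_ hM]]] := hH z Oz.
have [r r0 hr] := oO z Oz.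
(* The Lipschitz property holds for every constant larger than [M0], which may be negative. *)
pose M := Num.max M0 0 + 1.
have M0' : 0 <= M by rewrite /M addr_ge0// le_max lexx orbT.
have {hM} : M.-lipschitz_on (fun y => H y) (globally ((V `&` Om) `*` (V `&` Om))).
  by apply: hM; rewrite /M; apply: le_lt_trans (_ : Num.max M0 0 < _); rewrite ?le_max ?lexx// ltrDl.
rewrite /= => hM.
pose rb := Num.min 1 (Num.min (Num.sqrt s / 2) (Num.sqrt r / 2)).
have rb0 : 0 < rb by rewrite !lt_min ltr01 !divr_gt0// sqrtr_gt0.
have [rb1 rbs rbr] : [/\ rb <= 1, rb <= Num.sqrt s / 2 & rb <= Num.sqrt r / 2].
  by rewrite /rb !ge_min !lexx !orbT.
have inV x : nrm (x - z) <= rb -> V x /\ Om x.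
  have lt (t : R) : 0 < t -> rb <= Num.sqrt t / 2 -> nrm (x - z) <= rb -> sq (x - z) < t.
    move=> t0 rt xr; have st : 0 < Num.sqrt t by rewrite sqrtr_gt0.
    rewrite -[ltRHS](sqr_sqrtr (ltW t0)) -nrm_lt//; lra.
  by move=> xr; split; [apply: hs|apply: hr]; exact: lt.
have lipc x y : nrm (x - z) <= rb -> nrm (y - z) <= rb ->
    `|c * H x - c * H y| <= c * M * nrm (x - y).
  move=> /inV xV /inV yV; rewrite -mulrBr normrM ger0_norm// -mulrA ler_wpM2l//.
  apply: le_trans (_ : M * `|x - y| <= _); last by rewrite ler_wpM2l// normr_le_nrm.
  by have := hM (x, y) (conj xV yV).
exists rb, (c * M), (c * M + `|c * H z|); split => //; [exact: mulr_ge0| |].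
  by rewrite addr_ge0// mulr_ge0.
split => [x /inV[]//|//|x xr].
have zr : nrm (z - z) <= rb by rewrite subrr nrm0 ltW.
have := ler_normD (c * H x - c * H z) (c * H z); rewrite subrK => /le_trans; apply.
rewrite lerD2r; apply: le_trans (lipc x z xr zr) _.
by rewrite ler_piMr ?mulr_ge0//; lra.
Qed.

Lemma lip_ball_cont_at Om K z (rb L K0 : R) : lip_ball Om K z rb L K0 -> cont_at K z.
Proof.
move=> [rb0 _ L0 _ [_ hL _]] e e0; pose t := Num.min rb (e / (L + 1)).
have L1 : 0 < L + 1 by rewrite ltr_wpDl.
have t0 : 0 < t by rewrite lt_min rb0 divr_gt0.
have [t1 t2] : t <= rb /\ t <= e / (L + 1) by rewrite /t !ge_min !lexx orbT.
exists (t ^+ 2); first exact: exprn_gt0.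
move=> y; rewrite -nrm_lt// => yt.
have zr : nrm (z - z) <= rb by rewrite subrr nrm0 ltW.
apply: le_lt_trans (hL y z (ltW (lt_le_trans yt t1)) zr) _.
apply: le_lt_trans (_ : L * t < _); first by rewrite ler_wpM2l// ltW.
by rewrite ler_pdivlMr// in t2; lra.
Qed.

(** A coordinate attains its maximum on the compact closure, and never at an interior point. *)
Lemma boundary_nonempty Om : (0 < N)%N -> open Om -> Om !=set0 -> compact (closure Om) ->
  boundary Om !=set0.
Proof.
move=> N0 oO [z Oz] cO; pose i := Ordinal N0.
have Cz : closure Om z by exact: subset_closure.
have usc x : closure Om x -> usc_in (closure Om) (fun y => dot y 'e_i) x.
  move=> _; apply: (@D2_usc R N _ _ x 'e_i 0); apply: D2_exact => d.
  by rewrite bf_mx0 mul0r addr0 dotDl [dot 'e_i d]dotC.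
have [x Cx hx] := usc_in_max cO (ex_intro _ z Cz) usc.
exists x; split => // /interior_subset Ox.
have [r r0 hr] := open_sq_open oO Ox.
pose t := Num.sqrt r / 2; have t0 : 0 < t by rewrite divr_gt0// sqrtr_gt0.
have e1 : sq ('e_i : 'rV[R]_N) = 1 by rewrite /sq dot_delta mxE !eqxx.
have : closure Om (x + t *: 'e_i).
  apply/subset_closure/hr; rewrite addrC addKr sqZ e1 mulr1 /t exprMn sqr_sqrtr ?(ltW r0)//.
  by rewrite gtr_pMr// exprVn invf_lt1// -natrX ltr1n.
by move=> /hx; rewrite dotDl dotZl -/(sq _) e1; lra.
Qed.

End Assembly.

Theorem theorem3p1 (R : realType) (N : nat) (hN : (2 <= N)%N)
    (Omega : set 'rV[R]_N) (hOmega : bounded_domain Omega)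
    (H : 'rV[R]_N -> R) (hH : locally_lipschitz_on Omega H)
    (u v : 'rV[R]_N -> R)
    (u_lsc : lsc_on (closure Omega) u)
    (u_super : viscosity_supersolution Omega H u)
    (v_usc : usc_on (closure Omega) v)
    (v_sub : viscosity_subsolution Omega H v)
    (uv_boundary : forall x, boundary Omega x -> v x <= u x) :
  (forall x, Omega x -> v x <= u x) /\
  ((forall x, Omega x -> u x = v x) \/ (forall x, Omega x -> v x < u x)).
Proof.
case: (hOmega) => O0 oO cO bO.
have N0 : (0 < N)%N by exact: ltnW hN.
have Oo := open_sq_open oO.
have OC : Omega `<=` closure Omega := @subset_closure _ Omega.
have [M hM] : exists M : R, forall x, Omega x -> `|x| <= M.
  have [M [_ hM]] := bO; exists (M + 1) => x; apply: hM; lra.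
have Cc : compact (closure Omega).
  apply: (@subclosed_compact _ _ [set x | sq (x - 0) <= N%:R * M ^+ 2]).
  - exact: closed_closure.
  - exact: compact_closed_ball.
  - have cl : closed [set x : 'rV[R]_N | sq (x - 0) <= N%:R * M ^+ 2].
      by apply: compact_closed; [exact: norm_hausdorff|exact: compact_closed_ball].
    apply: subset_trans cl; apply: closure_subset => x /hM xM /=; rewrite subr0.
    apply: le_trans (sq_le_normr x) _; rewrite ler_wpM2l// lerXn2r ?nnegrE//.
    exact: le_trans xM.
have uC x : closure Omega x -> usc_in (closure Omega) (fun y => - u y) x.
  exact: lsc_on_usc_in.
have vC x : closure Omega x -> usc_in (closure Omega) v x by exact: usc_on_usc_in.
have lip z : Omega z -> exists rb L K0 : R, lip_ball Omega (fun x => N%:R * H x) z rb L K0.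
  exact: locally_lipschitz_lip_ball (ler0n _ _) hH.
have [y0 bd0] := boundary_nonempty N0 oO O0 Cc.
(* Constants may be subtracted because the operator involves only derivatives. *)
have strong (m : R) : (forall x, Omega x -> v x - u x <= m) ->
    (forall x, Omega x -> v x - u x = m) \/ (forall x, Omega x -> v x - u x < m).
  move=> hm.
  have ub z : Omega z -> usc_in Omega (fun x => - u x + - m) z.
    move=> Oz; apply: usc_inD; first exact: usc_in_sub OC (uC z (OC z Oz)).
    exact: D2_usc (D2_cst (- m) z).
  have va z : Omega z -> usc_in Omega v z by move=> Oz; apply: usc_in_sub OC (vC z (OC z Oz)).
  have Kc z : Omega z -> cont_at (fun x => N%:R * H x) z.
    by move=> /lip[rb [L [K0 /lip_ball_cont_at]]].
  have ab z : Omega z -> v z + (- u z + - m) <= 0 by move=> /hm; lra.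
  have [h|h] := strong_comparison N0 Oo (subsolution_qsub v_sub)
    (qsub_shift (c := - m) (supersolution_qsub u_super)) va ub Kc lip ab cO.
  - by left => x /h; lra.
  - by right => x /h; lra.
have [x1 Cx1 hx1] := usc_in_max Cc (ex_intro _ _ (proj1 bd0)) (fun x Cx => usc_inD (vC x Cx) (uC x Cx)).
have le : forall x, Omega x -> v x <= u x.
  have [x1m|x1m] := leP (v x1 + - u x1) 0.
    by move=> x /OC/hx1; lra.
  have Ox1 : Omega x1.
    apply: contrapT => nOx1; have : boundary Omega x1.
      by split => // /interior_subset.
    by move=> /uv_boundary; lra.
  have [|h|h] := strong (v x1 - u x1).
  - by move=> x /OC/hx1; lra.
  (* If [v - u] were a positive constant in the domain, semicontinuity at a boundary point, where
     [v - u <= 0], would force a smaller value at nearby points of the domain. *)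
  - have [r r0 hr] := usc_inD (uC y0 (proj1 bd0)) (vC y0 (proj1 bd0)) x1m.
    have [y [Oy yr]] : Omega `&` [set y | sq (y - y0) < r] !=set0.
      by apply: (proj1 bd0); apply/nbhs_sqP; exists r.
    by have := hr y (OC y Oy) yr; have := h y Oy; have := uv_boundary y0 bd0; lra.
  - by move=> x _; have := h x1 Ox1; lra.
split => //.
have [|h|h] := strong 0.
- by move=> x /le; lra.
- by left => x /h; lra.
- by right => x /h; lra.
Qed.
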